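(* There exists a self-join-free Boolean conjunctive query $q$ such that $\#\mathsf{Comp}^u(\neg q)$ is $\mathrm{SpanP}$-complete under polynomial-time parsimonious reductions.
   Context: A Boolean conjunctive query is $\exists \bar x\,(R_1(\bar x_1)\land\dots\land R_m(\bar x_m))$ with $m\ge1$ atoms over variables (no constants); self-join-free if no two atoms share a relation symbol. $D\models\neg q$ iff $D\not\models q$. A uniform incomplete database is $D=(T,\mathsf{dom})$ with $T$ a finite set of facts over constants and nulls and $\mathsf{dom}$ one finite set of constants; a valuation maps each null to an element of $\mathsf{dom}$; the completion $\nu(D)$ is the resulting set of facts. $\#\mathsf{Comp}^u(\neg q)$: given a uniform incomplete database over the relation symbols of $q$, output the number of distinct completions $\nu(D)$ with $\nu(D)\not\models q$. $\mathrm{SpanP}$ is the class of functions $f$ for which there is a polynomial-time nondeterministic Turing machine with output $M$ such that $f(x)$ is the number of distinct outputs of accepting runs of $M$ on $x$. A parsimonious reduction from $A$ to $B$ is a polynomial-time computable $g$ with $A(x)=B(g(x))$. *)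

(* Defs.v *)
From HB Require Import structures.
From mathcomp Require Import all_boot.
From mathcomp Require Import finmap.
From Stdlib Require Import ClassicalEpsilon.

Set Implicit Arguments.
Unset Strict Implicit.
Unset Printing Implicit Defensive.

Local Open Scope fset_scope.

(* A Boolean CQ: a list of atoms (relation symbol, tuple of variables).
   Relation symbols and variables are natural numbers; there are no
   constants in the query.  All variables are existentially quantified. *)
Record bcq := BCQ { atoms : seq (nat * seq nat) }.

Definition cq_wf (q : bcq) : Prop := 0 < size (atoms q).

Definition self_join_free (q : bcq) : Prop := uniq (map fst (atoms q)).

(* A term of an incomplete database: inl c = constant c, inr z = null z. *)
Definition term := (nat + nat)%type.
(* A (possibly incomplete) fact: relation symbol and tuple of terms. *)
Definition ifact := (nat * seq term)%type.
Definition gfact := (nat * seq nat)%type.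

Record uidb := UIDB { idb_facts : seq ifact; idb_dom : seq nat }.

Definition over_schema (q : bcq) (D : uidb) : Prop :=
  forall f, f \in idb_facts D ->
    exists2 a, a \in atoms q & a.1 = f.1 /\ size a.2 = size f.2.

Definition models (q : bcq) (C : {fset gfact}) : Prop :=
  exists h : nat -> nat, forall a, a \in atoms q -> (a.1, map h a.2) \in C.

Definition nulls_of_fact (f : ifact) : seq nat :=
  [seq z | t <- f.2, z <- (match t with inl _ => [::] | inr z => [:: z] end)].

Definition nulls (D : uidb) : seq nat :=
  undup (flatten (map nulls_of_fact (idb_facts D))).

Fixpoint all_seqs (s : seq nat) (n : nat) : seq (seq nat) :=
  match n with
  | 0 => [:: [::]]
  | n'.+1 => [seq a :: r | a <- s, r <- all_seqs s n']
  end.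

Definition val_term (nu : nat -> nat) (t : term) : nat :=
  match t with inl c => c | inr z => nu z end.

Definition completion (nu : nat -> nat) (D : uidb) : {fset gfact} :=
  seq_fset tt [seq (f.1, map (val_term nu) f.2) | f <- idb_facts D].

Definition val_of (D : uidb) (a : seq nat) : nat -> nat :=
  fun z => nth 0 a (index z (nulls D)).

(* The set of all completions nu(D): valuations map every null of D into
   dom; the value of a valuation outside the nulls of D is irrelevant. *)
Definition completions (D : uidb) : {fset {fset gfact}} :=
  seq_fset tt [seq completion (val_of D a) D
              | a <- all_seqs (idb_dom D) (size (nulls D))].

Definition classical_bool (P : Prop) : bool :=
  if excluded_middle_informative P then true else false.

Definition count_comp_neg (q : bcq) (D : uidb) : nat :=
  #|` [fset C in completions D | classical_bool (~ models q C)] |.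

Local Close Scope fset_scope.

Fixpoint binary_fuel (fuel n : nat) : seq bool :=
  match fuel with
  | 0 => [::]
  | f.+1 => if n is 0 then [::] else odd n :: binary_fuel f n./2
  end.
Definition binary (n : nat) : seq bool := binary_fuel n n.

(* 4-bit markers, distinguishable from 2-bit data blocks [false; b] *)
Definition marker (i : nat) : seq bool := [:: true; odd i; odd i./2; odd (i %/ 4)].

Definition enc_num (n : nat) : seq bool :=
  flatten [seq [:: false; b] | b <- binary n] ++ marker 0.
Definition enc_term (t : term) : seq bool :=
  match t with inl c => marker 1 ++ enc_num c | inr z => marker 2 ++ enc_num z end.
Definition enc_fact (f : ifact) : seq bool :=
  marker 3 ++ enc_num f.1 ++ flatten (map enc_term f.2).
Definition enc_uidb (D : uidb) : seq bool :=
  flatten (map enc_fact (idb_facts D)) ++ marker 4 ++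
  flatten (map enc_num (idb_dom D)).

Definition CompU_neg (q : bcq) (w : seq bool) : nat :=
  match excluded_middle_informative
          (exists D, over_schema q D /\ enc_uidb D = w) with
  | left H => count_comp_neg q (proj1_sig (constructive_indefinite_description _ H))
  | right _ => 0
  end.

Inductive move := MoveL | MoveR | Stay.

Record TM := {
  tm_state : finType;
  tm_sym : finType;
  tm_blank : tm_sym;
  tm_in : bool -> tm_sym;
  tm_out : tm_sym -> option bool;
  tm_start : tm_state;
  tm_halt : tm_state -> bool;
  tm_accept : tm_state -> bool;   (* meaningful on halting states *)
  tm_delta : tm_state -> tm_sym -> seq (tm_state * tm_sym * move)
}.
Arguments tm_blank : clear implicits.
Arguments tm_in : clear implicits.
Arguments tm_out : clear implicits.
Arguments tm_start : clear implicits.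
Arguments tm_halt : clear implicits.
Arguments tm_accept : clear implicits.
Arguments tm_delta : clear implicits.

(* configuration: state, tape left of head (reversed), head symbol,
   tape right of head *)
Definition config (M : TM) :=
  (tm_state M * seq (tm_sym M) * tm_sym M * seq (tm_sym M))%type.

Definition init_config (M : TM) (x : seq bool) : config M :=
  match map (tm_in M) x with
  | [::] => (tm_start M, [::], tm_blank M, [::])
  | a :: r => (tm_start M, [::], a, r)
  end.

Definition do_move (M : TM) (q : tm_state M) (l : seq (tm_sym M))
    (a : tm_sym M) (r : seq (tm_sym M)) (m : move) : config M :=
  match m with
  | Stay => (q, l, a, r)
  | MoveL => match l with
             | [::] => (q, [::], tm_blank M, a :: r)
             | b :: l' => (q, l', b, a :: r)
             end
  | MoveR => match r with
             | [::] => (q, a :: l, tm_blank M, [::])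
             | b :: r' => (q, a :: l, b, r')
             end
  end.

Definition halted (M : TM) (c : config M) : bool := tm_halt M c.1.1.1.

Definition next (M : TM) (c : config M) : seq (config M) :=
  let: (q, l, a, r) := c in
  if tm_halt M q then [::]
  else [seq @do_move M t.1.1 l t.1.2 r t.2 | t <- tm_delta M q a].

Fixpoint frontier (M : TM) (x : seq bool) (k : nat) : seq (config M) :=
  match k with
  | 0 => [:: init_config M x]
  | k'.+1 => flatten (map (@next M) (frontier M x k'))
  end.

Definition halting_configs (M : TM) (x : seq bool) (k : nat) : seq (config M) :=
  flatten [seq [seq c <- frontier M x i | halted c] | i <- iota 0 k.+1].

Fixpoint read_out (M : TM) (s : seq (tm_sym M)) : seq bool :=
  match s with
  | [::] => [::]
  | a :: s' => match tm_out M a with Some b => b :: @read_out M s' | None => [::] end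
  end.
Definition output (M : TM) (c : config M) : seq bool :=
  let: (_, _, a, r) := c in @read_out M (a :: r).

(* every run of M on x halts within t steps *)
Definition halts_within (M : TM) (x : seq bool) (t : nat) : Prop :=
  frontier M x t.+1 = [::].

Definition deterministic (M : TM) : Prop :=
  forall q a, size (tm_delta M q a) <= 1.

Definition poly_time_computable (g : seq bool -> seq bool) : Prop :=
  exists (M : TM) (c k : nat), deterministic M /\
    forall x, let t := c * size x ^ k + c in
      halts_within M x t /\
      map (@output M) (halting_configs M x t) = [:: g x].

Definition SpanP (f : seq bool -> nat) : Prop :=
  exists (M : TM) (c k : nat),
    forall x, let t := c * size x ^ k + c in
      halts_within M x t /\
      f x = size (undup [seq output c | c <- halting_configs M x t
                                        & tm_accept M c.1.1.1]).

Definition parsimonious_reduction (A B : seq bool -> nat)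
    (g : seq bool -> seq bool) : Prop :=
  poly_time_computable g /\ forall x, A x = B (g x).

Definition SpanP_complete (f : seq bool -> nat) : Prop :=
  SpanP f /\
  forall h, SpanP h -> exists g, parsimonious_reduction h f g.

(* Main.v *)
(* The query is R(x,y,z,x,y,z).  A fact R(t1,t2,t3,u1,u2,u3) in which the t's are
   nulls and the u's are constants makes the query true exactly when the nulls
   take the values u, so a set of such facts forbids prescribed value triples:
   the valuations avoiding the query are the solutions of a ternary constraint
   problem.

   Hardness: the constraints encode the space-time tableau of a SpanP machine,
   and the output bits are null values.  Adding to the database all ground facts
   R(a,b,c,a',b',c') over the domain with (a,b,c) <> (a',b',c') makes the
   completion insensitive to everything but the facts R(2^(d+j), o_j, 0, 0, 0, 0),
   d the domain size, which expose the output bits o_j; hence distinct completions falsifying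
   the query correspond to distinct accepted outputs.

   Membership: the machine guesses a table of the valuation and the sorted list
   of the facts of the completion, verifies both, and outputs the list; sorting
   makes the output a function of the completion.

   Machines are obtained from a language of nested loops over bit stacks, whose
   programs run in polynomial time by construction, and the verification is a
   first-order formula, evaluated by such a program. *)

From HB Require Import structures.
Require Import Defs.
From mathcomp Require Import all_boot zify finmap.
From Stdlib Require Import FunctionalExtensionality ClassicalEpsilon.

Set Implicit Arguments.
Unset Strict Implicit.
Unset Printing Implicit Defensive.

(** * Halting outcomes of nondeterministic machines *)

(** Three variables suffice because the tableau is centred on the head: in each row one null carries
    state, scanned symbol and chosen transition. It alone determines the move, so a transition
    constraint involves it and at most two further nulls. All nulls share one domain, so a domain
    element is a record with every component. Components that mean nothing at a tape null stay free,
    which is harmless because the completion hides them; an output null is forced to be one fixed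
    record, so that an output fixes its visible facts. The constants 2^(d+j) lie outside the domain,
    so the facts showing the output collide with no other ground fact; they are not 0, so these
    facts never match the query; and in binary they are a run of zeros closed by a one, which a
    program can print from unary counters without arithmetic. The names of the nulls are chosen for
    the same reason. Phrasing the verification as a formula leaves a single correctness proof about
    code, by induction on formulas; all else on the membership side concerns lists of facts. *)

Section Outcomes.

Variables (C : Type) (step : C -> seq C) (hlt : pred C).

(** Every branch from [c] ends within [n] steps, in a leaf related by [R] to an abstract outcome or
    in a dead end, which contributes nothing. A leaf need not be halting, so statements about
    program fragments compose. *)
Fixpoint outc (A : Type) (R : A -> C -> Prop) (n : nat) (c : C) (S : seq A) :
    Prop :=
  (exists2 s, R s c & S = [:: s]) \/
  if n is n'.+1 then
    ~~ hlt c /\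
    exists2 Ss, List.Forall2 (outc R n') (step c) Ss & S = flatten Ss
  else False.

Lemma outc_leaf (A : Type) (R : A -> C -> Prop) n c s :
  R s c -> outc R n c [:: s].
Proof. by move=> Rsc; case: n => [|n]; left; exists s. Qed.

Lemma outc_mono (A : Type) (R : A -> C -> Prop) m n c S :
  m <= n -> outc R m c S -> outc R n c S.
Proof.
elim: m n c S => [|m IH] [|n] c S //=.
- by move=> _ [|[]] //; left.
- move=> le_mn [|[hc [Ss HSs ->]]]; first by left.
  right; split=> //; exists Ss => //.
  elim: HSs => [|c' S' cs Ss' H _ IH2]; constructor => //.
  exact: IH H.
Qed.

(** Each leaf of the first tree is expanded by its own tree. The premise [List.In s S] lets the
    continuation use bounds that hold only for actual outcomes, such as [exec_size]. *)
Lemma outc_bind (A B : Type) (R : A -> C -> Prop) (R' : B -> C -> Prop)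
    n m c S (g : A -> seq B) :
  outc R n c S ->
  (forall s c', List.In s S -> R s c' -> outc R' m c' (g s)) ->
  outc R' (n + m) c (flatten (map g S)).
Proof.
elim: n c S => [|n IH] c S /=.
- by case=> // -[s Rsc ->] Hg /=; rewrite cats0; apply: Hg => //; left.
- case=> [[s Rsc ->]|[hc [Ss HSs ->]]] /= Hg.
    rewrite cats0; apply: (outc_mono (m := m) (n := (n + m).+1)); first lia.
    by apply: Hg => //; left.
  right; split=> //; exists (map (fun S => flatten (map g S)) Ss).
    elim: HSs Hg => [|c' S' cs Ss' H _ IH2] Hg; constructor => //.
      by apply: IH => // s c1 Hs; apply: Hg; apply/List.in_or_app; left.
    by apply: IH2 => s c1 Hs; apply: Hg; apply/List.in_or_app; right.
  by elim: Ss {HSs Hg} => //= S' Ss <-; rewrite map_cat flatten_cat.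
Qed.

Lemma outc_seq (A B : Type) (R : A -> C -> Prop) (R' : B -> C -> Prop)
    n m c s S :
  outc R n c [:: s] -> (forall c', R s c' -> outc R' m c' S) ->
  outc R' (n + m) c S.
Proof.
move=> H Hg; have := @outc_bind _ _ R R' n m c [:: s] (fun=> S) H.
by rewrite /= cats0; apply=> s' c' [<-|[]]; apply: Hg.
Qed.

Lemma outc_step (A : Type) (R : A -> C -> Prop) n c c' S :
  ~~ hlt c -> step c = [:: c'] -> outc R n c' S -> outc R n.+1 c S.
Proof.
move=> hc E H; right; split=> //; exists [:: S]; last by rewrite /= cats0.
by rewrite E; constructor => //; constructor.
Qed.

(** Unfolds at the root, as [outc] does, whereas [frontier] unfolds at the leaves; [front_rcons]
    reconciles them. *)
Fixpoint front (k : nat) (c : C) : seq C :=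
  if k is k'.+1 then flatten (map (front k') (step c)) else [:: c].

Lemma front_rcons k c : flatten (map step (front k c)) = front k.+1 c.
Proof.
elim: k c => [|k IH] c /=; first by rewrite cats0 flatten_seq1.
rewrite -[RHS]/(flatten (map (front k.+1) (step c))).
elim: (step c) => //= c' cs <-.
by rewrite map_cat flatten_cat IH.
Qed.

Definition hconfs (k : nat) (c : C) : seq C :=
  flatten [seq [seq c' <- front i c | hlt c'] | i <- iota 0 k.+1].

Lemma count_hconfs p k c :
  count p (hconfs k c) = \sum_(i < k.+1) count (predI p hlt) (front i c).
Proof.
rewrite /hconfs count_flatten -map_comp sumnE big_map -[iota _ _]/(index_iota 0 k.+1).
by rewrite big_mkord; apply: eq_bigr => i _ /=; rewrite count_filter.
Qed.

Lemma count_hconfsS p k c :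
  count p (hconfs k.+1 c) =
    (p c && hlt c) + \sum_(c' <- step c) count p (hconfs k c').
Proof.
rewrite count_hconfs big_ord_recl /= addn0; congr (_ + _).
under [RHS]eq_bigr do rewrite count_hconfs.
rewrite exchange_big /=; apply: eq_bigr => i _.
by rewrite count_flatten -map_comp sumnE big_map.
Qed.

Hypothesis hlt_stop : forall c, hlt c -> step c = [::].

(** Only a permutation can be expected: [hconfs] lists configurations level by level, [S] branch by
    branch. Counting under an arbitrary predicate is additive over branches, which gives the
    induction. *)
Lemma outc_halting (A : eqType) (out : C -> A) n c S :
  outc (fun s c => hlt c /\ out c = s) n c S ->
  front n.+1 c = [::] /\ perm_eq (map out (hconfs n c)) S.
Proof.
have base k c0 s : hlt c0 /\ out c0 = s ->
    front k.+1 c0 = [::] /\ perm_eq (map out (hconfs k c0)) [:: s].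
  case=> hc <-; split; first by rewrite /= hlt_stop.
  apply/permP => p; rewrite count_map; case: k => [|k].
    by rewrite /hconfs /= hc /= addn0.
  by rewrite count_hconfsS hc andbT hlt_stop //= big_nil.
elim: n c S => [|n IH] c S; first by case=> // -[s Hs ->]; apply: base.
case=> [[s Hs ->]|[hc [Ss HSs ->]]]; first exact: base.
split.
  rewrite [LHS]/= -[flatten _]/(flatten (map (front n.+1) (step c))).
  elim: HSs => //= c' S' cs Ss' /IH [E _] _ ->.
  by rewrite cats0 -[flatten _]/(front n.+1 c') E.
apply/permP => p; rewrite count_map count_hconfsS (negPf hc) andbF add0n.
elim: HSs => [|c' S' cs Ss' /IH [_ /permP E] _ IH2]; first by rewrite big_nil.
by rewrite big_cons /= count_cat -IH2 -E count_map.
Qed.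

End Outcomes.
Arguments outc : simpl never.

(** * Programs over bit stacks and their single-tape machines *)

Definition tvar := (nat * option bool)%type.
Definition store := tvar -> seq bool.
Definition supd (E : store) (v : tvar) (s : seq bool) : store :=
  fun u => if u == v then s else E u.

Inductive cmd :=
| CSkip
| CPush of tvar & bool
| CGuess of tvar
| CFail
| CCase of tvar & cmd & cmd & cmd
| CSeq of cmd & cmd
| CWhile of tvar & cmd.

Lemma cmd_eq_dec (x y : cmd) : {x = y} + {x <> y}.
Proof. by decide equality; apply: eq_comparable. Qed.

HB.instance Definition _ := hasDecEq.Build cmd (compareP cmd_eq_dec).

(* The continuations [c :: K] reachable while executing [c] in front of [K];
   they serve as control states. *)
Fixpoint pts (c : cmd) (K : seq cmd) : seq (seq cmd) :=
  (c :: K) :: match c with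
  | CCase _ p q r => pts p K ++ pts q K ++ pts r K
  | CSeq p q => pts p (q :: K) ++ pts q K
  | CWhile _ p => pts p (c :: K)
  | _ => [::]
  end.

Fixpoint wfc (n : nat) (c : cmd) : bool :=
  match c with
  | CSkip | CFail => true
  | CPush v _ | CGuess v => v.1 <= n
  | CCase v p q r => [&& v.1 <= n, wfc n p, wfc n q & wfc n r]
  | CSeq p q => wfc n p && wfc n q
  | CWhile v p => (v.1 <= n) && wfc n p
  end.

Section Machine.

Variables (n : nat) (c0 : cmd) (ov : nat) (nd : bool).

Definition track : finType := ('I_n.+1 * option bool)%type.
(** Each stack has a track of its own, bottom at cell 0, so its top is the last filled cell. The
    Boolean marks cell 0, which the head must recognise on a tape that extends in both
    directions. *)
Definition tsym : finType := (bool * {ffun track -> option bool})%type.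

Definition key (v : tvar) : track := (inord v.1, v.2).
Definition get (a : tsym) (v : tvar) : option bool := a.2 (key v).
Definition put (a : tsym) (v : tvar) (o : option bool) : tsym :=
  (a.1, [ffun t => if t == key v then o else a.2 t]).

Definition points : seq (seq cmd) := rcons (pts c0 [::]) [::].

(* [None] is the initial state; in [Some (k, ph)] the phase [ph] is
   [Some true] when executing the command at the head of point [k],
   [Some false] one step before popping, [None] on the way back to cell 0. *)
Definition tstate : finType :=
  option ('I_(size points).+1 * option bool)%type.

Definition at_pt (K : seq cmd) (ph : option bool) : tstate :=
  Some (inord (index K points), ph).
Definition code (k : 'I_(size points).+1) : seq cmd := nth [::] points k.

(** A case distinction and a loop test both pop a stack, so they share one treatment: a continuation
    for the empty stack and one for each popped bit. *)
Definition pops (K : seq cmd) :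
    option (tvar * seq cmd * (bool -> seq cmd)) :=
  match K with
  | CCase v p q r :: K' =>
      Some (v, p :: K', fun b : bool => (if b then r else q) :: K')
  | CWhile v p :: K' => Some (v, K', fun=> p :: K)
  | _ => None
  end.

Definition act_delta (q : tstate) (k : 'I_(size points).+1) (a : tsym) :
    seq (tstate * tsym * move) :=
  match code k with
  | CSkip :: K => [:: (at_pt K (Some true), a, Stay)]
  | CPush v b :: K =>
      if get a v is Some _ then [:: (q, a, MoveR)]
      else [:: (at_pt K None, put a v (Some b), Stay)]
  | CGuess v :: K =>
      if get a v is Some _ then [:: (q, a, MoveR)]
      else [seq (at_pt K None, put a v o, Stay)
           | o <- [:: None; Some false; Some true]]
  | CSeq c1 c2 :: K => [:: (at_pt [:: c1, c2 & K] (Some true), a, Stay)]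
  | K => if pops K is Some (v, K0, _) then
           if get a v is Some _ then [:: (q, a, MoveR)]
           else if a.1 then [:: (at_pt K0 (Some true), a, Stay)]
           else [:: (Some (k, Some false), a, MoveL)]
         else [::]
  end.

Definition mark (a : tsym) : tsym :=
  (true, [ffun t => if t.2 == Some true then Some true else a.2 t]).

Definition full_delta (q : tstate) (a : tsym) : seq (tstate * tsym * move) :=
  match q with
  | None => [:: (at_pt [:: c0] (Some true), mark a, Stay)]
  | Some (k, None) =>
      if a.1 then [:: (Some (k, Some true), a, Stay)] else [:: (q, a, MoveL)]
  | Some (k, Some true) => act_delta q k a
  | Some (k, Some false) =>
      if pops (code k) is Some (v, _, Kb) then
        if get a v is Some b then [:: (at_pt (Kb b) None, put a v None, Stay)]
        else [::]
      else [::]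
  end.

(** Truncation makes determinism hold by construction; it cuts something only at [CGuess]. *)
Definition delta (q : tstate) (a : tsym) : seq (tstate * tsym * move) :=
  if nd then full_delta q a else take 1 (full_delta q a).

Definition tblank : tsym := (false, [ffun=> None]).
(** The input symbols themselves carry a unary copy of the input length on every fuel track, so loop
    bounds need no computation; [mark] fills cell 0 in case the input is empty. *)
Definition tin (b : bool) : tsym :=
  (false, [ffun t => if t.2 == Some true then Some true
                     else if t == (ord0, None) then Some b else None]).
Definition thalt (q : tstate) : bool :=
  if q is Some (k, Some true) then code k == [::] else false.

(** Every halting state accepts: a rejecting branch gets stuck at [CFail] in a non-halting state and
    so yields no halting configuration. *)
Definition mach : TM :=
  {| tm_state := tstate; tm_sym := tsym; tm_blank := tblank; tm_in := tin;
     tm_out := fun a => get a (ov, None); tm_start := None; tm_halt := thalt;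
     tm_accept := fun=> true; tm_delta := delta |}.

Lemma mach_deterministic : ~~ nd -> deterministic mach.
Proof.
by move=> hnd q a; rewrite /= /delta (negPf hnd) size_take; case: ltnP.
Qed.

Definition tape := nat -> tsym.
Definition tupd (t : tape) (p : nat) (a : tsym) : tape :=
  fun i => if i == p then a else t i.
(** Configurations hold finite lists while [t] is total; [L] is the extent written out so far.
    Moving right past it creates a blank, hence the condition in [next_right] that [t] is blank from
    [L] on. *)
Definition mk (q : tstate) (t : tape) (p L : nat) : config mach :=
  (q, rev (mkseq t p), t p, [seq t i | i <- iota p.+1 (L - p.+1)]).

Lemma tupd_id t p : tupd t p (t p) = t.
Proof. by apply: functional_extensionality => i; rewrite /tupd; case: eqP => // ->. Qed.

Lemma mk_upd q t p L a :
  mk q (tupd t p a) p L =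
  (q, rev (mkseq t p), a, [seq t i | i <- iota p.+1 (L - p.+1)]).
Proof.
rewrite /mk /tupd eqxx; congr (_, rev _, _, _).
  by apply/eq_in_map => i; rewrite mem_iota; case: eqP => //; lia.
by apply/eq_in_map => i; rewrite mem_iota; case: eqP => //; lia.
Qed.

Lemma next_mk q t p L :
  Defs.next (mk q t p L) =
  if thalt q then [::] else
  [seq @do_move mach u.1.1 (rev (mkseq t p)) u.1.2
        [seq t i | i <- iota p.+1 (L - p.+1)] u.2 | u <- delta q (t p)].
Proof. by []. Qed.

Lemma next_stay q q' t p L a :
  ~~ thalt q -> delta q (t p) = [:: (q', a, Stay)] ->
  Defs.next (mk q t p L) = [:: mk q' (tupd t p a) p L].
Proof. by move=> /negPf hq E; rewrite next_mk hq E /= mk_upd. Qed.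

Lemma next_right q q' t p L :
  ~~ thalt q -> delta q (t p) = [:: (q', t p, MoveR)] ->
  p < L -> (forall i, L <= i -> t i = tblank) ->
  Defs.next (mk q t p L) = [:: mk q' t p.+1 (maxn L p.+2)].
Proof.
move=> /negPf hq E lt_pL Lblank; rewrite next_mk hq E /= /mk mkseqS rev_rcons.
case: (ltnP p.+1 L) => hp.
  rewrite (_ : L - p.+1 = (L - p.+2).+1) /=; last lia.
  by rewrite (maxn_idPl _) //; lia.
have -> : L = p.+1 by lia.
rewrite subnn (maxn_idPr _) // subnn /=.
by rewrite (Lblank p.+1 hp).
Qed.

Lemma next_left q q' t p L :
  ~~ thalt q -> delta q (t p.+1) = [:: (q', t p.+1, MoveL)] ->
  p.+1 < L -> Defs.next (mk q t p.+1 L) = [:: mk q' t p L].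
Proof.
move=> /negPf hq E lt_pL; rewrite next_mk hq E /= /mk mkseqS rev_rcons.
by rewrite (_ : L - p.+1 = (L - p.+2).+1) //=; lia.
Qed.

Local Notation outcm := (outc (@Defs.next mach) (@halted mach)).

Section Runs.

Variables (A : Type) (R : A -> config mach -> Prop) (S : seq A).

Lemma delta1 q a u : full_delta q a = [:: u] -> delta q a = [:: u].
Proof. by rewrite /delta => ->; case: nd. Qed.

Lemma run_return m k t p L :
  (forall i, (t i).1 = (i == 0)) -> p < L ->
  outcm R m (mk (Some (k, Some true)) t 0 L) S ->
  outcm R (m + p.+1) (mk (Some (k, None)) t p L) S.
Proof.
move=> mrk + H; elim: p => [|p IH] lt_pL; rewrite addnS.
  rewrite addn0; apply: outc_step H => //.
  rewrite -[X in [:: mk _ X _ _]](tupd_id t 0).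
  by apply: next_stay => //; apply: delta1; rewrite /= mrk.
apply: outc_step (IH _); [by [] | | lia].
by apply: next_left => //; apply: delta1; rewrite /= mrk.
Qed.

Lemma run_scan m k t d p L :
  (forall i, p <= i < p + d ->
     act_delta (Some (k, Some true)) k (t i) =
       [:: (Some (k, Some true), t i, MoveR)]) ->
  code k != [::] -> p < L -> (forall i, L <= i -> t i = tblank) ->
  outcm R m (mk (Some (k, Some true)) t (p + d) (maxn L (p + d).+1)) S ->
  outcm R (m + d) (mk (Some (k, Some true)) t p L) S.
Proof.
move=> Hd hk; elim: d p L Hd => [|d IH] p L Hd lt_pL Lblank.
  by rewrite !addn0 (maxn_idPl _).
rewrite !addnS => H; apply: outc_step.
- exact: hk.
- apply: next_right => //; apply: delta1.
  by apply: Hd; lia.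
- apply: IH => [i hi | | i hi |]; try lia; first by apply: Hd; lia.
    by apply: Lblank; lia.
  by rewrite -maxnA addSn (maxn_idPr (_ : p.+2 <= _)) //; lia.
Qed.

End Runs.

Definition cell (E : store) (p : nat) : tsym :=
  (p == 0, [ffun t : track => onth (rev (E (val t.1, t.2))) p]).

Lemma key_eq (v : tvar) (t : track) :
  v.1 <= n -> (t == key v) = ((val t.1, t.2) == v).
Proof.
case: v t => [v s] [i s'] /= hv; rewrite /key /= !xpair_eqE.
by rewrite -val_eqE /= inordK.
Qed.

Lemma get_cell E p v : v.1 <= n -> get (cell E p) v = onth (rev (E v)) p.
Proof. by move=> hv; rewrite /get ffunE /= inordK //; case: v hv. Qed.

Lemma tape_eq (t t' : tape) : (forall i, (t i).1 = (t' i).1) ->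
  (forall i k, (t i).2 k = (t' i).2 k) -> t = t'.
Proof.
move=> H1 H2; apply: functional_extensionality => i.
have := H1 i; have: (t i).2 = (t' i).2 by apply/ffunP.
by case: (t i) => ? ?; case: (t' i) => ? ? /= -> ->.
Qed.

Lemma tupd_cell E v p o s : v.1 <= n ->
  onth (rev s) p = o ->
  (forall i, i != p -> onth (rev s) i = onth (rev (E v)) i) ->
  tupd (cell E) p (put (cell E p) v o) = cell (supd E v s).
Proof.
move=> hv Ho Hs; apply: tape_eq => [i|i t]; rewrite /tupd; case: eqP => //=.
  by move->.
  move=> ->; rewrite !ffunE key_eq // /supd; case: eqP => // _.
move=> /eqP ip; rewrite !ffunE /supd; case: eqP => // ->.
by rewrite Hs.
Qed.

Lemma cell_push E v b : v.1 <= n ->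
  tupd (cell E) (size (E v)) (put (cell E (size (E v))) v (Some b)) =
  cell (supd E v (b :: E v)).
Proof.
move=> hv; apply: tupd_cell => // [|i hi]; rewrite rev_cons -cats1 onth_cat size_rev.
  by rewrite ltnn subnn.
case: ltngtP hi => // hi _; rewrite !onth_default ?size_rev //=; lia.
Qed.

Lemma cell_pop E v b s : v.1 <= n -> E v = b :: s ->
  tupd (cell E) (size s) (put (cell E (size s)) v None) = cell (supd E v s).
Proof.
move=> hv Ev; apply: tupd_cell => // [|i hi].
  by rewrite onth_default ?size_rev.
rewrite Ev rev_cons -cats1 onth_cat size_rev.
case: ltngtP hi => // hi _; rewrite !onth_default ?size_rev //=; lia.
Qed.

Lemma cell_none E v : v.1 <= n ->
  tupd (cell E) (size (E v)) (put (cell E (size (E v))) v None) = cell E.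
Proof.
move=> hv; rewrite (@tupd_cell _ _ _ _ (E v)) //.
  by congr cell; apply: functional_extensionality => u; rewrite /supd; case: eqP => // ->.
by rewrite onth_default ?size_rev.
Qed.

Definition rep (s : seq cmd * store) (c : config mach) : Prop :=
  exists L, [/\ c = mk (at_pt s.1 (Some true)) (cell s.2) 0 L, 0 < L &
                forall v, v.1 <= n -> size (s.2 v) <= L].

Lemma code_at K : K \in points -> code (inord (index K points)) = K.
Proof.
move=> hK; rewrite /code inordK ?nth_index //.
by rewrite ltnS ltnW // index_mem.
Qed.

Lemma cell_blank E L : 0 < L -> (forall v, v.1 <= n -> size (E v) <= L) ->
  forall i, L <= i -> cell E i = tblank.
Proof.
move=> L0 HL i hi; rewrite /cell /tblank; congr (_, _); first lia.
apply/ffunP => t; rewrite !ffunE onth_default // size_rev.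
by apply: leq_trans (HL _ _) hi => /=; rewrite -ltnS.
Qed.

Lemma run_stay K K' E c : K \in points -> K != [::] ->
  (forall k a, code k = K -> act_delta (Some (k, Some true)) k a =
     [:: (at_pt K' (Some true), a, Stay)]) ->
  rep (K, E) c -> outcm rep 1 c [:: (K', E)].
Proof.
move=> hK nK Hd [L [/= -> L0 HL]].
apply: (outc_step (c' := mk (at_pt K' (Some true)) (cell E) 0 L)).
- by rewrite /halted /= code_at.
- rewrite -[X in [:: mk _ X _ _]](tupd_id _ 0).
  apply: next_stay; first by rewrite /= code_at.
  by apply: delta1; rewrite /= Hd // code_at.
- by apply: outc_leaf; exists L.
Qed.

Lemma run_to_top A (R : A -> config mach -> Prop) S m K E L v :
  K \in points -> K != [::] -> v.1 <= n ->
  0 < L -> (forall v, v.1 <= n -> size (E v) <= L) ->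
  (forall k a b, code k = K -> get a v = Some b ->
     act_delta (Some (k, Some true)) k a = [:: (Some (k, Some true), a, MoveR)]) ->
  outcm R m (mk (at_pt K (Some true)) (cell E) (size (E v))
               (maxn L (size (E v)).+1)) S ->
  outcm R (m + size (E v)) (mk (at_pt K (Some true)) (cell E) 0 L) S.
Proof.
move=> hK nK hv L0 HL Hd H; apply: run_scan => //; [ | by rewrite code_at | exact: cell_blank].
  move=> i /andP[_ hi]; have := get_cell E i hv.
  have: i < size (rev (E v)) by rewrite size_rev.
  rewrite -onthTE; case: onth => // b _ hb.
  by apply: Hd hb; rewrite code_at.
Qed.

Lemma run_push K E v b c H : (CPush v b :: K) \in points -> v.1 <= n ->
  size (E v) <= H -> rep (CPush v b :: K, E) c ->
  outcm rep (2 * H + 3) c [:: (K, supd E v (b :: E v))].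
Proof.
move=> hK hv hH [L [/= -> L0 HL]].
set h := size (E v) in hH *.
(* [h] steps up the track, one to write, [h.+1] back to cell 0 and into the executing phase. *)
apply: (@outc_mono _ _ _ _ _ ((0 + h.+1).+1 + h)); first lia.
apply: run_to_top => //.
  by move=> k a b' Ek Ha; rewrite /act_delta Ek Ha.
apply: (outc_step (c' := mk (at_pt K None) (cell (supd E v (b :: E v))) h
                           (maxn L h.+1))).
- by rewrite /halted /= code_at.
- rewrite -cell_push //; apply: next_stay; first by rewrite /= code_at.
  apply: delta1; rewrite /= /act_delta code_at // get_cell //.
  by rewrite onth_default ?size_rev.
- apply: run_return => //; first lia.
  apply: outc_leaf; exists (maxn L h.+1); split=> //=; first lia.
  move=> u hu; rewrite /supd; case: eqP => [_|_] /=; first by rewrite -/h; lia.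
  by rewrite leq_max HL.
Qed.

Lemma run_guess K E v c H : nd -> (CGuess v :: K) \in points -> v.1 <= n ->
  size (E v) <= H -> rep (CGuess v :: K, E) c ->
  outcm rep (2 * H + 3) c [:: (K, E); (K, supd E v (false :: E v));
                              (K, supd E v (true :: E v))].
Proof.
move=> hnd hK hv hH [L [/= -> L0 HL]].
set h := size (E v) in hH *.
apply: (@outc_mono _ _ _ _ _ ((0 + h.+1).+1 + h)); first lia.
apply: run_to_top => //.
  by move=> k a b' Ek Ha; rewrite /act_delta Ek Ha.
have Edel : delta (at_pt (CGuess v :: K) (Some true)) (cell E h) =
    [seq (at_pt K None, put (cell E h) v o, Stay)
    | o <- [:: None; Some false; Some true]].
  rewrite /delta hnd /= /act_delta code_at // get_cell //.
  by rewrite onth_default ?size_rev.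
have wr E' t : (forall u, u.1 <= n -> size (E' u) <= maxn L h.+1) ->
    t = cell E' ->
    outcm rep (0 + h.+1) (mk (at_pt K None) t h (maxn L h.+1)) [:: (K, E')].
  move=> HE' ->; apply: run_return => //; first lia.
  by apply: outc_leaf; exists (maxn L h.+1); split=> //=; lia.
right; split; first by rewrite /halted /= code_at.
exists [:: [:: (K, E)]; [:: (K, supd E v (false :: E v))];
           [:: (K, supd E v (true :: E v))]] => //.
rewrite next_mk Edel /thalt /= code_at //=.
have szb b u : u.1 <= n -> size (supd E v (b :: E v) u) <= maxn L h.+1.
  move=> hu; rewrite /supd; case: eqP => [_|_] /=; first by rewrite -/h; lia.
  by rewrite leq_max HL.
constructor.
  rewrite -mk_upd cell_none //; apply: wr => // u hu.
  by rewrite leq_max HL.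
constructor; first by rewrite -mk_upd; apply: wr; [exact: szb | exact: cell_push].
constructor; last by constructor.
by rewrite -mk_upd; apply: wr; [exact: szb | exact: cell_push].
Qed.

Lemma act_delta_pop K v K0 Kb k a : code k = K -> pops K = Some (v, K0, Kb) ->
  act_delta (Some (k, Some true)) k a =
    if get a v is Some _ then [:: (Some (k, Some true), a, MoveR)]
    else if a.1 then [:: (at_pt K0 (Some true), a, Stay)]
    else [:: (Some (k, Some false), a, MoveL)].
Proof.
rewrite /act_delta => ->.
by case: K => [|[|u b|u||u p q r|p q|u p] K] //= [<- <- _].
Qed.

Lemma run_pop_nil K E v K0 Kb c : K \in points -> v.1 <= n ->
  pops K = Some (v, K0, Kb) -> E v = [::] -> rep (K, E) c ->
  outcm rep 1 c [:: (K0, E)].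
Proof.
move=> hK hv HK Ev [L [/= -> L0 HL]].
have nK : K != [::] by case: (K) HK.
apply: (outc_step (c' := mk (at_pt K0 (Some true)) (cell E) 0 L)).
- by rewrite /halted /= code_at.
- rewrite -[X in [:: mk _ X _ _]](tupd_id _ 0).
  apply: next_stay; first by rewrite /= code_at.
  apply: delta1; rewrite [LHS](act_delta_pop _ (code_at hK) HK).
  by rewrite get_cell // Ev.
- by apply: outc_leaf; exists L.
Qed.

Lemma run_pop_cons K E v K0 Kb b s c H : K \in points -> v.1 <= n ->
  pops K = Some (v, K0, Kb) -> Kb b \in points -> E v = b :: s ->
  size (E v) <= H -> rep (K, E) c ->
  outcm rep (2 * H + 3) c [:: (Kb b, supd E v s)].
Proof.
move=> hK hv HK hKb Ev hH [L [/= -> L0 HL]].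
have nK : K != [::] by case: (K) HK.
set h := size (E v) in hH *.
have Eh : h = (size s).+1 by rewrite /h Ev.
apply: (@outc_mono _ _ _ _ _ ((0 + (size s).+1).+2 + h)); first lia.
apply: run_to_top => //.
  by move=> k a b' Ek Ha; rewrite (act_delta_pop _ Ek HK) Ha.
rewrite -/h Eh.
apply: (outc_step (c' := mk (Some (inord (index K points), Some false))
                           (cell E) (size s) (maxn L (size s).+2))).
- by rewrite /halted /= code_at.
- apply: next_left; first by rewrite /= code_at.
    apply: delta1; rewrite [LHS](act_delta_pop _ (code_at hK) HK) get_cell //.
    by rewrite onth_default ?size_rev // Ev.
  lia.
apply: (outc_step (c' := mk (at_pt (Kb b) None) (cell (supd E v s)) (size s)
                           (maxn L (size s).+2))) => //.
- rewrite -(cell_pop hv Ev); apply: next_stay => //.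
  apply: delta1; rewrite /= code_at // HK get_cell // Ev rev_cons -cats1.
  by rewrite onth_cat size_rev ltnn subnn.
- apply: run_return => //; first lia.
  apply: outc_leaf; exists (maxn L (size s).+2); split=> //=; first lia.
  move=> u hu; rewrite /supd; case: eqP => [_|_] /=; first lia.
  by rewrite leq_max HL.
Qed.

End Machine.

(** * Bounded loops *)

Inductive prog :=
| Skip
| Push of nat & bool
| Guess of nat
| Fail
| Case of nat & prog & prog & prog
| Seq of prog & prog
| Loop of prog.

Definition env := nat -> seq bool.
Definition upd (e : env) (v : nat) (s : seq bool) : env :=
  fun u => if u == v then s else e u.

Fixpoint loop (f : env -> seq env) (k : nat) (e : env) : seq env :=
  if k is k'.+1 then flatten (map (loop f k') (f e)) else [:: e].

(* [Loop] runs its body exactly [N] times, for a global parameter [N]. *)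
Fixpoint exec (N : nat) (p : prog) (e : env) : seq env :=
  match p with
  | Skip => [:: e]
  | Push v b => [:: upd e v (b :: e v)]
  | Guess v => [:: e; upd e v (false :: e v); upd e v (true :: e v)]
  | Fail => [::]
  | Case v p q r =>
      match e v with
      | [::] => exec N p e
      | b :: s => (if b then exec N r else exec N q) (upd e v s)
      end
  | Seq p q => flatten (map (exec N q) (exec N p e))
  | Loop p => loop (exec N p) N e
  end.

Fixpoint det (p : prog) : bool :=
  match p with
  | Skip | Push _ _ => true
  | Guess _ | Fail => false
  | Case _ p q r => [&& det p, det q & det r]
  | Seq p q => det p && det q
  | Loop p => det p
  end.

Fixpoint run (N : nat) (p : prog) (e : env) : env :=
  match p with
  | Skip | Guess _ | Fail => e
  | Push v b => upd e v (b :: e v)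
  | Case v p q r =>
      match e v with
      | [::] => run N p e
      | b :: s => (if b then run N r else run N q) (upd e v s)
      end
  | Seq p q => run N q (run N p e)
  | Loop p => iter N (run N p) e
  end.

Lemma exec_det N p e : det p -> exec N p e = [:: run N p e].
Proof.
elim: p e => //=.
- move=> v p IHp q IHq r IHr e /and3P[hp hq hr].
  by case: (e v) => [|[] s]; [rewrite IHp | rewrite IHr | rewrite IHq].
- by move=> p IHp q IHq e /andP[hp hq]; rewrite IHp //= cats0 IHq.
- move=> p IHp e hp.
  suff H k : loop (exec N p) k e = [:: iter k (run N p) e] by exact: H.
  elim: k e => //= k IHk e.
  by rewrite IHp //= cats0 IHk -iterSr.
Qed.

Fixpoint dep (p : prog) : nat :=
  match p with
  | Case _ p q r => maxn (dep p) (maxn (dep q) (dep r))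
  | Seq p q => maxn (dep p) (dep q)
  | Loop p => (dep p).+1
  | _ => 0
  end.

Fixpoint maxvar (p : prog) : nat :=
  match p with
  | Skip | Fail => 0
  | Push v _ | Guess v => v
  | Case v p q r => maxn v (maxn (maxvar p) (maxn (maxvar q) (maxvar r)))
  | Seq p q => maxn (maxvar p) (maxvar q)
  | Loop p => maxvar p
  end.

Definition dvar (v : nat) : tvar := (v, None).
(* Loop counters: [fuel j] holds the remaining iterations of a loop of nesting
   height [j] in unary, [spent j] the finished ones. *)
Definition fuel (j : nat) : tvar := (j, Some true).
Definition spent (j : nat) : tvar := (j, Some false).

(** The second loop refills [fuel] from [spent], so loops of equal height can share a counter; an
    enclosing loop has greater height and hence another counter. *)
Fixpoint compile (p : prog) : cmd :=
  match p with
  | Skip => CSkip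
  | Push v b => CPush (dvar v) b
  | Guess v => CGuess (dvar v)
  | Fail => CFail
  | Case v p q r => CCase (dvar v) (compile p) (compile q) (compile r)
  | Seq p q => CSeq (compile p) (compile q)
  | Loop p => CSeq (CWhile (fuel (dep p)) (CSeq (CPush (spent (dep p)) true) (compile p)))
                   (CWhile (spent (dep p)) (CPush (fuel (dep p)) true))
  end.

(** An iteration costs five operations beyond its body: popping [fuel], a sequencing step, pushing
    [spent], and later popping [spent] and pushing [fuel]. The final 3 are the outer sequencing step
    and the two loop tests that find an empty stack. *)
Fixpoint cost (N : nat) (p : prog) : nat :=
  match p with
  | Skip | Fail | Push _ _ | Guess _ => 1
  | Case _ p q r => 1 + cost N p + cost N q + cost N r
  | Seq p q => 1 + cost N p + cost N q
  | Loop p => N * (cost N p + 5) + 3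
  end.

Lemma cost_poly p : exists C d, forall N, 0 < N -> cost N p <= C * N ^ d.
Proof.
have mono C d d' N : 0 < N -> d <= d' -> C * N ^ d <= C * N ^ d'.
  by move=> hN hd; rewrite leq_mul2l leq_pexp2l ?orbT.
have one : exists C d, forall N, 0 < N -> 1 <= C * N ^ d.
  by exists 1, 0 => N hN; rewrite expn0.
elim: p => //=.
- move=> _ p [C1 [d1 H1]] q [C2 [d2 H2]] r [C3 [d3 H3]].
  exists (1 + C1 + C2 + C3), (d1 + d2 + d3) => N hN.
  have := H1 N hN; have := H2 N hN; have := H3 N hN.
  have := @mono C1 d1 (d1 + d2 + d3) N hN.
  have := @mono C2 d2 (d1 + d2 + d3) N hN.
  have := @mono C3 d3 (d1 + d2 + d3) N hN.
  have : 0 < N ^ (d1 + d2 + d3) by rewrite expn_gt0 hN.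
  by rewrite !mulnDl; lia.
- move=> p [C1 [d1 H1]] q [C2 [d2 H2]].
  exists (1 + C1 + C2), (d1 + d2) => N hN.
  have := H1 N hN; have := H2 N hN.
  have := @mono C1 d1 (d1 + d2) N hN.
  have := @mono C2 d2 (d1 + d2) N hN.
  have : 0 < N ^ (d1 + d2) by rewrite expn_gt0 hN.
  by rewrite !mulnDl; lia.
- move=> p [C [d H]]; exists (C + 8), d.+1 => N hN.
  have := H N hN; have : 0 < N ^ d by rewrite expn_gt0 hN.
  by rewrite expnS; nia.
Qed.

Definition mix (e : env) (f : store) : store :=
  fun v => if v.2 is None then e v.1 else f v.

Lemma supd_mix_data e f v s : supd (mix e f) (dvar v) s = mix (upd e v s) f.
Proof.
apply: functional_extensionality => -[u [b|]]; rewrite /supd /mix /upd /=.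
  by rewrite xpair_eqE andbF.
by rewrite /dvar xpair_eqE eqxx andbT.
Qed.

Lemma supd_mix_fuel e f v b s :
  supd (mix e f) (v, Some b) s = mix e (supd f (v, Some b) s).
Proof.
apply: functional_extensionality => -[u [b'|]]; rewrite /supd /mix //=.
by rewrite xpair_eqE andbF.
Qed.

Lemma In_flatten_map (A B : Type) (f : A -> seq B) (s : seq A) y :
  List.In y (flatten (map f s)) -> exists2 x, List.In x s & List.In y (f x).
Proof.
elim: s => //= x s IH /(@List.in_app_or _ _ _ _) [Hy|/IH[x' H1 H2]].
  by exists x => //; left.
by exists x' => //; right.
Qed.

Lemma size_upd e v s B : (forall u, size (e u) <= B) -> size s <= B ->
  forall u, size (upd e v s u) <= B.
Proof. by move=> He Hs u; rewrite /upd; case: eqP. Qed.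

(** Every push is charged in [cost], so the same quantity bounds both time and growth;
    [N + cost N p] then bounds the data stacks throughout a run. *)
Lemma exec_size N p e e' B : (forall v, size (e v) <= B) ->
  List.In e' (exec N p e) -> forall v, size (e' v) <= B + cost N p.
Proof.
elim: p e e' B => /=.
- by move=> e e' B He [<-|[]] // v; apply: leq_trans (He v) _; lia.
- move=> u b e e' B He [<-|[]] // v; apply: size_upd => [w|] /=.
    by apply: leq_trans (He w) _; lia.
  by have := He u; lia.
- move=> u e e' B He; have He1 v : size (e v) <= B + 1.
    by apply: leq_trans (He v) _; lia.
  by case=> [<-|[<-|[<-|[]]]] // v; apply: size_upd => //=; have := He u; lia.
- by [].
- move=> u p IHp q IHq r IHr e e' B He.
  have sub s b : e u = b :: s -> forall v, size (upd e u s v) <= B.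
    by move=> Eu; apply: size_upd => //; have := He u; rewrite Eu /=; lia.
  case Eu: (e u) => [|[] s].
  + by move=> He' v; apply: leq_trans (IHp _ _ _ He He' v) _; lia.
  + by move=> He' v; apply: leq_trans (IHr _ _ _ (sub _ _ Eu) He' v) _; lia.
  + by move=> He' v; apply: leq_trans (IHq _ _ _ (sub _ _ Eu) He' v) _; lia.
- move=> p IHp q IHq e e' B He Hin v.
  have [e1 H1 H2] := In_flatten_map Hin.
  by apply: leq_trans (IHq _ _ _ (IHp _ _ _ He H1) H2 v) _; lia.
- move=> p IHp e e' B He H v.
  suff: forall k e B, (forall v, size (e v) <= B) ->
      List.In e' (loop (exec N p) k e) -> size (e' v) <= B + k * cost N p.
    by move=> /(_ _ _ _ He H) /leq_trans; apply; lia.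
  elim=> [|k IHk] e1 B1 He1 /=; first by case=> [<-|[]] //; rewrite mul0n addn0.
  move=> Hin; have [e2 H1 H2] := In_flatten_map Hin.
  by apply: leq_trans (IHk _ _ (IHp _ _ _ He1 H1) H2) _; rewrite mulSn; lia.
Qed.

(* [lia] is slow in large contexts. *)
Ltac keep_nat :=
  repeat match goal with
  | H : ?T |- _ =>
      lazymatch T with
      | is_true (leq _ _) => fail
      | @eq nat _ _ => fail
      | nat => fail
      | _ => clear H
      end
  end.
Ltac nlia := keep_nat; lia.

Section Compile.

Variables (n : nat) (c0 : cmd) (ov : nat) (nd : bool) (N H : nat).
Hypothesis N_le_H : N <= H.

Local Notation outcm := (outc (@Defs.next (mach n c0 ov nd))
                              (@halted (mach n c0 ov nd))).
Local Notation rep := (@rep n c0 ov nd).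
Local Notation B := (2 * H + 3).

(** Only counters below [d] must be full: those of enclosing loops are in the middle of their count.
    The second part bounds the time to scan any counter. *)
Definition fuel_ok (d : nat) (f : store) : Prop :=
  (forall j, j < d -> f (fuel j) = nseq N true /\ f (spent j) = [::]) /\
  (forall v, size (f v) <= N).

Lemma run_fail K E c : (CFail :: K) \in points c0 -> rep (CFail :: K, E) c ->
  outcm rep 1 c [::].
Proof.
move=> hK [L [/= -> L0 HL]]; right; split.
  by rewrite /halted /= code_at.
exists [::] => //; rewrite next_mk /= code_at //=.
rewrite /delta /= /act_delta code_at //=; case: nd => //.
Qed.

Lemma fuel_okW d d' f : d' <= d -> fuel_ok d f -> fuel_ok d' f.
Proof. by move=> le [h1 h2]; split=> // j hj; apply: h1; lia. Qed.

(** The counters return to [f], although a loop runs its body under changed counters; so the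
    induction hypothesis has to hold for every [f] admissible at the height of the body. *)
Lemma compile_correct p K e f c :
  {subset pts (compile p) K <= points c0} -> wfc n (compile p) -> nd || det p ->
  fuel_ok (dep p) f -> (forall v, size (e v) + cost N p <= H) ->
  rep (compile p :: K, mix e f) c ->
  outcm rep (cost N p * B) c [seq (K, mix e' f) | e' <- exec N p e].
Proof.
elim: p K e f c => /=.
- move=> K e f c sub _ _ _ _ Hrep; apply: (@outc_mono _ _ _ _ _ 1); first lia.
  apply: run_stay Hrep; [by apply: sub; rewrite inE | exact: isT |].
  by move=> k a Ek; rewrite /act_delta Ek.
- move=> v b K e f c sub wf _ _ He; rewrite mul1n -supd_mix_data.
  apply: run_push => //; first by apply: sub; rewrite inE.
  by have := He v; rewrite /mix /=; lia.
- move=> v K e f c sub wf hnd _ He; rewrite mul1n -!supd_mix_data.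
  apply: run_guess => //; last by have := He v; rewrite /mix /=; lia.
    by case: (nd) hnd.
  by apply: sub; rewrite inE.
- move=> K e f c sub _ _ _ _ Hrep; apply: (@outc_mono _ _ _ _ _ 1); first lia.
  by apply: run_fail Hrep; apply: sub; rewrite inE.
- move=> v p IHp q IHq r IHr K e f c sub /and4P[wv wp wq wr] hd hf He Hrep.
  have {hd}[hp hq hr] : [/\ nd || det p, nd || det q & nd || det r].
    by case: (nd) hd => //= /and3P[].
  have hK : (CCase (dvar v) (compile p) (compile q) (compile r) :: K) \in points c0.
    by apply: sub; rewrite inE eqxx.
  have hv := He v.
  have wv' : (dvar v).1 <= n := wv.
  have sub1 : {subset pts (compile p) K <= points c0}.
    by move=> x hx; apply: sub; rewrite inE !mem_cat hx orbT.
  have sub2 : {subset pts (compile q) K <= points c0}.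
    by move=> x hx; apply: sub; rewrite inE !mem_cat hx !orbT.
  have sub3 : {subset pts (compile r) K <= points c0}.
    by move=> x hx; apply: sub; rewrite inE !mem_cat hx !orbT.
  have hd x : x :: K \in pts x K by case: x => *; rewrite inE eqxx.
  case Ev: (e v) => [|b s].
    apply: (@outc_mono _ _ _ _ _ (1 + cost N p * B)); first nlia.
    refine (outc_seq (run_pop_nil hK wv' (erefl _) Ev Hrep) _).
    move=> c' Hrep'; apply: IHp => //; first by apply: fuel_okW hf; nlia.
    by move=> u; have := He u; nlia.
  have Hu u : size (upd e v s u) <= size (e u).
    by rewrite /upd; case: eqP => // ->; rewrite Ev /=; nlia.
  pose pb := if b then r else q.
  apply: (@outc_mono _ _ _ _ _ (B + cost N pb * B)).
    by rewrite /pb; case: (b); nlia.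
  have hKb : compile pb :: K \in points c0.
    by rewrite /pb; case: (b); [apply: sub3 | apply: sub2]; apply: hd.
  apply: outc_seq (run_pop_cons (b := b) (s := s) (H := H) hK wv' (erefl _) _ _ _ Hrep) _.
  - by move: hKb; rewrite /pb; case: (b).
  - by [].
  - by rewrite /mix /=; nlia.
  move=> c' /=; rewrite supd_mix_data => Hrep'.
  have Hrun : outcm rep (cost N pb * B) c' [seq (K, mix e' f) | e' <- exec N pb (upd e v s)].
    move: Hrep'; rewrite /pb; case: (b) => Hrep'; [apply: IHr|apply: IHq] => //;
      try (by apply: fuel_okW hf; lia); move=> u; have := He u; have := Hu u; nlia.
  by move: Hrun; rewrite /pb; case: (b).
- move=> p IHp q IHq K e f c sub /andP[wp wq] hd hf He Hrep.
  have {hd}[hp hq] : nd || det p /\ nd || det q.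
    by case: (nd) hd => //= /andP[].
  have hK : (CSeq (compile p) (compile q) :: K) \in points c0.
    by apply: sub; rewrite inE eqxx.
  apply: (@outc_mono _ _ _ _ _ (1 + (cost N p * B + cost N q * B))); first nlia.
  apply: outc_seq (run_stay hK isT _ Hrep) _.
    by move=> k a Ek; rewrite /act_delta Ek.
  move=> c1 Hrep1.
  have Hp := IHp (compile q :: K) e f c1 _ wp hp _ _ Hrep1.
  (* The continuation in [outc_bind] receives a pair of control point and store, so the environment
     is recovered from the data tracks of that store. *)
  have -> : [seq (K, mix e' f) | e' <- flatten [seq exec N q i | i <- exec N p e]] =
      flatten (map (fun s => [seq (K, mix e' f) | e' <- exec N q (fun v => s.2 (dvar v))])
                 [seq (compile q :: K, mix e' f) | e' <- exec N p e]).
    by rewrite map_flatten -!map_comp.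
  apply: outc_bind (Hp _ _ _) _.
  - by move=> x hx; apply: sub; rewrite inE mem_cat hx orbT.
  - by apply: fuel_okW hf; nlia.
  - by move=> v; have := He v; nlia.
  move=> s c2 /(@List.in_map_iff _ _ _ _ _) [e1 [<- He1]] Hrep2.
  apply: IHq => //.
  - by move=> x hx; apply: sub; rewrite inE mem_cat hx !orbT.
  - by apply: fuel_okW hf; nlia.
  move=> v.
  have h u : size (e u) <= H - cost N p - cost N q - 1 by have := He u; nlia.
  by rewrite /mix /=; have := exec_size h He1 v; have := He v; nlia.
- move=> p IHp K e f c sub wf hd hf He Hrep.
  set d := dep p in sub wf Hrep hf *.
  set body := CSeq (CPush (spent d) true) (compile p) in sub wf Hrep *.
  set W1 := CWhile (fuel d) body in sub wf Hrep *.
  set W2 := CWhile (spent d) (CPush (fuel d) true) in sub wf Hrep *.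
  have [wd wp] : d <= n /\ wfc n (compile p).
    by move: wf => /= /andP[/andP[-> /andP[_ ->]] _].
  have wf' : (fuel d).1 <= n := wd.
  have ws' : (spent d).1 <= n := wd.
  have hK : (CSeq W1 W2 :: K) \in points c0 by apply: sub; rewrite inE eqxx.
  have hW1 : W1 :: W2 :: K \in points c0.
    by apply: sub; rewrite !inE eqxx ?orbT.
  have hbody : body :: W1 :: W2 :: K \in points c0.
    by apply: sub; rewrite !inE eqxx ?orbT.
  have hpush : [:: CPush (spent d) true, compile p, W1, W2 & K] \in points c0.
    by apply: sub; rewrite !inE eqxx ?orbT.
  have subp : {subset pts (compile p) [:: W1, W2 & K] <= points c0}.
    by move=> x hx; apply: sub; rewrite !inE mem_cat hx ?orbT.
  have hW2 : W2 :: K \in points c0.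
    by apply: sub; rewrite !inE mem_cat !inE eqxx ?orbT.
  have hpush2 : [:: CPush (fuel d) true, W2 & K] \in points c0.
    by apply: sub; rewrite !inE mem_cat !inE eqxx ?orbT.
  (* [a] iterations remain and [b] are finished; both loops keep the sum equal to [N]. *)
  pose ff a b := supd (supd f (fuel d) (nseq a true)) (spent d) (nseq b true).
  have fs : (fuel d == spent d) = false by rewrite xpair_eqE andbF.
  have ff_fuel a a' b : supd (ff a b) (fuel d) (nseq a' true) = ff a' b.
    apply: functional_extensionality => v; rewrite /ff /supd.
    by case: (eqVneq v (fuel d)) => [->|_]; rewrite ?fs.
  have ff_spent a b b' : supd (ff a b) (spent d) (nseq b' true) = ff a b'.
    apply: functional_extensionality => v; rewrite /ff /supd.
    by case: (eqVneq v (spent d)).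
  have ff_id : ff N 0 = f.
    apply: functional_extensionality => v; rewrite /ff /supd.
    have [h1 h2] := hf.1 d (ltnSn _).
    by case: eqP => [->|_]; [rewrite h2 | case: eqP => [->|_] //; rewrite h1].
  have ff_f a b : ff a b (fuel d) = nseq a true.
    by rewrite /ff /supd fs eqxx.
  have ff_s a b : ff a b (spent d) = nseq b true by rewrite /ff /supd eqxx.
  have ff_ok a b : a <= N -> b <= N -> fuel_ok d (ff a b).
    move=> ha hb; split=> [j hj|v].
      have [h1 h2] := hf.1 j (ltnW hj).
      rewrite /ff /supd -h1 -h2 /fuel /spent !xpair_eqE !andbT !andbF.
      by rewrite (_ : j == d = false) //; apply/eqP; nlia.
    rewrite /ff /supd; case: eqP => _; first by rewrite size_nseq.
    by case: eqP => _; [rewrite size_nseq | exact: hf.2].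
  have second k e1 c1 : k <= N -> rep (W2 :: K, mix e1 (ff (N - k) k)) c1 ->
      outcm rep ((2 * k + 1) * B) c1 [:: (K, mix e1 f)].
    elim: k c1 => [|k IHk] c1 hk Hrep1.
      apply: (@outc_mono _ _ _ _ _ (1 + 0)); first nlia.
      rewrite -ff_id; move: Hrep1; rewrite subn0 => Hrep1.
      apply: outc_seq (run_pop_nil hW2 ws' (erefl _) _ Hrep1) _.
        by rewrite /mix /= ff_s.
      by move=> c2 Hrep2; apply: outc_leaf.
    apply: (@outc_mono _ _ _ _ _ (B + (B + (2 * k + 1) * B))); first nlia.
    apply: outc_seq (run_pop_cons (b := true) (s := nseq k true) (H := H)
                       hW2 ws' (erefl _) _ _ _ Hrep1) _ => //.
    - by rewrite /mix /= ff_s.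
    - by rewrite /mix /= ff_s size_nseq; nlia.
    move=> c2; rewrite supd_mix_fuel ff_spent => Hrep2.
    apply: outc_seq (run_push (H := H) hpush2 wf' _ Hrep2) _.
      by rewrite /mix /= ff_f size_nseq; nlia.
    move=> c3; rewrite supd_mix_fuel [mix _ _ _]ff_f -[true :: _]/(nseq (N - k.+1).+1 true).
    rewrite ff_fuel (_ : (N - k.+1).+1 = N - k); last nlia.
    by move=> Hrep3; apply: IHk => //; nlia.
  have first k e1 c1 : k <= N -> (forall v, size (e1 v) + k * cost N p <= H) ->
      rep ([:: W1, W2 & K], mix e1 (ff k (N - k))) c1 ->
      outcm rep ((k * (cost N p + 3) + 1) * B) c1
        [seq (W2 :: K, mix e' (ff 0 N)) | e' <- loop (exec N p) k e1].
    elim: k e1 c1 => [|k IHk] e1 c1 hk He1 Hrep1.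
      apply: (@outc_mono _ _ _ _ _ (1 + 0)); first nlia.
      move: Hrep1; rewrite subn0 => Hrep1.
      apply: outc_seq (run_pop_nil hW1 wf' (erefl _) _ Hrep1) _.
        by rewrite /mix /= ff_f.
      by move=> c2 Hrep2; apply: outc_leaf.
    apply: (@outc_mono _ _ _ _ _ (B + (1 + (B + (cost N p * B +
      (k * (cost N p + 3) + 1) * B))))); first nlia.
    apply: outc_seq (run_pop_cons (b := true) (s := nseq k true) (H := H)
                       hW1 wf' (erefl _) _ _ _ Hrep1) _ => //.
    - by rewrite /mix /= ff_f.
    - by rewrite /mix /= ff_f size_nseq; nlia.
    move=> c2; rewrite supd_mix_fuel ff_fuel => Hrep2.
    apply: outc_seq (run_stay hbody isT _ Hrep2) _.
      by move=> k' a Ek; rewrite /act_delta Ek.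
    move=> c3 Hrep3.
    apply: outc_seq (run_push (H := H) hpush ws' _ Hrep3) _.
      by rewrite /mix /= ff_s size_nseq; nlia.
    move=> c4; rewrite supd_mix_fuel [mix _ _ _]ff_s -[true :: _]/(nseq (N - k.+1).+1 true).
    rewrite ff_spent (_ : (N - k.+1).+1 = N - k); last nlia.
    move=> Hrep4 /=.
    have -> : [seq (W2 :: K, mix e' (ff 0 N)) | e' <- flatten [seq loop (exec N p) k i | i <- exec N p e1]] =
      flatten (map (fun s => [seq (W2 :: K, mix e' (ff 0 N)) | e' <- loop (exec N p) k (fun v => s.2 (dvar v))])
                 [seq ([:: W1, W2 & K], mix e' (ff k (N - k))) | e' <- exec N p e1]).
      by rewrite map_flatten -!map_comp.
    apply: outc_bind (IHp _ _ _ _ subp wp hd _ _ Hrep4) _.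
    - by apply: ff_ok; nlia.
    - by move=> v; have := He1 v; rewrite mulSn; nlia.
    move=> s c5 /(@List.in_map_iff _ _ _ _ _) [e2 [<- He2]] Hrep5.
    apply: IHk => //; first nlia.
    move=> v /=.
    have h u : size (e1 u) <= H - k.+1 * cost N p.
      by move: (He1 u); clear; lia.
    move: (exec_size h He2 v) (He1 v); rewrite /mix /= mulSn; clear; lia.
  apply: (@outc_mono _ _ _ _ _ (1 + ((N * (cost N p + 3) + 1) * B + (2 * N + 1) * B))).
    by keep_nat; nia.
  apply: outc_seq (run_stay hK isT _ Hrep) _.
    by move=> k a Ek; rewrite /act_delta Ek.
  move=> c1 Hrep0.
  have Hrep1 : rep ([:: W1, W2 & K], mix e (ff N (N - N))) c1.
    by rewrite subnn ff_id.
  have -> : [seq (K, mix e' f) | e' <- loop (exec N p) N e] =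
    flatten (map (fun s => [:: (K, mix (fun v => s.2 (dvar v)) f)])
      [seq (W2 :: K, mix e' (ff 0 N)) | e' <- loop (exec N p) N e]).
    by rewrite -map_comp flatten_seq1 || 
       (elim: (loop _ _ _) => //= x s ->).
  refine (outc_bind (first N e c1 (leqnn _) _ Hrep1) _).
    by move=> v; have := He v; nlia.
  move=> s c2 /(@List.in_map_iff _ _ _ _ _) [e1 [<- He1]] Hrep2.
  by apply: second => //; rewrite subnn.
Qed.

End Compile.

(** * Polynomial time and SpanP by programs *)

Definition fuel_of (x : seq bool) : nat := maxn 1 (size x).
(** The first input bit lies in cell 0, the bottom of the stack. For the same reason an output, read
    from cell 0 to the right, is [rev (e ov)]. *)
Definition env0 (x : seq bool) : env := fun v => if v == 0 then rev x else [::].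

Lemma compile_wf n p : maxvar p <= n -> dep p <= n -> wfc n (compile p).
Proof.
elim: p => //=.
- move=> v p IHp q IHq r IHr; rewrite !geq_max.
  by case/and4P=> hv h1 h2 h3 /and3P[d1 d2 d3]; rewrite hv IHp ?IHq ?IHr.
- move=> p IHp q IHq; rewrite !geq_max.
  by move=> /andP[h1 h2] /andP[d1 d2]; rewrite IHp ?IHq.
- by move=> p IHp h1 h2; rewrite (ltnW h2) IHp // ltnW.
Qed.

Lemma read_out_cells n c0 ov nd E m p : ov <= n ->
  size (E (ov, None)) <= p + m ->
  @read_out (mach n c0 ov nd) [seq cell n E i | i <- iota p m] =
  drop p (rev (E (ov, None))).
Proof.
move=> hov; elim: m p => [|m IH] p hp /=.
  by rewrite drop_oversize // size_rev; lia.
rewrite get_cell //; case Eo: (onth _ p) => [b|].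
  rewrite IH; last lia.
  have hps : p < size (rev (E (ov, None))) by rewrite -onthTE Eo.
  by rewrite [RHS](drop_nth b) // (onth_nth b _ _ _ Eo).
rewrite drop_oversize //.
by have := onthNE (rev (E (ov, None))) p; rewrite Eo => <-.
Qed.

Lemma init_rep n c0 ov nd (x : seq bool) :
  outc (@Defs.next (mach n c0 ov nd)) (@halted (mach n c0 ov nd))
    (@rep n c0 ov nd) 1 (init_config (mach n c0 ov nd) x)
    [:: ([:: c0], mix (env0 x) (fun v => if v.2 == Some true
                               then nseq (fuel_of x) true else [::]))].
Proof.
set E := mix _ _.
have sz v : size (E v) <= fuel_of x.
  rewrite /E /mix /env0 /fuel_of; case: v => v [[]|] /=.
  - by rewrite size_nseq.
  - by [].
  - by case: eqP => _ //; rewrite size_rev leq_maxr.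
have cellS i : i < size x -> 0 < i ->
    cell n E i = tin n (nth false x i).
  move=> hi hi0; rewrite /cell /tin (_ : (i == 0) = false); last by case: i hi0 {hi}.
  congr (_, _); apply/ffunP => -[t o]; rewrite !ffunE /= /E /mix /env0 /=.
  case: o => [[]|] /=.
  - by rewrite rev_nseq onth_nseq /fuel_of leq_max hi orbT.
  - by rewrite onth0n xpair_eqE andbF.
  - rewrite xpair_eqE andbT -val_eqE /=; case: eqP => _; last by rewrite onth0n.
    by rewrite revK onthE (nth_map false).
have cell0 a : (size x = 0 -> a = tblank n) -> (0 < size x -> a = tin n (nth false x 0)) ->
    cell n E 0 = mark a.
  move=> a0 a1; rewrite /cell /mark; congr (_, _).
  apply/ffunP => -[t o]; rewrite !ffunE /= /E /mix /env0 /=.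
  case: o => [[]|] /=.
  - by rewrite rev_nseq -(@prednK (fuel_of x)) // leq_max.
  - case: (posnP (size x)) => hx; first by rewrite a0 // ffunE.
    by rewrite a1 // ffunE /= xpair_eqE andbF.
  - case: (posnP (size x)) => hx.
      by rewrite a0 // ffunE; case: eqP => _ //; rewrite (size0nil hx).
    rewrite a1 // ffunE /= xpair_eqE andbT -val_eqE /=.
    by case: eqP => _ //; rewrite revK; case: (x) hx.
have init a L : 0 < L -> L = fuel_of x ->
    (size x = 0 -> a = tblank n) -> (0 < size x -> a = tin n (nth false x 0)) ->
    init_config (mach n c0 ov nd) x =
      (None, [::], a, [seq cell n E i | i <- iota 1 (L - 1)]) ->
    outc (@Defs.next (mach n c0 ov nd)) (@halted (mach n c0 ov nd))
      (@rep n c0 ov nd) 1 (init_config (mach n c0 ov nd) x) [:: ([:: c0], E)].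
  move=> L0 EL a0 a1 ->.
  apply: (outc_step (c' := @mk n c0 ov nd (at_pt c0 [:: c0] (Some true)) (cell n E) 0 L)) => //.
    rewrite /= /delta /= (_ : (if nd then _ else _) =
       [:: (at_pt c0 [:: c0] (Some true), mark a, Stay)]); last by case: nd.
    by rewrite /= -cell0.
  by apply: outc_leaf; exists L; split=> // v _; rewrite EL.
case: x @E sz cellS cell0 init => [|b x] E sz cellS cell0 init.
  by apply: (init (tblank n) 1).
apply: (init (tin n b) (size x).+1) => //; first by rewrite /fuel_of /=; lia.
rewrite /init_config /= subn1 /=; congr (_, _, _, _).
apply: (@eq_from_nth _ (tblank n)); first by rewrite !size_map size_iota.
move=> i; rewrite size_map => hi.
by rewrite (nth_map false) // (nth_map 0) ?size_iota // nth_iota // cellS.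
Qed.

Lemma prog_outc p ov nd x : nd || det p ->
  let n := maxn ov (maxn (maxvar p) (dep p)) in
  let M := mach n (compile p) ov nd in
  let N := fuel_of x in
  outc (@Defs.next M) (@halted M) (fun s c => halted c /\ output c = s)
    (1 + cost N p * (2 * (N + cost N p) + 3)) (init_config M x)
    [seq rev (e ov) | e <- exec N p (env0 x)].
Proof.
move=> hd n M N; apply: outc_seq (init_rep _ _ _ _ _) _ => c Hrep.
pose f : store := fun v => if v.2 == Some true then nseq N true else [::].
have -> : [seq rev (e ov) | e <- exec N p (env0 x)] =
   flatten (map (fun s => [:: rev (s.2 (ov, None))])
     [seq ([::] : seq cmd, mix e f) | e <- exec N p (env0 x)]).
  by elim: (exec _ _ _) => //= e s ->.
rewrite -[X in outc _ _ _ X]addn0.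
apply: outc_bind (@compile_correct n (compile p) ov nd N (N + cost N p) _ p [::]
  (env0 x) f c _ _ hd _ _ Hrep) _.
- by rewrite leq_addr.
- by move=> K hK; rewrite /points mem_rcons inE hK orbT.
- by apply: compile_wf; rewrite /n !leq_max leqnn ?orbT.
- split=> [j _ //|v]; rewrite /f; case: eqP => _ //.
  by rewrite size_nseq.
- move=> v; rewrite leq_add2r /env0 /N /fuel_of; case: eqP => _ //.
  by rewrite size_rev leq_maxr.
move=> s c' /(@List.in_map_iff _ _ _ _ _) [e [<- He]] [L [/= -> L0 HL]].
apply: outc_leaf; split.
  by rewrite /halted /= code_at // mem_rcons inE eqxx.
have hov : ov <= n by rewrite leq_maxl.
rewrite -[RHS]drop0 -(@read_out_cells n (compile p) ov nd (mix e f) L 0) //.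
  by case: L L0 {HL} => // L _; rewrite /output /mk [iota 0 _]/= map_cons subn1.
by apply: HL.
Qed.

Lemma time_poly p : exists c k, forall x : seq bool,
  1 + cost (fuel_of x) p * (2 * (fuel_of x + cost (fuel_of x) p) + 3) <=
  c * size x ^ k + c.
Proof.
have [C [d HC]] := cost_poly p.
exists (1 + C * (2 * (1 + C) + 3)), (d + d.+1) => x.
set N := fuel_of x.
have N0 : 0 < N by rewrite /N /fuel_of leq_max.
have le1 : 1 + cost N p * (2 * (N + cost N p) + 3) <=
    (1 + C * (2 * (1 + C) + 3)) * N ^ (d + d.+1).
  have h1 := HC N N0.
  have h2 : cost N p <= C * N ^ d.+1.
    by apply: leq_trans h1 _; rewrite leq_mul2l leq_pexp2l ?orbT.
  have h3 : N <= N ^ d.+1 by rewrite -{1}(expn1 N) leq_pexp2l.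
  have h4 : 0 < N ^ d by rewrite expn_gt0 N0.
  have h5 : 0 < N ^ d.+1 by rewrite expn_gt0 N0.
  have h6 : 2 * (N + cost N p) + 3 <= (2 * (1 + C) + 3) * N ^ d.+1 by nia.
  rewrite mulnDl mul1n expnD; apply: leq_add; first by rewrite muln_gt0 h4.
  apply: leq_trans (leq_mul h1 h6) _; nia.
apply: leq_trans le1 _; rewrite -mulnSr leq_mul2l; apply/orP; right.
(* On the empty input [N] is 1 while [size x] to this positive power is 0; the additive constant
   pays for it. *)
rewrite /N /fuel_of; case: (posnP (size x)) => [->|hx].
  by rewrite exp1n.
by rewrite (maxn_idPr hx) leqnSn.
Qed.

Lemma frontier_front M x k : frontier M x k = front (@Defs.next M) k (init_config M x).
Proof. by elim: k => //= k ->; rewrite front_rcons. Qed.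

Lemma halting_hconfs M x k :
  halting_configs M x k = hconfs (@Defs.next M) (@halted M) k (init_config M x).
Proof.
rewrite /halting_configs /hconfs; congr flatten; apply: eq_map => i.
by rewrite frontier_front.
Qed.

Lemma halted_next M c : halted c -> @Defs.next M c = [::].
Proof. by case: c => [[[q l] a] r]; rewrite /halted /= => ->. Qed.

Lemma prog_halting p ov nd : nd || det p ->
  let M := mach (maxn ov (maxn (maxvar p) (dep p))) (compile p) ov nd in
  exists c k, forall x, let t := c * size x ^ k + c in
    halts_within M x t /\
    perm_eq [seq output c | c <- halting_configs M x t]
      [seq rev (e ov) | e <- exec (fuel_of x) p (env0 x)].
Proof.
move=> hd M; have [c [k H]] := time_poly p; exists c, k => x t.
have := outc_mono (H x) (prog_outc ov x hd).
move/(outc_halting (@halted_next M)); rewrite /halts_within frontier_front.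
by rewrite halting_hconfs.
Qed.

Theorem poly_time_prog p ov : det p ->
  poly_time_computable (fun x => rev (run (fuel_of x) p (env0 x) ov)).
Proof.
move=> hp; have [c [k H]] := @prog_halting p ov false hp.
exists (mach (maxn ov (maxn (maxvar p) (dep p))) (compile p) ov false), c, k.
split; first exact: mach_deterministic.
move=> x t; have [h1 h2] := H x; split=> //.
by move: h2; rewrite exec_det // => /perm_small_eq; apply.
Qed.

Theorem SpanP_prog p ov f :
  (forall x, f x = size (undup [seq rev (e ov)
                               | e <- exec (fuel_of x) p (env0 x)])) ->
  SpanP f.
Proof.
move=> Hf; have [c [k H]] := @prog_halting p ov true isT.
exists (mach (maxn ov (maxn (maxvar p) (dep p))) (compile p) ov true), c, k.
move=> x t; have [h1 h2] := H x; split=> //.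
rewrite Hf filter_predT; apply/esym/perm_size/perm_undup.
exact: perm_mem.
Qed.

(** * The encoding of incomplete databases *)

Definition bval (s : seq bool) : nat := foldr (fun (b : bool) a => b + a.*2) 0 s.

Lemma binary_fuelE f n : n <= f -> binary_fuel f n = binary n.
Proof.
rewrite /binary; elim/ltn_ind: n f => n IH f hf.
case: n f IH hf => [|n] [|f] IH hf //=.
have h1 : uphalf n < n.+1 by rewrite uphalfE; lia.
have h2 : uphalf n <= f by lia.
have h3 : uphalf n <= n by lia.
by rewrite (IH _ h1 _ h2) (IH _ h1 _ h3).
Qed.

Lemma binary_cons (b : bool) n : 0 < b + n.*2 -> binary (b + n.*2) = b :: binary n.
Proof.
case E: (b + n.*2) => [|m] // _.
have E1 := congr1 odd E; rewrite oddD odd_double addbF oddb /= in E1.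
have E2 := congr1 half E; rewrite half_bit_double -uphalfE in E2.
rewrite {1}/binary [LHS]/= -E1 -E2 binary_fuelE // E2 uphalfE; lia.
Qed.

(** Digits are written least significant first, so canonical strings are those without a final
    [false]; the default in [last true] admits the empty string, which is 0. *)
Lemma binaryK s : last true s -> binary (bval s) = s.
Proof.
elim: s => //= b s IH hs; rewrite binary_cons.
  by rewrite IH //; case: s hs {IH}.
elim: s b hs {IH} => [|b' s IH] b /=; first by move=> ->.
by move=> /IH; lia.
Qed.

Lemma succ_bits n : n.+1 = ~~ odd n + (uphalf n).*2.
Proof. by rewrite -{1}(odd_double_half n.+1). Qed.

Lemma bval_binary n : bval (binary n) = n.
Proof.
elim/ltn_ind: n => n IH; case: n IH => [|n] IH //.
rewrite {1}succ_bits binary_cons -?succ_bits //= IH -?succ_bits //.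
by rewrite uphalfE; lia.
Qed.

Lemma binary_last n : last true (binary n).
Proof.
elim/ltn_ind: n => n IH; case: n IH => [|n] IH //.
have h : uphalf n < n.+1 by rewrite uphalfE; lia.
have E := succ_bits n; rewrite E binary_cons -?E //=.
have := IH _ h; case Eb: (binary _) => [|b s] //= _.
have := bval_binary (uphalf n); rewrite Eb /= => h0; move: E; rewrite -h0 /=.
by case: (odd n).
Qed.

Definition dbl (s : seq bool) : seq bool := flatten [seq [:: false; b] | b <- s].

Lemma enc_numE n : enc_num n = dbl (binary n) ++ marker 0. Proof. by []. Qed.

Lemma dbl_inj s t u v : dbl s ++ true :: u = dbl t ++ true :: v -> s = t /\ u = v.
Proof.
elim: s t => [|b s IH] [|b' t] //=; first by case.
by case=> -> /IH[-> ->].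
Qed.

Lemma enc_num_inj m n s t : enc_num m ++ s = enc_num n ++ t -> m = n /\ s = t.
Proof.
rewrite !enc_numE -!catA => /dbl_inj[/(congr1 bval)]; rewrite !bval_binary.
by move=> -> /= [->].
Qed.

Lemma enc_nums_inj ms ns :
  flatten (map enc_num ms) = flatten (map enc_num ns) -> ms = ns.
Proof.
have ne n s : enc_num n ++ s <> [::] by rewrite enc_numE; case: (dbl _).
elim: ms ns => [|m ms IH] [|n ns] //=.
- by move=> /esym/ne.
- by move=> /ne.
- by case/enc_num_inj=> -> /IH ->.
Qed.

(** The number of terms is not encoded: the list ends where a marker 3 or 4 stands in place of a
    term marker, so both sides must be followed by one. *)
Lemma enc_terms_inj (ts us : seq term) i j s t : i \in [:: 3; 4] -> j \in [:: 3; 4] ->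
  flatten (map enc_term ts) ++ marker i ++ s =
  flatten (map enc_term us) ++ marker j ++ t ->
  ts = us /\ marker i ++ s = marker j ++ t.
Proof.
move=> hi hj; elim: ts us => [|a ts IH] [|b us] //=.
- by move: hi; rewrite !inE => /orP[] /eqP ->; case: b.
- by move: hj; rewrite !inE => /orP[] /eqP ->; case: a.
- rewrite -!catA; case: a => a; case: b => b //= [] /enc_num_inj[-> E];
    by have [-> ?] := IH _ E.
Qed.

Lemma enc_factE f s : enc_fact f ++ s =
  marker 3 ++ (enc_num f.1 ++ (flatten (map enc_term f.2) ++ s)).
Proof. by rewrite catA catA. Qed.

Lemma enc_fact_inj (f g : ifact) i j s t : i \in [:: 3; 4] -> j \in [:: 3; 4] ->
  enc_fact f ++ marker i ++ s = enc_fact g ++ marker j ++ t ->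
  f = g /\ marker i ++ s = marker j ++ t.
Proof.
move=> hi hj; case: f g => [r ts] [r' ts']; rewrite !enc_factE.
move/(congr1 (drop 4)); rewrite !drop_size_cat // => /enc_num_inj[/= -> E].
by have [/= -> ->] := enc_terms_inj hi hj E.
Qed.

Lemma enc_facts_head (l : seq ifact) e : exists i s, i \in [:: 3; 4] /\
  flatten (map enc_fact l) ++ marker 4 ++ e = marker i ++ s.
Proof.
case: l => [|f l]; first by exists 4, e.
exists 3, (enc_num f.1 ++ (flatten (map enc_term f.2) ++
  (flatten (map enc_fact l) ++ marker 4 ++ e))); split=> //.
by rewrite -enc_factE; exact: (esym (catA _ _ _)).
Qed.

Lemma enc_uidb_inj D D' : enc_uidb D = enc_uidb D' -> D = D'.
Proof.
case: D D' => [fs d] [fs' d']; rewrite /enc_uidb -[idb_facts _]/fs -[idb_dom _]/d.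
rewrite -[idb_facts _]/fs' -[idb_dom _]/d'.
elim: fs fs' => [|f fs IH] [|f' fs'].
- by rewrite /= => -[] /enc_nums_inj ->.
- by rewrite -[flatten (map _ (f' :: _))]/(enc_fact f' ++ _) -(catA (enc_fact f')) enc_factE.
- by rewrite -[flatten (map _ (f :: _))]/(enc_fact f ++ _) -(catA (enc_fact f)) enc_factE.
- rewrite -[flatten (map _ (f :: _))]/(enc_fact f ++ _) -(catA (enc_fact f)).
  rewrite -[flatten (map _ (f' :: _))]/(enc_fact f' ++ _) -(catA (enc_fact f')).
  have [i [s [hi Es]]] := enc_facts_head fs (flatten (map enc_num d)).
  have [j [t [hj Et]]] := enc_facts_head fs' (flatten (map enc_num d')).
  rewrite Es Et => /(enc_fact_inj hi hj)[-> E].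
  by move: E; rewrite -Es -Et => /IH[-> ->].
Qed.

(** * Polynomially many repetitions, and printing from templates *)

Fixpoint seqn (c : nat) (p : prog) : prog :=
  if c is c'.+1 then Seq p (seqn c' p) else Skip.
Fixpoint loopn (k : nat) (p : prog) : prog :=
  if k is k'.+1 then Loop (loopn k' p) else p.
Definition reps (c k : nat) (p : prog) : prog := loopn k (seqn c p).

Lemma iter_mul (T : Type) (f : T -> T) a b x :
  iter a (iter b f) x = iter (a * b) f x.
Proof. by elim: a => //= a ->; rewrite mulSn iterD. Qed.

Lemma run_reps N c k p e : run N (reps c k p) e = iter (c * N ^ k) (run N p) e.
Proof.
rewrite /reps; elim: k e => [|k IH] e /=.
  by rewrite muln1; elim: c e => //= c IH e; rewrite IH -iterSr.
rewrite (eq_iter (IH)) iter_mul; congr iter.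
by rewrite expnS mulnCA.
Qed.

Lemma det_reps c k p : det p -> det (reps c k p).
Proof. by move=> hp; elim: k => //=; elim: c => //= c ->; rewrite hp. Qed.

Definition le (l : seq (seq bool)) : env := fun v => nth [::] l v.

Lemma upd_le l v s : upd (le l) v s = le (set_nth [::] l v s).
Proof.
by apply: functional_extensionality => u; rewrite /upd /le nth_set_nth /=.
Qed.

(** [VI] and [VJ] print a run of zero digits as encoded, that is, two bits [false] per digit;
    counters enter the text only in unary. *)
Inductive titem := Lit of bool | VI | VJ.

Definition tinst (i j : nat) (t : seq titem) : seq bool :=
  flatten [seq match a with Lit b => [:: b] | VI => nseq (2 * i) false
                          | VJ => nseq (2 * j) false end | a <- t].

Section Printing.

Variables (c k N : nat).
Let B := c * N ^ k.

(* Registers: 0 input, 1 output (reversed), 2 rest of the input,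
   3 and 4 unary counters, 5 scratch. *)
Definition copy_out (v : nat) : prog :=
  Seq (reps c k (Case v Skip (Seq (Push 5 false) (Seq (Push 1 false) (Push 1 false))) Skip))
      (reps c k (Case 5 Skip (Push v false) Skip)).

Definition pr_item (a : titem) : prog :=
  match a with Lit b => Push 1 b | VI => copy_out 3 | VJ => copy_out 4 end.

Fixpoint pr (t : seq titem) : prog :=
  if t is a :: t' then Seq (pr_item a) (pr t') else Skip.

Lemma det_pr t : det (pr t).
Proof. by elim: t => //= -[b||] t -> //=; rewrite !det_reps. Qed.

Lemma nseq_rcons_cat i (o : seq bool) :
  nseq (2 * i) false ++ [:: false, false & o] = nseq (2 * i.+1) false ++ o.
Proof.
by rewrite (_ : 2 * i.+1 = 2 * i + 2) ?nseqD -?catA //; lia.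
Qed.

(** The loops always run [B] times; an iteration that finds its source empty does nothing, so it is
    enough that [B] bounds the counters. *)
Lemma run_copy_out v x o X i j : i <= B -> j <= B -> (v == 3) || (v == 4) ->
  run N (copy_out v) (le [:: x; o; X; nseq i false; nseq j false; [::]]) =
  le [:: x; nseq (2 * (if v == 3 then i else j)) false ++ o; X;
         nseq i false; nseq j false; [::]].
Proof.
move=> hi hj hv; rewrite /= !run_reps -/B.
have H1 b a m o' J : a <= b -> (v == 3) ->
    iter b (run N (Case v Skip (Seq (Push 5 false) (Seq (Push 1 false) (Push 1 false))) Skip))
      (le [:: x; o'; X; nseq a false; J; nseq m false]) =
    le [:: x; nseq (2 * a) false ++ o'; X; [::]; J; nseq (a + m) false].
  move=> + /eqP ->; elim: b a m o' => [|b IH] a m o' hab.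
    by case: a hab.
  rewrite iterSr; case: a hab => [|a] hab; first by rewrite IH.
  rewrite [run _ _ _]/= !upd_le /= (IH _ m.+1) // nseq_rcons_cat.
  by rewrite addnS.
have H2 b a m o' J : a <= b -> (v == 4) ->
    iter b (run N (Case v Skip (Seq (Push 5 false) (Seq (Push 1 false) (Push 1 false))) Skip))
      (le [:: x; o'; X; J; nseq a false; nseq m false]) =
    le [:: x; nseq (2 * a) false ++ o'; X; J; [::]; nseq (a + m) false].
  move=> + /eqP ->; elim: b a m o' => [|b IH] a m o' hab.
    by case: a hab.
  rewrite iterSr; case: a hab => [|a] hab; first by rewrite IH.
  rewrite [run _ _ _]/= !upd_le /= (IH _ m.+1) // nseq_rcons_cat.
  by rewrite addnS.
have H3 b a m o' J : a <= b -> (v == 3) ->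
    iter b (run N (Case 5 Skip (Push v false) Skip))
      (le [:: x; o'; X; nseq m false; J; nseq a false]) =
    le [:: x; o'; X; nseq (a + m) false; J; [::]].
  move=> + /eqP ->; elim: b a m => [|b IH] a m hab; first by case: a hab.
  rewrite iterSr; case: a hab => [|a] hab; first by rewrite IH.
  by rewrite [run _ _ _]/= !upd_le /= (IH _ m.+1) // addnS.
have H4 b a m o' J : a <= b -> (v == 4) ->
    iter b (run N (Case 5 Skip (Push v false) Skip))
      (le [:: x; o'; X; J; nseq m false; nseq a false]) =
    le [:: x; o'; X; J; nseq (a + m) false; [::]].
  move=> + /eqP ->; elim: b a m => [|b IH] a m hab; first by case: a hab.
  rewrite iterSr; case: a hab => [|a] hab; first by rewrite IH.
  by rewrite [run _ _ _]/= !upd_le /= (IH _ m.+1) // addnS.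
case/orP: hv => hv.
  by rewrite (H1 B i 0) // (H3 B (i + 0) 0) ?hv ?addn0.
rewrite (H2 B j 0) // (H4 B (j + 0) 0) ?addn0 //.
by rewrite (eqP hv).
Qed.

Lemma run_pr t x o X i j : i <= B -> j <= B ->
  run N (pr t) (le [:: x; o; X; nseq i false; nseq j false; [::]]) =
  le [:: x; catrev (tinst i j t) o; X; nseq i false; nseq j false; [::]].
Proof.
move=> hi hj; elim: t o => [|a t IH] o //.
have rv m (s : seq bool) : catrev (nseq m false) s = nseq m false ++ s.
  by rewrite catrevE rev_nseq.
have ct (s s' s'' : seq bool) : catrev (s ++ s') s'' = catrev s' (catrev s s'').
  by rewrite !catrevE rev_cat catA.
case: a => [b||]; rewrite /tinst [flatten _]/= -[flatten _]/(tinst i j t).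
- by rewrite [run _ _ _]/= upd_le /= IH.
- by rewrite -[run _ _ _]/(run N (pr t) (run N (copy_out 3) _)) run_copy_out // IH
     ct rv.
- by rewrite -[run _ _ _]/(run N (pr t) (run N (copy_out 4) _)) run_copy_out // IH
     ct rv.
Qed.

End Printing.

(** * The reduction *)

Section ReductionProgram.

Variables (cT kT cW kW : nat).
Variables (tS tB tA tE tO tF : seq titem) (tH tX : option bool -> seq titem).

Local Notation prw := (pr cW kW).

Definition case_input (f : option bool -> prog) : prog :=
  Case 2 (f None) (f (Some false)) (f (Some true)).

Definition for_J (p : prog) : prog :=
  Seq (reps cW kW (Seq p (Push 4 false))) (reps cW kW (Case 4 Skip Skip Skip)).

(** Register 3 is not reset after the rows: it then holds the number of rows, so [tE], [tO] and [tF]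
    are printed for the last one. *)
Definition red_prog : prog :=
  Seq (Loop (Case 0 Skip (Push 2 false) (Push 2 true)))
 (Seq (prw tS)
 (Seq (case_input (fun b => prw (tH b)))
 (Seq (for_J (case_input (fun b => prw (tX b))))
 (Seq (reps cT kT (Seq (prw tB) (Seq (for_J (prw tA)) (Push 3 false))))
 (Seq (prw tE) (Seq (for_J (prw tO)) (prw tF))))))).

Lemma det_red_prog : det red_prog.
Proof. by rewrite /= !det_pr !det_reps /= ?det_pr // !det_reps /= ?det_pr. Qed.

(** [g] is the effect of the body on the unread input: dropping a bit where input symbols are
    placed, the identity elsewhere. *)
Lemma run_for_J N p x o X I (f : nat -> seq bool -> seq bool) g :
  (forall j o' X', j <= cW * N ^ kW ->
     run N p (le [:: x; o'; X'; I; nseq j false; [::]]) =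
     le [:: x; catrev (f j X') o'; g X'; I; nseq j false; [::]]) ->
  run N (for_J p) (le [:: x; o; X; I; [::]; [::]]) =
  le [:: x; catrev (flatten [seq f j (iter j g X) | j <- iota 0 (cW * N ^ kW)]) o;
         iter (cW * N ^ kW) g X; I; [::]; [::]].
Proof.
move=> Hp; rewrite /= !run_reps; set W := cW * N ^ kW in Hp *.
have H1 k j o' : j + k <= W ->
    iter k (run N (Seq p (Push 4 false)))
      (le [:: x; o'; iter j g X; I; nseq j false; [::]]) =
    le [:: x; catrev (flatten [seq f j (iter j g X) | j <- iota j k]) o';
           iter (j + k) g X; I; nseq (j + k) false; [::]].
  elim: k j o' => [|k IH] j o' hjk; first by rewrite !addn0.
  rewrite iterSr -[run _ _ _]/(run N (Push 4 false) (run N p _)) Hp; last lia.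
  rewrite [run _ _ _]/= upd_le /= (IH j.+1); last lia.
  by rewrite addSnnS !catrevE rev_cat catA.
have H2 a o' X' b : a <= b ->
    iter b (run N (Case 4 Skip Skip Skip)) (le [:: x; o'; X'; I; nseq a false; [::]]) =
    le [:: x; o'; X'; I; [::]; [::]].
  elim: b a => [|b IH] a hab; first by case: a hab.
  rewrite iterSr; case: a hab => [|a] hab; first by rewrite IH.
  by rewrite [run _ _ _]/= upd_le IH.
by rewrite (H1 W 0) // H2.
Qed.

Lemma run_load_input N x : size x <= N ->
  run N (Loop (Case 0 Skip (Push 2 false) (Push 2 true))) (env0 x) =
  le [:: [::]; [::]; x; [::]; [::]; [::]].
Proof.
move=> hN; have -> : env0 x = le [:: rev x; [::]; [::]; [::]; [::]; [::]].
  by apply: functional_extensionality => -[|[|[|[|[|[|[|v]]]]]]].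
have H s y k : size s <= k -> 
    iter k (run N (Case 0 Skip (Push 2 false) (Push 2 true)))
      (le [:: s; [::]; y; [::]; [::]; [::]]) =
    le [:: [::]; [::]; catrev s y; [::]; [::]; [::]].
  elim: k s y => [|k IH] s y hs; first by case: s hs.
  rewrite iterSr; case: s hs => [|b s] hs; first by rewrite IH.
  by case: b hs => hs; rewrite [run _ _ _]/= !upd_le /= IH.
by rewrite [LHS]/= H ?size_rev // catrevE revK cats0.
Qed.

Definition red_out (x : seq bool) (T W : nat) : seq bool :=
  tinst 0 0 tS ++ tinst 0 0 (tH (ohead x)) ++
  flatten [seq tinst 0 j (tX (onth (behead x) j)) | j <- iota 0 W] ++
  flatten [seq tinst i 0 tB ++ flatten [seq tinst i j tA | j <- iota 0 W]
          | i <- iota 0 T] ++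
  tinst T 0 tE ++ flatten [seq tinst T j tO | j <- iota 0 W] ++ tinst T 0 tF.

(** The printing loops run [W] times also for the row counter, hence the condition [T <= W]. *)
Lemma run_red_prog x (N := fuel_of x) (T := cT * N ^ kT) (W := cW * N ^ kW) :
  T <= W -> rev (run N red_prog (env0 x) 1) = red_out x T W.
Proof.
move=> leTW; have sN : size x <= N by rewrite leq_maxr.
have iid k (y : seq bool) : iter k id y = y by elim: k.
have caseE (tt : option bool -> seq titem) o X i j : i <= W -> j <= W ->
    run N (case_input (fun b => prw (tt b)))
      (le [:: [::]; o; X; nseq i false; nseq j false; [::]]) =
    le [:: [::]; catrev (tinst i j (tt (ohead X))) o; behead X;
           nseq i false; nseq j false; [::]].
  move=> hi hj; case: X => [|b X]; first by rewrite [run _ _ _]/= run_pr.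
  by case: b; rewrite [run _ _ _]/= upd_le /= run_pr.
(* Past the end of the input [behead] stays empty and the template for [None] is used, so blank
   columns need no loop of their own. *)
have [X [HX EX]] : exists X, X = iter W behead (behead x) /\
    forall j, ohead (iter j behead (behead x)) = onth (behead x) j.
  exists (iter W behead (behead x)); split=> // j; elim: j (behead x) => [|j IH] s; first by case: s.
  by rewrite iterSr IH; case: s => //=; rewrite onth0n.
rewrite -[run _ _ _]/(run N (prw tF) (run N (for_J (prw tO)) (run N (prw tE)
  (run N (reps cT kT (Seq (prw tB) (Seq (for_J (prw tA)) (Push 3 false))))
  (run N (for_J (case_input (fun b => prw (tX b))))
  (run N (case_input (fun b => prw (tH b))) (run N (prw tS)
  (run N (Loop (Case 0 Skip (Push 2 false) (Push 2 true))) (env0 x))))))))).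
rewrite run_load_input //.
rewrite (@run_pr cW kW N _ _ _ _ 0 0) // (caseE _ _ _ 0 0) //.
rewrite (@run_for_J N _ _ _ _ (nseq 0 false)
  (fun j X => tinst 0 j (tX (ohead X))) behead); last first.
  by move=> j o' X' hj; apply: caseE.
rewrite -/W -HX (eq_map (fun j => congr1 (fun o => tinst 0 j (tX o)) (EX j))).
rewrite run_reps -/T.
have H k i o : i + k <= T ->
   iter k (run N (Seq (prw tB) (Seq (for_J (prw tA)) (Push 3 false))))
     (le [:: [::]; o; X; nseq i false; [::]; [::]]) =
   le [:: [::]; catrev (flatten [seq tinst i 0 tB ++
          flatten [seq tinst i j tA | j <- iota 0 W] | i <- iota i k]) o; X;
          nseq (i + k) false; [::]; [::]].
  elim: k i o => [|k IH] i o hi; first by rewrite !addn0.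
  have hiW : i <= W by lia.
  rewrite iterSr -[run _ _ _]/(run N (Push 3 false) (run N (for_J (prw tA))
    (run N (prw tB) _))).
  rewrite (@run_pr cW kW N _ _ _ _ i 0) //.
  rewrite (@run_for_J N _ _ _ _ _ (fun j X => tinst i j tA) id); last first.
    by move=> j o' X' hj; apply: run_pr.
  rewrite -/W iid [run _ _ _]/= upd_le /= (IH i.+1); last lia.
  by rewrite addSnnS !catrevE !rev_cat !catA.
rewrite (H T 0) // add0n (@run_pr cW kW N _ _ _ _ T 0) //.
rewrite (@run_for_J N _ _ _ _ _ (fun j X => tinst T j tO) id); last first.
  by move=> j o' X' hj; apply: run_pr.
rewrite iid (@run_pr cW kW N _ _ _ _ T 0) // /le /= !catrevE cats0.
by rewrite !rev_cat !revK /red_out !catA.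
Qed.

End ReductionProgram.

(** * Names that are printed from unary counters, and fact schemes *)

(** The digits, least significant first, are three runs of zeros each closed by a one: the name is
    decodable, and it ends in the [true] that a canonical number requires. *)
Definition nid (tag i j : nat) : nat :=
  bval (nseq tag false ++ true :: nseq i false ++ true :: nseq j false ++ [:: true]).
Definition vid (k : nat) : nat := bval (nseq k false ++ [:: true]).

Lemma binary_nid tag i j : binary (nid tag i j) =
  nseq tag false ++ true :: nseq i false ++ true :: nseq j false ++ [:: true].
Proof. by rewrite binaryK // last_cat /= last_cat /= last_cat. Qed.

Lemma binary_vid k : binary (vid k) = nseq k false ++ [:: true].
Proof. by rewrite binaryK // last_cat. Qed.

Lemma vidE k : vid k = 2 ^ k.
Proof. by elim: k => //= k IH; rewrite expnS mul2n -IH. Qed.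

Definition nid_dec (z : nat) : nat * nat * nat :=
  let s := binary z in let tag := index true s in
  let s1 := drop tag.+1 s in let i := index true s1 in
  (tag, i, index true (drop i.+1 s1)).

Lemma nidK tag i j : nid_dec (nid tag i j) = (tag, i, j).
Proof.
have H m s : index true (nseq m false ++ true :: s) = m.
  by rewrite index_cat mem_nseq andbF size_nseq /= addn0.
have H2 m s : drop m.+1 (nseq m false ++ true :: s) = s.
  by rewrite -cat_rcons drop_size_cat // size_rcons size_nseq.
by rewrite /nid_dec binary_nid; cbv zeta; rewrite !(H, H2).
Qed.

(* A term scheme is instantiated at loop indices [i] and [j]: [SN tag di oj] is
   the null of row [i + di] and column [j + dj] (column 0 if [oj = None]), and
   [SV d] is the constant [2 ^ (d + j)]. *)
Inductive sterm := SC of nat | SN of nat & nat & option nat | SV of nat.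

Lemma sterm_eq_dec (t u : sterm) : {t = u} + {t <> u}.
Proof. by decide equality; apply: eq_comparable. Qed.

HB.instance Definition _ := hasDecEq.Build sterm (compareP sterm_eq_dec).

Definition col (j : nat) (oj : option nat) : nat :=
  if oj is Some d then j + d else 0.

Definition sinst (i j : nat) (t : sterm) : term :=
  match t with
  | SC n => inl n
  | SN tag di oj => inr (nid tag (i + di) (col j oj))
  | SV d => inl (vid (d + j))
  end.

Definition lits (s : seq bool) : seq titem := map Lit s.

Definition tterm (t : sterm) : seq titem :=
  match t with
  | SC n => lits (enc_term (inl n))
  | SN tag di oj =>
      lits (marker 2 ++ dbl (nseq tag false ++ true :: nseq di false)) ++ VI ::
      lits (dbl [:: true]) ++
      (if oj is Some dj then lits (dbl (nseq dj false)) ++ [:: VJ] else [::]) ++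
      lits (dbl [:: true] ++ marker 0)
  | SV d => lits (marker 1 ++ dbl (nseq d false)) ++ VJ ::
            lits (dbl [:: true] ++ marker 0)
  end.

Lemma tinst_cat i j s t : tinst i j (s ++ t) = tinst i j s ++ tinst i j t.
Proof. by rewrite /tinst map_cat flatten_cat. Qed.

Lemma tinst_lits i j s : tinst i j (lits s) = s.
Proof. by elim: s => //= b s {2}<-. Qed.

Lemma dbl_nseq i : dbl (nseq i false) = nseq (2 * i) false.
Proof. by elim: i => // i IH; rewrite mulnS /dbl /= -[flatten _]/(dbl _) IH. Qed.

Lemma tinst_VI i j t : tinst i j (VI :: t) = dbl (nseq i false) ++ tinst i j t.
Proof. by rewrite dbl_nseq. Qed.

Lemma tinst_VJ i j t : tinst i j (VJ :: t) = dbl (nseq j false) ++ tinst i j t.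
Proof. by rewrite dbl_nseq. Qed.

Lemma dbl_cat s t : dbl (s ++ t) = dbl s ++ dbl t.
Proof. by rewrite /dbl map_cat flatten_cat. Qed.

Lemma dbl_cons b s : dbl (b :: s) = [:: false; b] ++ dbl s.
Proof. by []. Qed.

Lemma tinst_term i j t : tinst i j (tterm t) = enc_term (sinst i j t).
Proof.
case: t => [n|tag di oj|d]; first exact: tinst_lits.
- rewrite /tterm tinst_cat tinst_VI !tinst_cat !tinst_lits /enc_term /sinst.
  rewrite enc_numE binary_nid addnC nseqD.
  case: oj => [dj|]; rewrite /col ?tinst_cat ?tinst_VJ ?tinst_lits.
    by rewrite addnC nseqD !(dbl_cat, dbl_cons) -!catA /= -?catA.
  by rewrite !(dbl_cat, dbl_cons) -!catA /= -?catA.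
- rewrite /tterm tinst_cat tinst_VJ !tinst_lits /enc_term /sinst.
  by rewrite enc_numE binary_vid nseqD !(dbl_cat, dbl_cons) -!catA /= -?catA.
Qed.

Definition finst (i j : nat) (f : seq sterm) : ifact := (0, map (sinst i j) f).

Definition tblock (fs : seq (seq sterm)) : seq titem :=
  flatten [seq lits (marker 3 ++ enc_num 0) ++ flatten (map tterm f) | f <- fs].

Lemma tinst_block i j fs :
  tinst i j (tblock fs) = flatten (map enc_fact (map (finst i j) fs)).
Proof.
have H f : tinst i j (flatten (map tterm f)) = flatten (map enc_term (map (sinst i j) f)).
  by elim: f => //= t f IH; rewrite tinst_cat tinst_term IH.
elim: fs => // f fs IH.
rewrite -[tblock (f :: fs)]/((lits (marker 3 ++ enc_num 0) ++ flatten (map tterm f))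
  ++ tblock fs) !tinst_cat {}IH tinst_lits H.
rewrite -[RHS]/(enc_fact (finst i j f) ++ flatten (map enc_fact (map (finst i j) fs))).
by rewrite enc_factE -!catA.
Qed.

(** * Completions and the query *)

Lemma mem_all_seqs (s a : seq nat) n :
  (a \in all_seqs s n) = (size a == n) && all (mem s) a.
Proof.
elim: n a => [|n IH] [|b a] //=; first by apply/allpairsPdep => -[b [r []]].
rewrite eqSS andbCA -IH; apply/allpairsPdep/andP.
  by case=> b' [r [hb hr [-> ->]]].
by case=> hb ha; exists b, a.
Qed.

Lemma mem_nulls D z :
  reflect (exists2 f, f \in idb_facts D & inr z \in f.2) (z \in nulls D).
Proof.
rewrite mem_undup; apply: (iffP flatten_mapP) => -[f hf].
  move=> /allpairsPdep[t [z' [ht]]]; case: t ht => // z'' ht.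
  by rewrite inE => /eqP -> ->; exists f.
move=> hz; exists f => //; apply/allpairsPdep; exists (inr z), z.
by split=> //; rewrite inE.
Qed.

Lemma completion_eq nu nu' D : {in nulls D, nu =1 nu'} ->
  completion nu D = completion nu' D.
Proof.
move=> H; rewrite /completion; congr seq_fset.
apply/eq_in_map => f hf; congr (_, _); apply/eq_in_map => -[//|z] hz /=.
by apply: H; apply/mem_nulls; exists f.
Qed.

(** Only the values at nulls of [D] matter, so total functions can stand for the listed
    valuations. *)
Lemma completionsP D C :
  (exists2 nu, (forall z, z \in nulls D -> nu z \in idb_dom D) &
               C = completion nu D) <->
  C \in completions D.
Proof.
rewrite /completions seq_fsetE; split=> [[nu Hnu ->]|/mapP[a ha ->]].
  apply/mapP; exists (map nu (nulls D)).
    rewrite mem_all_seqs size_map eqxx all_map; apply/allP => z hz /=.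
    exact: Hnu.
  apply: completion_eq => z hz.
  by rewrite /val_of (nth_map 0) ?index_mem // nth_index.
move: ha; rewrite mem_all_seqs => /andP[/eqP sz /allP Ha].
exists (val_of D a) => // z hz; apply: Ha; apply: mem_nth.
by rewrite sz index_mem.
Qed.

Lemma mem_completion nu D g : (g \in completion nu D) =
  (g \in [seq (f.1, map (val_term nu) f.2) | f <- idb_facts D]).
Proof. by rewrite /completion seq_fsetE. Qed.

Lemma classical_boolP P : reflect P (classical_bool P).
Proof.
rewrite /classical_bool; case: excluded_middle_informative => h.
  exact: ReflectT.
exact: ReflectF.
Qed.

(** Counting completions becomes counting distinct labels; [outs] may repeat a label, as several
    runs may share an output. *)
Lemma count_comp_negE (Y : eqType) q D (outs : seq Y) (Phi : Y -> {fset gfact}) :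
  {in outs &, injective Phi} ->
  (forall C, C \in completions D -> ~ models q C -> exists2 y, y \in outs & C = Phi y) ->
  (forall y, y \in outs -> Phi y \in completions D /\ ~ models q (Phi y)) ->
  count_comp_neg q D = size (undup outs).
Proof.
move=> inj H1 H2; rewrite /count_comp_neg.
have -> : [fset C in completions D | classical_bool (~ models q C)]%fset =
    seq_fset tt (map Phi (undup outs)).
  apply/fsetP => C; rewrite seq_fsetE !inE /=; apply/andP/mapP.
    case=> hC /classical_boolP nC; have [y hy ->] := H1 C hC nC.
    by exists y => //; rewrite mem_undup.
  case=> y; rewrite mem_undup => hy ->; have [h1 h2] := H2 y hy.
  by split=> //; apply/classical_boolP.
rewrite size_seq_fset undup_id ?size_map //.
rewrite map_inj_in_uniq ?undup_uniq // => y y'; rewrite !mem_undup.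
exact: inj.
Qed.

Lemma CompU_neg_enc q D : over_schema q D ->
  CompU_neg q (enc_uidb D) = count_comp_neg q D.
Proof.
move=> HD; rewrite /CompU_neg; case: excluded_middle_informative => [H|[]].
  case: constructive_indefinite_description => D' /= [_ /enc_uidb_inj -> //].
by exists D.
Qed.

Definition q0 : bcq := BCQ [:: (0, [:: 0; 1; 2; 0; 1; 2])].

Lemma models_q0 C : models q0 C <->
  exists a b c, (0, [:: a; b; c; a; b; c]) \in C.
Proof.
split=> [[h /(_ _ (mem_head _ _)) /= H]|[a [b [c H]]]].
  by exists (h 0), (h 1), (h 2).
by exists (nth 0 [:: a; b; c]) => f; rewrite inE => /eqP ->.
Qed.

Lemma over_q0 D : over_schema q0 D <->
  forall f, f \in idb_facts D -> f.1 = 0 /\ size f.2 = 6.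
Proof.
split=> H f /H; first by case=> a; rewrite inE => /eqP -> /= [<- <-].
by case=> h1 h2; exists (0, [:: 0; 1; 2; 0; 1; 2]); rewrite ?inE // h1 h2.
Qed.

(** * The space-time tableau as a ternary constraint problem *)

Definition is_R (m : move) := if m is MoveR then true else false.
Definition is_L (m : move) := if m is MoveL then true else false.
Definition is_S (m : move) := if m is Stay then true else false.

Lemma move_eq_dec (m m' : move) : {m = m'} + {m <> m'}.
Proof. by decide equality. Qed.

HB.instance Definition _ := hasDecEq.Build move (compareP move_eq_dec).

Section Tableau.

Variable M : TM.
Let Q := tm_state M.
Let G := tm_sym M.

(** The successor keeps the index type inhabited when there are no transitions. Indices without a
    transition are ruled out by the first constraint of [cB]. *)
Definition width : nat := (\max_(q : Q) \max_(a : G) size (tm_delta M q a)).+1.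

(* The values of nulls: state, symbol (absent beyond the visited tape), index
   of the chosen transition, output bit. *)
Definition value : finType := (Q * option G * 'I_width * option bool)%type.

Definition st (u : value) : Q := u.1.1.1.
Definition sy (u : value) : option G := u.1.1.2.
Definition hd (u : value) : G := odflt (tm_blank M) (sy u).
Definition ch (u : value) : 'I_width := u.1.2.
Definition ob (u : value) : option bool := u.2.
Definition cellv (o : option G) : value := (tm_start M, o, ord0, None).
(** Output nulls are compared with entire records of this form, not just on [ob], so that an output
    bit determines the value of its null. *)
Definition outv (o : option bool) : value := (tm_start M, None, ord0, o).

(** A halting state repeats itself, so runs of all lengths fill the same number of rows. *)
Definition tr (u : value) : option (Q * G * move) :=
  if tm_halt M (st u) then Some (st u, hd u, Stay)
  else onth (tm_delta M (st u) (hd u)) (ch u).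
Definition mv (u : value) : move := if tr u is Some t then t.2 else Stay.
Definition wr (u : value) : G := if tr u is Some t then t.1.2 else hd u.
Definition nst (u : value) : Q := if tr u is Some t then t.1.1 else st u.

Definition constr := ((value -> value -> value -> bool) * sterm * sterm * sterm)%type.

(** Tag 0 is the scanned cell together with the control, tags 1 and 2 are the tape to the right and
    to the left, numbered outwards from the head, and tag 3 is the output. *)
Definition tS := SN 0 0 None.
Definition tS' := SN 0 1 None.
Definition tR di dj := SN 1 di (Some dj).
Definition tL di dj := SN 2 di (Some dj).
Definition tO dj := SN 3 0 (Some dj).

(** Constraints on fewer than three nulls repeat one of them. *)
Definition cH (o : option bool) : seq constr :=
  [:: (fun u _ _ => (st u == tm_start M) &&
                    (hd u == oapp (tm_in M) (tm_blank M) o), tS, tS, tS)].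
Definition cX (o : option bool) : seq constr :=
  [:: (fun r l _ => (sy r == omap (tm_in M) o) && (sy l == None),
       tR 0 0, tL 0 0, tL 0 0)].
(** These constraints concern the neighbourhood of the head, where the written symbol enters: on a
    move to the right it becomes cell 0 of the left part, and cell 0 of the right part becomes the
    scanned one. *)
Definition cB : seq constr :=
  [:: (fun s s' _ => [&& tr s : bool, st s' == nst s &
                         is_S (mv s) ==> (hd s' == wr s)], tS, tS', tS');
      (fun s r s' => is_R (mv s) ==> (hd s' == hd r), tS, tR 0 0, tS');
      (fun s l s' => is_L (mv s) ==> (hd s' == hd l), tS, tL 0 0, tS');
      (fun s l' _ => is_R (mv s) ==> (sy l' == Some (wr s)), tS, tL 1 0, tL 1 0);
      (fun s r' _ => is_L (mv s) ==> (sy r' == Some (wr s)), tS, tR 1 0, tR 1 0)].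
Definition shift (p : move -> bool) (t t' : sterm) : constr :=
  (fun s a b => p (mv s) ==> (sy a == sy b), tS, t, t').
(** Far from the head a move only renumbers cells: one part of the tape is shifted towards the head,
    the other away from it. *)
Definition cA : seq constr :=
  [:: shift is_R (tR 0 1) (tR 1 0); shift is_R (tL 0 0) (tL 1 1);
      shift is_L (tL 0 1) (tL 1 0); shift is_L (tR 0 0) (tR 1 1);
      shift is_S (tR 0 0) (tR 1 0); shift is_S (tL 0 0) (tL 1 0)].
Definition cE : seq constr :=
  [:: (fun s o _ => [&& tm_halt M (st s), tm_accept M (st s) &
                        o == outv (tm_out M (hd s))], tS, tO 0, tO 0)].
(** Output ends at the first symbol without an output bit. Passing [None] along the columns turns
    this global rule into a constraint on neighbours. *)
Definition next_out (o : option bool) (g : option G) : option bool :=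
  if o is Some _ then obind (tm_out M) g else None.
Definition cO : seq constr :=
  [:: (fun o r o' => o' == outv (next_out (ob o) (sy r)), tO 0, tR 0 0, tO 1)].

Definition asg := nat -> nat -> nat -> value.

Definition tmval (al : asg) (i j : nat) (t : sterm) : value :=
  if t is SN tag di oj then al tag (i + di) (col j oj) else outv None.

Definition holds (al : asg) (i j : nat) (c : constr) : bool :=
  let: (P, t1, t2, t3) := c in
  P (tmval al i j t1) (tmval al i j t2) (tmval al i j t3).

Definition sat_tab (x : seq bool) (T W : nat) (al : asg) : Prop :=
  [/\ all (holds al 0 0) (cH (ohead x)),
      forall j, j < W -> all (holds al 0 j) (cX (onth (behead x) j)),
      forall i, i < T -> all (holds al i 0) cB /\
                         (forall j, j < W -> all (holds al i j) cA),
      all (holds al T 0) cE &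
      forall j, j < W -> all (holds al T j) cO].

(** Describing the two parts through [onth] absorbs the case of an exhausted part, whose next symbol
    is the blank. *)
Lemma do_moveE q (l : seq G) a r m :
  let: (q', l', a', r') := @do_move M q l a r m in
  q' = q /\
  match m with
  | Stay => [/\ l' = l, a' = a & r' = r]
  | MoveR => [/\ a' = odflt (tm_blank M) (onth r 0),
                 forall j, onth r' j = onth r j.+1, onth l' 0 = Some a &
                 forall j, onth l' j.+1 = onth l j]
  | MoveL => [/\ a' = odflt (tm_blank M) (onth l 0),
                 forall j, onth l' j = onth l j.+1, onth r' 0 = Some a &
                 forall j, onth r' j.+1 = onth r j]
  end.
Proof. by case: m => //=; [case: l|case: r] => //= *; do !split=> //; case. Qed.

Lemma onth_read_out s j : onth (@read_out M s) j.+1 =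
  next_out (onth (@read_out M s) j) (onth s j.+1).
Proof.
elim: s j => [|a s IH] j; first by rewrite !onth0n.
rewrite [read_out _]/=; case: tm_out => [b|]; last by case: j.
case: j => [|j]; last exact: IH.
by case: s {IH} => //= a' s; case: tm_out.
Qed.

Lemma size_next (cf cf' : config M) : cf' \in Defs.next cf ->
  size cf'.2 <= (size cf.2).+1.
Proof.
case: cf => [[[q l] a] r] /=; case: tm_halt => //= /mapP[[[q' w] m] _ ->] /=.
by case: m => /=; [case: l|case: r|] => /= *; lia.
Qed.

Lemma size_frontier x i cf : cf \in frontier M x i -> size cf.2 <= size x + i.
Proof.
elim: i cf => [|i IH] cf /=.
  rewrite inE => /eqP ->; rewrite /init_config; case: x => //= b x.
  by rewrite size_map; lia.
by case/flatten_mapP=> cf' /IH h /size_next h'; rewrite addnS; apply: leq_trans h' _.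
Qed.

Lemma size_read_out s : size (@read_out M s) <= size s.
Proof. by elim: s => //= a s IH; case: tm_out. Qed.

Lemma mem_halting x t cf : cf \in halting_configs M x t <->
  exists2 i, i <= t & (cf \in frontier M x i) && halted cf.
Proof.
split=> [/flatten_mapP[i]|[i hi /andP[h1 h2]]].
  by rewrite mem_iota mem_filter => /andP[_ hi] /andP[h1 h2]; exists i; rewrite ?h1 ?h2.
apply/flatten_mapP; exists i; first by rewrite mem_iota.
by rewrite mem_filter h1 h2.
Qed.

Section Fixed.

Variables (x : seq bool) (t T W : nat).
Hypothesis halts : halts_within M x t.
Hypothesis tT : t <= T.
Hypothesis TW : size x + 2 * T + 2 <= W.

(** The constraints stop at column [W] and a shift reads the column after, so each row controls one
    column less than the row before: hence [i + j < W]. *)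
Definition tracks (al : asg) (i : nat) (cf : config M) : Prop :=
  let: (q, l, a, r) := cf in
  [/\ st (al 0 i 0) = q, hd (al 0 i 0) = a &
      forall j, i + j < W -> sy (al 1 i j) = onth r j /\ sy (al 2 i j) = onth l j].

Lemma tracks_init al : sat_tab x T W al -> tracks al 0 (init_config M x).
Proof.
case=> hH hX _ _ _.
have [h1 h2] : st (al 0 0 0) = tm_start M /\
               hd (al 0 0 0) = oapp (tm_in M) (tm_blank M) (ohead x).
  by move: hH; rewrite /= andbT => /andP[/eqP -> /eqP ->].
have hj j : j < W -> sy (al 1 0 j) = omap (tm_in M) (onth (behead x) j) /\
                      sy (al 2 0 j) = None.
  by move=> /hX; rewrite /= !addn0 andbT => /andP[/eqP -> /eqP ->].
rewrite /tracks /init_config; case: (x) h2 hj => [|b s] /= h2 hj; split=> // j /hj[-> ->];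
  by rewrite ?onth_map !onth0n.
Qed.

Lemma tracks_step al i cf : sat_tab x T W al -> i < T -> tracks al i cf ->
  exists2 cf', tracks al i.+1 cf' &
    if halted cf then cf' = cf else cf' \in Defs.next cf.
Proof.
case=> _ _ Hi _ _ hi; case: cf => [[[q l] a] r] [hq ha hrl].
have [hB hA] := Hi i hi; have iW : i + 1 < W by lia.
move: hB; rewrite /= !addn0 !addn1 andbT.
set s := al 0 i 0; set s' := al 0 i.+1 0.
case Etr: (tr s) => [[[q' w] m]|]; last by [].
rewrite /mv /wr /nst Etr /=; set mm := @do_move M q' l w r m.
case/and5P=> /andP[/eqP hst hS] hR hL hR' hL'.
exists mm; last first.
  rewrite /halted /=; move: Etr; rewrite /tr /s hq ha.
  case: ifP => hh; first by case=> E1 E2 E3; rewrite /mm -E1 -E2 -E3.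
  move=> Ht; apply/mapP; exists (q', w, m) => //.
  by apply/onthP; exists (ch (al 0 i 0)).
have hj j : j < W ->
    [/\ is_R m -> sy (al 1 i j.+1) = sy (al 1 i.+1 j),
        is_R m -> sy (al 2 i j) = sy (al 2 i.+1 j.+1) &
        is_L m -> sy (al 2 i j.+1) = sy (al 2 i.+1 j)] /\
    [/\ is_L m -> sy (al 1 i j) = sy (al 1 i.+1 j.+1),
        is_S m -> sy (al 1 i j) = sy (al 1 i.+1 j) &
        is_S m -> sy (al 2 i j) = sy (al 2 i.+1 j)].
  move=> /hA; rewrite /= /mv !addn0 !addn1 -/s Etr /= !andbT.
  by case/and5P=> /implyP h1 /implyP h2 /implyP h3 /implyP h4 /andP[/implyP h5 /implyP h6];
    split; split=> h; apply/eqP; auto.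
have := do_moveE q' l w r m; rewrite -/mm.
case: mm => [[[q1 l1] a1] r1] [-> Hm]; split=> //.
- have [h10 h20] : sy (al 1 i 0) = onth r 0 /\ sy (al 2 i 0) = onth l 0.
    by apply: hrl; lia.
  move: hS hR hL; rewrite -/s'; case: (m) Hm => /=.
  + by case=> -> _ _ _ _ _ /eqP ->; rewrite /hd h20.
  + by case=> -> _ _ _ _ /eqP -> _; rewrite /hd h10.
  + by case=> _ -> _ /eqP -> .
- move=> j hjW.
  have [E1 E2] := hrl j ltac:(lia).
  have [E3 E4] := hrl j.+1 ltac:(lia).
  have [[b1 _ b3] [_ b5 b6]] := hj j ltac:(lia).
  move: hR' hL' b1 b3 b5 b6 hj; case: (m) Hm => /=.
  + case=> _ Hl Hr0 Hr _ /eqP hL' _ b3 _ _ hj; rewrite -b3 // Hl E4; split=> //.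
    (* On the side from which the head moves away, column 0 receives the written symbol; the other
       columns come from the shift constraint one column earlier. *)
    case: j hjW {E1 E2 E3 E4 b3} => [|j] hjW; first exact: etrans hL' (esym Hr0).
    have [_ [b4 _ _]] := hj j ltac:(lia); rewrite -b4 //.
    by have [E _] := hrl j ltac:(lia); exact: etrans E (esym (Hr j)).
  + case=> _ Hr Hl0 Hl /eqP hR' _ b1 _ _ _ hj; rewrite -b1 // Hr E3; split=> //.
    case: j hjW {E1 E2 E3 E4 b1} => [|j] hjW; first exact: etrans hR' (esym Hl0).
    have [[_ b2 _] _] := hj j ltac:(lia); rewrite -b2 //.
    by have [_ E] := hrl j ltac:(lia); exact: etrans E (esym (Hl j)).
  + by case=> -> _ -> _ _ _ _ b5 b6 _; rewrite -b5 // -b6.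
Qed.

Lemma frontier_nil i : t < i -> frontier M x i = [::].
Proof.
move=> /subnK <-; elim: (i - t.+1) => [|k IH]; first exact: halts.
by rewrite addSn /= IH.
Qed.

Lemma tableau_sound al : sat_tab x T W al ->
  exists2 cf, cf \in halting_configs M x t & tm_accept M cf.1.1.1 /\
    forall j, j < W -> al 3 T j = outv (onth (output cf) j).
Proof.
move=> Hsat.
(* [i'] is the time on the machine; it falls behind the row number once the configuration has
   halted. *)
have H i : i <= T -> exists2 cf, tracks al i cf &
    exists2 i', i' <= i & (cf \in frontier M x i') && ((i' == i) || halted cf).
  elim: i => [|i IH] hi.
    exists (init_config M x); first exact: tracks_init.
    by exists 0; rewrite //= inE eqxx.
  have [cf Hcf [i' hi' /andP[hf hh]]] := IH (ltnW hi).
  have [cf' Hcf' Hn] := tracks_step Hsat hi Hcf; exists cf' => //.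
  case: ifP Hn hh => [hcf -> _|hcf Hn]; first by exists i'; rewrite ?hf ?hcf ?orbT // ltnW.
  rewrite orbF => /eqP Ei; exists i.+1 => //; rewrite eqxx andbT /=.
  by apply/flatten_mapP; exists cf; rewrite // -Ei.
have [[[[q l] a] r] [hq ha hrl] [i' hi' /andP[hf _]]] := H T (leqnn T).
case: Hsat => _ _ _; rewrite /= !addn0 andbT => /and3P[].
rewrite hq ha => hh hacc /eqP hO HO.
have hi't : i' <= t.
  by rewrite leqNgt; apply/negP => /frontier_nil E; rewrite E in hf.
exists (q, l, a, r).
  by apply/mem_halting; exists i' => //; rewrite hf.
split=> //; elim=> [|j IH] hj; first by rewrite hO /output /=; case: tm_out.
have -> : al 3 T j.+1 = outv (next_out (ob (al 3 T j)) (sy (al 1 T j))).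
  by have := HO j (ltnW hj); rewrite /= !addn0 addn1 andbT => /eqP.
rewrite IH ?(ltnW hj) // /output onth_read_out; congr outv.
rewrite -[onth (a :: r) j.+1]/(onth r j) -[ob _]/(onth (@read_out M (a :: r)) j).
(* In the remaining case the symbol in column [j] is not controlled. By [TW] the output has at most
   [j] bits, so bit [j] is already [None] and [next_out] ignores that symbol. *)
have [hTj|hTj] := ltnP (T + j) W; first by have [-> _] := hrl j hTj.
rewrite (onth_default (n := j)) //.
apply: leq_trans (size_read_out _) _ => /=.
by have := size_frontier hf; rewrite /=; lia.
Qed.

Lemma frontier_path i cf : cf \in frontier M x i ->
  exists2 p : nat -> config M, p 0 = init_config M x /\ p i = cf &
    forall j, j < i -> p j.+1 \in Defs.next (p j).
Proof.
elim: i cf => [|i IH] cf /=.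
  by rewrite inE => /eqP ->; exists (fun=> init_config M x).
case/flatten_mapP=> cf' /IH[p [p0 pi] Hp] Hn.
exists (fun j => if j <= i then p j else cf); first by rewrite ltnn.
move=> j; rewrite ltnS leq_eqVlt => /orP[/eqP ->|hj].
  by rewrite ltnn eqxx pi.
by rewrite hj orbT Hp.
Qed.

Lemma tableau_complete cf : cf \in halting_configs M x t -> tm_accept M cf.1.1.1 ->
  exists2 al, sat_tab x T W al & forall i j, al 3 i j = outv (onth (output cf) j).
Proof.
move=> /mem_halting[i0 hi0 /andP[/frontier_path[p [p0 pi] Hp] hh]] hacc.
have i0T : i0 <= T by apply: leq_trans tT.
(* Cutting time off at [i0] repeats the halting configuration in all later rows. *)
pose q i := (p (minn i i0)).1.1.1.
pose l i := (p (minn i i0)).1.1.2.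
pose a i := (p (minn i i0)).1.2.
pose r i := (p (minn i i0)).2.
have pE i : p (minn i i0) = (q i, l i, a i, r i).
  by rewrite /q /l /a /r; case: (p _) => [[[]]].
(* The choice is recovered as the position of the next configuration among the successors. *)
pose ix i : 'I_width := inord (index (p (minn i i0).+1) (Defs.next (p (minn i i0)))).
pose al : asg := fun tag i j =>
  match tag with
  | 0 => (q i, Some (a i), ix i, None)
  | 1 => cellv (onth (r i) j)
  | 2 => cellv (onth (l i) j)
  | _ => outv (onth (output cf) j)
  end.
have step i : exists m, tr (al 0 i 0) = Some (q i.+1, wr (al 0 i 0), m) /\
    @do_move M (q i.+1) (l i) (wr (al 0 i 0)) (r i) m =
    (q i.+1, l i.+1, a i.+1, r i.+1).
  have [hi|hi] := ltnP i i0; last first.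
    have Ei : minn i i0 = i0 by apply/minn_idPr.
    have Ei' : minn i.+1 i0 = i0 by apply/minn_idPr; rewrite leqW.
    have hq : tm_halt M (q i) by move: hh; rewrite /halted /q Ei pi.
    exists Stay; rewrite /wr /tr /= hq /q /l /a /r Ei Ei'.
    by [].
  have Ei : minn i i0 = i by apply/minn_idPl; rewrite ltnW.
  have Ei' : minn i.+1 i0 = i.+1 by apply/minn_idPl.
  have := Hp i hi; have := pE i; rewrite Ei => Epi.
  have Epi' := pE i.+1; rewrite Ei' in Epi'.
  rewrite Epi => Hn; move: (Hn); rewrite /=; case: ifP => // hq Hmem.
  set D := tm_delta M (q i) (a i) in Hmem *.
  set F := (fun t : Q * G * move => _) in Hmem.
  have hidx : index (p i.+1) (map F D) < size D by rewrite -(size_map F) index_mem.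
  have Eix : ix i = index (p i.+1) (map F D) :> nat.
    rewrite /ix Ei Epi /= hq inordK // ltnS (leq_trans (ltnW hidx)) //.
    apply: leq_trans (leq_bigmax (q i)).
    exact: (@leq_bigmax _ (fun a => size (tm_delta M (q i) a)) (a i)).
  pose t0 : Q * G * move := (q i, a i, Stay).
  pose tt := nth t0 D (index (p i.+1) (map F D)).
  have Htt : p i.+1 = F tt by rewrite -(nth_map t0 (p 0)) // nth_index.
  have Etr : tr (al 0 i 0) = Some tt.
    rewrite /tr /= /hd /= hq -/D Eix /tt -(odflt_onth t0).
    by have := onthTE D (index (p i.+1) (map F D)); rewrite hidx; case: onth.
  have := do_moveE tt.1.1 (l i) tt.1.2 (r i) tt.2.
  rewrite -[do_move _ _ _ _ _]/(F tt) -Htt Epi' => -[Eq _].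
  exists tt.2; rewrite /wr Etr Eq; split; first by case: (tt) => [[]].
  by rewrite -[do_move _ _ _ _ _]/(F tt) -Htt Epi' Eq.
have shifts i j : all (holds al i j) cA.
  have [m [Etr Em]] := step i; have := do_moveE (q i.+1) (l i) (wr (al 0 i 0)) (r i) m.
  rewrite {}Em /= /mv !addn0 !addn1 Etr /= => -[_].
  rewrite /cellv /sy /=; case: (m) => /=.
  - by case=> _ H1 _ H2; rewrite H1 H2 !eqxx.
  - by case=> _ H1 _ H2; rewrite H1 H2 !eqxx.
  - by case=> -> _ ->; rewrite !eqxx.
exists al => //; split.
- rewrite /= /hd /= andbT /q /a min0n p0 /init_config.
  by case: (x) => [|b s] /=; rewrite !eqxx.
- move=> j _; rewrite /= /cellv /sy /= !addn0 andbT /r /l min0n p0 /init_config.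
  by case: (x) => [|b s] /=; rewrite ?onth0n ?onth_map !eqxx.
- move=> i _; split; last by move=> j _; exact: shifts.
  have [m [Etr Em]] := step i; have := do_moveE (q i.+1) (l i) (wr (al 0 i 0)) (r i) m.
  rewrite {}Em /= !addn0 !addn1 /mv /nst Etr /st /= eqxx => -[_].
  rewrite /cellv /hd /sy /= ?(andbT, implybT).
  case: (m) => /=.
  - by case=> -> _ -> _; rewrite !eqxx.
  - by case=> -> _ -> _; rewrite !eqxx.
  - by case=> _ -> _; rewrite !eqxx.
- have Ei : minn T i0 = i0 by apply/minn_idPr.
  rewrite /= !addn0 /st /hd /= andbT /q /a Ei pi hacc.
  move: hh; rewrite /halted => ->; case: (cf) => [[[q' l'] a'] r'] /=.
  by case: tm_out.
- move=> j _; have E : onth (output cf) j.+1 =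
      next_out (onth (output cf) j) (onth (r T) j).
    have Ei : minn T i0 = i0 by apply/minn_idPr.
    rewrite /r Ei pi; case: (cf) => [[[q' l'] a'] r'].
    exact: onth_read_out.
  rewrite /= !addn0 addn1 andbT; apply/eqP; congr outv; exact: E.
Qed.

End Fixed.
End Tableau.

(** * Hardness *)

Definition pat (s : seq nat) : bool :=
  if s is [:: a; b; c; a'; b'; c'] then [&& a == a', b == b' & c == c'] else false.

Definition ground (nu : nat -> nat) (f : ifact) : gfact := (f.1, map (val_term nu) f.2).

Section Database.

Variable M : TM.
Local Notation V := (value M).

Definition cd (u : V) : nat := index u (enum V).
Definition dc (n : nat) : V := nth (outv M None) (enum V) n.
Definition dsize : nat := #|V|.

Lemma cdK : cancel cd dc.
Proof. by move=> u; rewrite /cd /dc nth_index // mem_enum. Qed.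

Lemma cd_lt u : cd u < dsize.
Proof. by rewrite /cd /dsize cardE index_mem mem_enum. Qed.

Lemma dcK n : n < dsize -> cd (dc n) = n.
Proof. by move=> hn; rewrite /cd /dc index_uniq ?enum_uniq // -cardE. Qed.

Definition con (c : constr M) : seq (seq sterm) :=
  let: (P, t1, t2, t3) := c in
  [seq [:: t1; t2; t3; SC (cd u.1.1); SC (cd u.1.2); SC (cd u.2)]
  | u <- enum {: V * V * V} & ~~ P u.1.1 u.1.2 u.2].
Definition blk (cs : seq (constr M)) : seq (seq sterm) := flatten (map con cs).

Definition triple (u : V * V * V) : seq nat := [:: cd u.1.1; cd u.1.2; cd u.2].
Definition base : seq (seq sterm) :=
  [seq map SC (triple p.1 ++ triple p.2)
  | p <- enum {: (V * V * V) * (V * V * V)} & p.1 != p.2].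
Definition vis : seq sterm := [:: SV dsize; tO 0; SC 0; SC 0; SC 0; SC 0].

Definition red_facts (x : seq bool) (T W : nat) : seq ifact :=
  map (finst 0 0) base ++ map (finst 0 0) (blk (cH M (ohead x))) ++
  flatten [seq map (finst 0 j) (blk (cX M (onth (behead x) j))) | j <- iota 0 W] ++
  flatten [seq map (finst i 0) (blk (cB M)) ++
               flatten [seq map (finst i j) (blk (cA M)) | j <- iota 0 W]
          | i <- iota 0 T] ++
  map (finst T 0) (blk (cE M)) ++
  flatten [seq map (finst T j) (rcons (blk (cO M)) vis) | j <- iota 0 W].

Definition redD (x : seq bool) (T W : nat) : uidb :=
  UIDB (red_facts x T W) (iota 0 dsize).

Definition red_string (x : seq bool) (T W : nat) : seq bool :=
  red_out (tblock base) (tblock (blk (cB M))) (tblock (blk (cA M)))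
    (tblock (blk (cE M))) (tblock (rcons (blk (cO M)) vis))
    (lits (marker 4 ++ flatten (map enc_num (iota 0 dsize))))
    (fun o => tblock (blk (cH M o))) (fun o => tblock (blk (cX M o))) x T W.

Lemma enc_flatten (I : Type) (F : I -> seq ifact) (s : seq I) :
  flatten (map enc_fact (flatten (map F s))) =
  flatten [seq flatten (map enc_fact (F i)) | i <- s].
Proof. by elim: s => //= i s <-; rewrite map_cat flatten_cat. Qed.

Lemma enc_redD x T W : enc_uidb (redD x T W) = red_string x T W.
Proof.
rewrite /enc_uidb /red_string /red_out /redD.
rewrite -[idb_facts _]/(red_facts x T W) -[idb_dom _]/(iota 0 dsize).
have E (a b c d e f g : seq bool) :
    (a ++ b ++ c ++ d ++ e ++ f) ++ g = a ++ b ++ c ++ d ++ e ++ f ++ g.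
  by rewrite -!catA.
rewrite /red_facts.
move: (blk (cH M (ohead x))) (blk (cE M)) (blk (cB M)) (blk (cA M)) => bH bE bB bA.
rewrite !map_cat !flatten_cat !enc_flatten E !tinst_block tinst_lits.
congr (_ ++ (_ ++ (_ ++ (_ ++ (_ ++ (_ ++ _)))))).
- by congr flatten; apply: eq_map => j; rewrite tinst_block.
- congr flatten; apply: eq_map => i; rewrite tinst_block map_cat flatten_cat.
  by rewrite enc_flatten; congr (_ ++ flatten _); apply: eq_map => j; rewrite tinst_block.
- by congr flatten; apply: eq_map => j; rewrite tinst_block.
Qed.

Definition is_null (t : sterm) : bool := if t is SN _ _ _ then true else false.
Definition on_nulls (c : constr M) : bool :=
  let: (_, t1, t2, t3) := c in [&& is_null t1, is_null t2 & is_null t3].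

Section Valuation.

Variable nu : nat -> nat.
Hypothesis nu_dom : forall z, nu z < dsize.
Let al : asg M := fun tag i j => dc (nu (nid tag i j)).

Lemma val_null i j t : is_null t ->
  val_term nu (sinst i j t) = cd (tmval al i j t).
Proof. by case: t => // tag di oj _; rewrite /= /al dcK. Qed.

Lemma con_holds i j c : on_nulls c ->
  all (fun f => ~~ pat (ground nu f).2) (map (finst i j) (con c)) = holds al i j c.
Proof.
case: c => [[[P t1] t2] t3] /= /and3P[h1 h2 h3]; rewrite !all_map /=.
apply/allP/idP => [H|H [[u1 u2] u3]].
  apply/negPn/negP => hP.
  have := H (tmval al i j t1, tmval al i j t2, tmval al i j t3).
  rewrite mem_filter hP mem_enum /= !val_null // !eqxx /=.
  by move=> /(_ isT).
rewrite mem_filter => /andP[hP _] /=; rewrite !val_null // !(can_eq cdK).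
by apply/negP => /and3P[/eqP E1 /eqP E2 /eqP E3]; rewrite -E1 -E2 -E3 H in hP.
Qed.

Lemma blk_holds i j cs : all on_nulls cs ->
  all (fun f => ~~ pat (ground nu f).2) (map (finst i j) (blk cs)) =
  all (holds al i j) cs.
Proof.
elim: cs => //= c cs IH /andP[h1 h2].
by rewrite /blk /= map_cat all_cat con_holds // IH.
Qed.

Lemma base_ok :
  all (fun f => ~~ pat (ground nu f).2) (map (finst 0 0) base).
Proof.
rewrite !all_map; apply/allP => -[[[u1 u2] u3] [[v1 v2] v3]].
rewrite mem_filter => /andP[/= ne _]; rewrite !(can_eq cdK).
by apply: contraNN ne => /and3P[/eqP -> /eqP -> /eqP ->].
Qed.

(** The first entry is a power of two and the fourth is 0. *)
Lemma vis_ok i j : ~~ pat (ground nu (finst i j vis)).2.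
Proof. by rewrite /= vidE expn_eq0. Qed.

Lemma all_flatten_map (I A : Type) (a : pred A) (F : I -> seq A) (s : seq I) :
  all a (flatten (map F s)) = all (fun i => all a (F i)) s.
Proof. by elim: s => //= i s <-; rewrite all_cat. Qed.

Lemma red_sat x T W :
  all (fun f => ~~ pat (ground nu f).2) (red_facts x T W) <-> sat_tab x T W al.
Proof.
rewrite /red_facts !all_cat base_ok !all_flatten_map.
rewrite (@blk_holds 0 0 (cH M (ohead x))) // (@blk_holds T 0 (cE M)) //.
rewrite andTb; split.
- case/and5P=> hH /allP hX' /allP hT hE /allP hO; split=> //.
  + by move=> j hj; rewrite -blk_holds //; apply: hX'; rewrite mem_iota.
  + move=> i hi; have := hT i; rewrite mem_iota hi => /(_ isT); rewrite all_cat blk_holds //.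
    case/andP=> hB; rewrite all_flatten_map => /allP hA; split; [exact: hB | move=> j hj].
    by rewrite -blk_holds //; apply: hA; rewrite mem_iota.
  + move=> j hj; rewrite -blk_holds //; have := hO j; rewrite mem_iota hj.
    by move=> /(_ isT); rewrite map_rcons all_rcons => /andP[].
- case=> hH hX' hT hE hO; apply/and5P; split=> //; apply/allP => i;
    rewrite mem_iota /= add0n => hi.
  + by rewrite blk_holds // hX'.
  + have [hB hA] := hT i hi; rewrite all_cat blk_holds // hB all_flatten_map.
    apply/allP => j; rewrite mem_iota /= add0n => hj.
    by rewrite blk_holds // hA.
  + by rewrite map_rcons all_rcons vis_ok blk_holds // hO.
Qed.

End Valuation.
End Database.

Lemma models_q0_pat nu D : over_schema q0 D ->
  models q0 (completion nu D) <->
  ~~ all (fun f => ~~ pat (ground nu f).2) (idb_facts D).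
Proof.
move=> /over_q0 HD; rewrite models_q0 -has_predC; split.
  case=> a [b [c]]; rewrite mem_completion => /mapP[f hf [_ E]].
  by apply/hasP; exists f => //=; rewrite negbK -E /= !eqxx.
case/hasP=> f hf; rewrite /= negbK.
have [h1 _] := HD f hf.
case E: (map _ _) => [|a [|b [|c [|a' [|b' [|c' [|]]]]]]] //=.
case/and3P=> /eqP ea /eqP eb /eqP ec; exists a, b, c.
rewrite mem_completion; apply/mapP; exists f => //.
by rewrite h1 E -ea -eb -ec.
Qed.

Section Hardness.

Variable M : TM.
Local Notation V := (value M).

Lemma dsize_gt0 : 0 < dsize M.
Proof. exact: leq_ltn_trans (leq0n _) (cd_lt (outv M None)). Qed.

(** Failing to match the query means that the values differ from the forbidden triple, and [base]
    contains every pair of distinct triples. So a satisfied constraint leaves no trace in the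
    completion. *)
Lemma con_like_base nu (i j : nat) (c : constr M) f :
  (forall z, nu z < dsize M) -> on_nulls c ->
  f \in map (finst i j) (con c) -> ~~ pat (ground nu f).2 ->
  ground nu f \in map (ground (fun=> 0)) (map (finst 0 0) (base M)).
Proof.
move=> Hnu; case: c => [[[P t1] t2] t3] /= /and3P[h1 h2 h3].
case/mapP=> s /mapP[[[u1 u2] u3] _ ->] ->.
rewrite /ground /= !(val_null Hnu) // !(can_eq (@cdK M)) => np.
set v1 := tmval _ _ _ t1 in np *; set v2 := tmval _ _ _ t2 in np *.
set v3 := tmval _ _ _ t3 in np *.
apply/mapP; exists (finst 0 0 (map SC (triple (v1, v2, v3) ++ triple (u1, u2, u3)))) => //.
apply/map_f/mapP; exists ((v1, v2, v3), (u1, u2, u3)) => //.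
rewrite mem_filter mem_enum andbT /=; apply: contraNN np.
by case/eqP=> -> -> ->; rewrite !eqxx.
Qed.

Lemma blk_like_base nu (i j : nat) (cs : seq (constr M)) f :
  (forall z, nu z < dsize M) -> all (@on_nulls M) cs ->
  f \in map (finst i j) (blk cs) -> ~~ pat (ground nu f).2 ->
  ground nu f \in map (ground (fun=> 0)) (map (finst 0 0) (base M)).
Proof.
move=> Hnu; elim: cs => // c cs IH /= /andP[hc hcs].
rewrite /blk /= map_cat mem_cat => /orP[hf|hf]; first exact: con_like_base hf.
exact: IH.
Qed.

Definition visG (j : nat) (o : option bool) : gfact :=
  (0, [:: vid (dsize M + j); cd (outv M o); 0; 0; 0; 0]).
Definition Phi (W : nat) (y : seq bool) : {fset gfact} :=
  seq_fset tt (map (ground (fun=> 0)) (map (finst 0 0) (base M)) ++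
               [seq visG j (onth y j) | j <- iota 0 W]).

Lemma ground_base nu f : f \in map (finst 0 0) (base M) ->
  ground nu f = ground (fun=> 0) f.
Proof. by case/mapP=> s /mapP[p _ ->] ->. Qed.

Lemma red_completion nu x T W y : (forall z, nu z < dsize M) ->
  all (fun f => ~~ pat (ground nu f).2) (red_facts M x T W) ->
  (forall j, j < W -> dc M (nu (nid 3 T j)) = outv M (onth y j)) ->
  completion nu (redD M x T W) = Phi W y.
Proof.
move=> Hnu Hok Hy; apply/fsetP => g; rewrite mem_completion seq_fsetE mem_cat.
have visE j : j < W -> ground nu (finst T j (vis M)) = visG j (onth y j).
  by move=> hj; rewrite /visG -Hy // dcK // /ground /= !addn0.
have HX j : all (@on_nulls M) (cX M (onth (behead x) j)) by [].
apply/mapP/orP => [[f hf ->]|].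
  rewrite -[(f.1, _)]/(ground nu f).
  have ok := allP Hok _ hf; move: hf; rewrite /= /red_facts !mem_cat.
  case/or4P=> [hf|hf|/flatten_mapP[j _ hf]|/or3P[|hf|/flatten_mapP[j]]].
  - by left; rewrite ground_base // map_f.
  - by left; apply: (@blk_like_base nu 0 0 (cH M (ohead x))).
  - by left; apply: (@blk_like_base nu 0 j (cX M (onth (behead x) j))).
  - case/flatten_mapP=> i _; rewrite mem_cat => /orP[hf|/flatten_mapP[j _ hf]].
      by left; apply: (@blk_like_base nu i 0 (cB M)).
    by left; apply: (@blk_like_base nu i j (cA M)).
  - by left; apply: (@blk_like_base nu T 0 (cE M)).
  - rewrite mem_iota map_rcons mem_rcons inE => hj /orP[/eqP ->|hf].
      by right; apply/mapP; exists j; rewrite ?mem_iota // visE.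
    by left; apply: (@blk_like_base nu T j (cO M)).
case=> /mapP[f hf ->].
  exists f; last by rewrite -(ground_base nu hf).
  by rewrite /= /red_facts mem_cat hf.
rewrite mem_iota in hf; exists (finst T f (vis M)); last by rewrite -visE.
rewrite /= /red_facts !mem_cat; do 5 (apply/orP; right).
apply/flatten_mapP; exists f; first by rewrite mem_iota.
by rewrite map_rcons mem_rcons inE eqxx.
Qed.

(** First entries beyond the domain separate the visible facts from [base], and the exponent tells
    the position. Only [W] positions are shown, hence the bounds on the sizes. *)
Lemma Phi_inj W y y' : size y <= W -> size y' <= W -> Phi W y = Phi W y' -> y = y'.
Proof.
move=> hy hy' E; apply: eq_from_onth => j.
have [hj|hj] := ltnP j W; last by rewrite !onth_default // (leq_trans _ hj).
have : visG j (onth y j) \in Phi W y'.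
  rewrite -E seq_fsetE mem_cat; apply/orP; right; apply/mapP.
  by exists j; rewrite // mem_iota.
have big : dsize M < vid (dsize M + j).
  rewrite vidE; apply: leq_ltn_trans (leq_addr j _) _.
  exact: ltn_expl.
rewrite seq_fsetE mem_cat => /orP[/mapP[f /mapP[s /mapP[p _ ->] ->]] [h _]|].
  by move: big; rewrite h ltnNge ltnW // cd_lt.
case/mapP=> j' hj' [hv hc].
move: hv; rewrite !vidE => /eqP; rewrite eqn_exp2l // eqn_add2l => /eqP Ej.
have := congr1 (@dc M) hc; rewrite !cdK -Ej => -[].
by [].
Qed.

Lemma red_over x T W : over_schema q0 (redD M x T W).
Proof.
have Hcon i j (c : constr M) f : f \in map (finst i j) (con c) ->
    f.1 = 0 /\ size f.2 = 6.
  by case: c => [[[P t1] t2] t3] /mapP[s /mapP[u _ ->] ->].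
have Hblk i j (cs : seq (constr M)) f : f \in map (finst i j) (blk cs) ->
    f.1 = 0 /\ size f.2 = 6.
  elim: cs => // c cs IH; rewrite /blk /= map_cat mem_cat => /orP[/Hcon|/IH] //.
apply/over_q0 => f; rewrite /= /red_facts !mem_cat.
case/or4P=> [|/Hblk|/flatten_mapP[j _ /Hblk]|/or3P[|/Hblk|/flatten_mapP[j _]]] //.
- by case/mapP=> s /mapP[p _ ->] ->.
- by case/flatten_mapP=> i _; rewrite mem_cat => /orP[/Hblk|/flatten_mapP[j _ /Hblk]].
- by rewrite map_rcons mem_rcons inE => /orP[/eqP ->|/Hblk].
Qed.

Lemma red_count x t T W : halts_within M x t -> t <= T -> size x + 2 * T + 2 <= W ->
  CompU_neg q0 (enc_uidb (redD M x T W)) =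
  size (undup [seq output c | c <- halting_configs M x t & tm_accept M c.1.1.1]).
Proof.
move=> hlt tT TW; rewrite CompU_neg_enc; last exact: red_over.
have outsz y : y \in [seq output c | c <- halting_configs M x t & tm_accept M c.1.1.1] ->
    size y <= W.
  case/mapP=> c; rewrite mem_filter => /andP[_ /mem_halting[i hi /andP[hc _]]] ->.
  case: c hc => [[[q l] a] r] /size_frontier h.
  apply: leq_trans (@size_read_out M (a :: r)) _; apply: leq_ltn_trans h _; lia.
apply: (@count_comp_negE _ _ _ _ (Phi W)).
- by move=> y y' hy hy'; apply: Phi_inj; apply: outsz.
- move=> C /completionsP[nu Hnu ->].
  (* The valuation is known to take domain values only at the nulls; the default 0 extends this to
     all arguments without changing the completion. *)
  pose nu' z := if nu z < dsize M then nu z else 0.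
  have Hnu' z : nu' z < dsize M by rewrite /nu'; case: ifP => // _; exact: dsize_gt0.
  have -> : completion nu (redD M x T W) = completion nu' (redD M x T W).
    apply: completion_eq => z /Hnu; rewrite mem_iota /= add0n => h.
    by rewrite /nu' h.
  rewrite models_q0_pat; last exact: red_over.
  move/negP/negPn => hok.
  have /(tableau_sound hlt tT TW) [cf hcf [hacc Hout]] := (red_sat Hnu' x T W).1 hok.
  exists (output cf); first by apply/map_f; rewrite mem_filter hacc.
  by apply: red_completion => // j hj; rewrite Hout.
- move=> y /mapP[cf]; rewrite mem_filter => /andP[hacc hcf] ->.
  have [al Hsat Hout] := tableau_complete W tT hcf hacc.
  (* Names are decodable, so any assignment to the grid is induced by a valuation. *)
  pose nu z := let: (tag, i, j) := nid_dec z in cd (al tag i j).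
  have Hnu z : nu z < dsize M by rewrite /nu; case: nid_dec => [[? ?] ?]; exact: cd_lt.
  have Eal : al = (fun tag i j => dc M (nu (nid tag i j))).
    do 3 (apply: functional_extensionality => ?).
    by rewrite /nu nidK cdK.
  rewrite Eal in Hsat Hout.
  have hok := (red_sat Hnu x T W).2 Hsat.
  rewrite -(red_completion Hnu hok (fun j _ => Hout T j)); split.
    by apply/completionsP; exists nu => // z _; rewrite mem_iota Hnu.
  by rewrite models_q0_pat; [rewrite hok | exact: red_over].
Qed.

End Hardness.

Theorem CompU_neg_hard h : SpanP h ->
  exists g, parsimonious_reduction h (CompU_neg q0) g.
Proof.
case=> M [c [k HM]].
(* With [N] the maximum of 1 and the input length, the running time is at most T = 2c N^k, and N +
   2T + 2 is at most W = (4c + 4) N^(k+1); the larger exponent covers the linear term when k = 0. *)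
pose p := red_prog (2 * c) k (4 * c + 4) k.+1 (tblock (base M)) (tblock (blk (cB M)))
  (tblock (blk (cA M))) (tblock (blk (cE M))) (tblock (rcons (blk (cO M)) (vis M)))
  (lits (marker 4 ++ flatten (map enc_num (iota 0 (dsize M)))))
  (fun o => tblock (blk (cH M o))) (fun o => tblock (blk (cX M o))).
exists (fun x => rev (run (fuel_of x) p (env0 x) 1)); split.
  by apply: poly_time_prog; exact: det_red_prog.
move=> x; have [hlt ->] := HM x.
set N := fuel_of x.
have N1 : 0 < N by rewrite leq_max.
have Nx : size x <= N by rewrite leq_maxr.
have Nk : 0 < N ^ k by rewrite expn_gt0 N1.
have xk : size x ^ k <= N ^ k by case: (k) => // k'; rewrite leq_exp2r.
rewrite run_red_prog -/N; last by rewrite expnS; nia.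
rewrite -[red_out _ _ _ _ _ _ _ _ _ _ _]/(red_string M x _ _) -enc_redD.
rewrite (@red_count M x (c * size x ^ k + c)) //.
  by nia.
by rewrite expnS; nia.
Qed.

(** * First-order formulas over suffixes of bit strings *)

(** A truncated item yields the empty string, so the function is total; well-formedness is the
    business of [wf_enc]. *)
Fixpoint skip (s : seq bool) : seq bool :=
  match s with
  | [:: false, _ & s'] => skip s'
  | [:: true, _, _, _ & s'] => s'
  | _ => [::]
  end.

(** The budget [k] mirrors the fixed number of loop iterations; it is no restriction once it bounds
    the length, see [sufs_fuel]. *)
Fixpoint sufs (k : nat) (s : seq bool) : seq (seq bool) :=
  match k, s with
  | k'.+1, _ :: _ => s :: sufs k' (skip s)
  | _, _ => [::]
  end.

(** Lexicographic comparison of the leading blocks of digits, a proper prefix being smaller. *)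
Fixpoint ltd (s t : seq bool) : bool :=
  match s with
  | [:: false, b & s'] =>
      match t with
      | [:: false, c & t'] => if b == c then ltd s' t' else c
      | _ => false
      end
  | _ => match t with [:: false, _ & _] => true | _ => false end
  end.

(** [p] is the last digit read. It must be [true] at the end, as in a canonical number; starting
    from [true] admits 0. *)
Fixpoint numb (p : bool) (s : seq bool) : bool :=
  match s with
  | [:: false, b & s'] => numb b s'
  | [:: true, false, false, false & _] => p
  | _ => false
  end.

(* Bit strings are read as sequences of items, an item being a block of digits
   closed by a marker.  Atoms look at string [i] with its first [m] items
   dropped; [FAll m i f] binds the next free variable to the nonempty suffixes
   of that string that start at an item. *)
Inductive fm :=
| FPre of seq bool & nat & nat
| FLt of nat & nat & nat & nat
| FNum of nat & nat
| FAnd of fm & fm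
| FNot of fm
| FAll of nat & nat & fm.

Fixpoint sat (B l : nat) (e : nat -> seq bool) (f : fm) : bool :=
  match f with
  | FPre u m i => prefix u (iter m skip (e i))
  | FLt m i n j => ltd (iter m skip (e i)) (iter n skip (e j))
  | FNum m i => numb true (iter m skip (e i))
  | FAnd f g => sat B l e f && sat B l e g
  | FNot f => ~~ sat B l e f
  | FAll m i f =>
      all (fun s => sat B l.+1 (upd e l s) f) (sufs B (iter m skip (e i)))
  end.

Fixpoint wff (l : nat) (f : fm) : bool :=
  match f with
  | FPre _ _ i | FNum _ i => i < l
  | FLt _ i _ j => (i < l) && (j < l)
  | FAnd f g => wff l f && wff l g
  | FNot f => wff l f
  | FAll _ i f => (i < l) && wff l.+1 f
  end.

Lemma size_skip s : size (skip s) <= (size s).-1.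
Proof.
have [n] := ubnP (size s); elim: n s => // n IH [|[] [|b s]] //=.
  by case: s => [|? [|? s]] //= _; lia.
by move=> h; have := IH s ltac:(lia); lia.
Qed.

Ltac upd_ext :=
  apply: functional_extensionality => ?; rewrite /upd;
  repeat match goal with
  | |- context [?a == ?b :> nat] => destruct (eqVneq a b)
  end; subst; try done; try congruence; try (exfalso; lia).

Section FormulaProgram.

Variables (c0 k : nat).

Definition pop (v : nat) : prog := Case v Skip Skip Skip.
Definition clear (v : nat) : prog := reps c0 k (pop v).
Definition copy (v d : nat) : prog :=
  Seq (reps c0 k (Case v Skip (Push 2 false) (Push 2 true)))
      (reps c0 k (Case 2 Skip (Seq (Push v false) (Push d false))
                            (Seq (Push v true) (Push d true)))).

(** A loop cannot be left early. Once the marker is consumed, register [g] holds a flag and the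
    remaining iterations merely pop it and push it back. *)
Definition skip_prog (v g : nat) : prog :=
  Seq (reps c0 k (Case g (Case v Skip (pop v)
                          (Seq (pop v) (Seq (pop v) (Seq (pop v) (Push g true)))))
                       (Push g true) (Push g true)))
      (pop g).

Fixpoint skips_prog (m v g : nat) : prog :=
  if m is m'.+1 then Seq (skip_prog v g) (skips_prog m' v g) else Skip.

Fixpoint pre_prog (u : seq bool) : prog :=
  if u is b :: u' then
    Case 0 (Push 3 false) (if b then Push 3 false else pre_prog u')
                          (if b then pre_prog u' else Push 3 false)
  else Push 3 true.

Definition answer (b : bool) : prog := Seq (Push 3 b) (Push 2 true).

Definition lt_prog : prog :=
  let end_left := Case 1 (answer false)
    (Case 1 (answer false) (answer true) (answer true)) (answer false) in
  let digit b := Case 1 (answer false)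
    (Case 1 (answer false) (if b then answer false else Skip)
                           (if b then Skip else answer true)) (answer false) in
  reps c0 k (Case 2 (Case 0 end_left (Case 0 end_left (digit false) (digit true)) end_left)
                  (Push 2 true) (Push 2 true)).

(** Register 1 carries the digit [p] of [numb], initially [true]; register 2 is the flag that stops
    the scan. *)
Definition num_prog : prog :=
  Seq (Push 1 true)
    (reps c0 k (Case 2
      (Case 0 (answer false)
         (Case 0 (answer false) (Seq (pop 1) (Push 1 false)) (Seq (pop 1) (Push 1 true)))
         (Case 0 (answer false)
            (Case 0 (answer false)
               (Case 0 (answer false) (Case 1 (answer false) (answer false) (answer true))
                  (answer false))
               (answer false))
            (answer false)))
      (Push 2 true) (Push 2 true))).

Definition and_prog : prog :=
  Case 3 Skip (Case 3 Skip (Push 3 false) (Push 3 false))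
              (Case 3 Skip (Push 3 false) (Push 3 true)).

(* Registers: 0, 1, 2 scratch, 3 a stack of truth values, [i + 4] variable [i]. *)
Fixpoint compf (l : nat) (f : fm) : prog :=
  match f with
  | FPre u m i => Seq (copy (i + 4) 0) (Seq (skips_prog m 0 1)
                    (Seq (pre_prog u) (clear 0)))
  | FLt m i n j => Seq (copy (i + 4) 0) (Seq (skips_prog m 0 1)
                  (Seq (copy (j + 4) 1) (Seq (skips_prog n 1 2)
                  (Seq lt_prog (Seq (clear 0) (Seq (clear 1) (pop 2)))))))
  | FNum m i => Seq (copy (i + 4) 0) (Seq (skips_prog m 0 1)
                  (Seq num_prog (Seq (clear 0) (Seq (clear 1) (pop 2)))))
  | FAnd f g => Seq (compf l f) (Seq (compf l g) and_prog)
  | FNot f => Seq (compf l f) (Case 3 Skip (Push 3 true) (Push 3 false))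
  | FAll m i f =>
      let body := Seq (compf l.+1 f) (Seq and_prog (skip_prog (l + 4) 1)) in
      Seq (copy (i + 4) (l + 4)) (Seq (skips_prog m (l + 4) 1) (Seq (Push 3 true)
        (reps c0 k (Case (l + 4) Skip (Seq (Push (l + 4) false) body)
                                      (Seq (Push (l + 4) true) body)))))
  end.

Lemma det_skips m v g : det (skips_prog m v g).
Proof. by elim: m => //= m ->; rewrite det_reps. Qed.

Lemma det_compf l f : det (compf l f).
Proof.
elim: f l => [u m i|m i n j|m i|f IHf g IHg|f IHf|m i f IHf] l;
  rewrite [det _]/= ?IHf ?IHg ?det_skips ?det_reps //= ?IHf ?det_reps //=.
by rewrite !andbT; elim: u => //= -[] u ->.
Qed.

Variable N : nat.
Local Notation B := (c0 * N ^ k).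

Lemma upd_same e v s t : upd (upd e v s) v t = upd e v t.
Proof. by apply: functional_extensionality => u; rewrite /upd; case: eqP. Qed.

Lemma upd_id e v : upd e v (e v) = e.
Proof. by apply: functional_extensionality => u; rewrite /upd; case: eqP => // ->. Qed.

Lemma updE e v s : upd e v s v = s.
Proof. by rewrite /upd eqxx. Qed.

Lemma updN e v s u : u != v -> upd e v s u = e u.
Proof. by rewrite /upd => /negPf ->. Qed.

Lemma updC e u v s t : u != v -> upd (upd e u s) v t = upd (upd e v t) u s.
Proof.
move=> ne; apply: functional_extensionality => w; rewrite /upd.
by case: (eqVneq w v) => // ->; rewrite eq_sym (negPf ne).
Qed.

Lemma run_clear v e : size (e v) <= B -> run N (clear v) e = upd e v [::].
Proof.
rewrite run_reps; elim: B e => [|b IH] e hb.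
  have E : e v = [::] by case: (e v) hb.
  by rewrite -[in RHS]E upd_id.
rewrite iterSr /=; case E: (e v) hb => [|c s] hb.
  by rewrite IH ?E.
by rewrite if_same IH ?upd_same // updE.
Qed.

Lemma run_copy v d e : v != 2 -> d != 2 -> v != d -> e 2 = [::] -> e d = [::] ->
  size (e v) <= B -> run N (copy v d) e = upd e d (e v).
Proof.
move=> v2 d2 vd e2 ed hB; rewrite /= !run_reps.
have H1 b s t e' : size s <= b ->
    iter b (run N (Case v Skip (Push 2 false) (Push 2 true))) (upd (upd e' v s) 2 t) =
    upd (upd e' v [::]) 2 (catrev s t).
  elim: b s t => [|b IH] s t hb; first by case: s hb.
  rewrite iterSr /= updN // updE; case: s hb => [|c s] hb; first by rewrite IH.
  rewrite [X in iter b _ X](_ : _ = upd (upd e' v s) 2 (c :: t)) ?IH //.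
  by case: c {hb}; rewrite /= ?updE; upd_ext.
have H2 b s t t' e' : size s <= b ->
    iter b (run N (Case 2 Skip (Seq (Push v false) (Push d false))
                               (Seq (Push v true) (Push d true))))
      (upd (upd (upd e' 2 s) v t) d t') =
    upd (upd (upd e' 2 [::]) v (catrev s t)) d (catrev s t').
  elim: b s t t' => [|b IH] s t t' hb; first by case: s hb.
  rewrite iterSr /= updN 1?eq_sym // updN 1?eq_sym // updE.
  case: s hb => [|c s] hb; first by rewrite IH.
  rewrite [X in iter b _ X](_ : _ = upd (upd (upd e' 2 s) v (c :: t)) d (c :: t')) ?IH //.
  by case: c {hb}; upd_ext.
have E0 : e = upd (upd e v (e v)) 2 [::] by rewrite upd_id -e2 upd_id.
rewrite {1}E0 H1 //.
have -> : upd (upd e v [::]) 2 (catrev (e v) [::]) =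
    upd (upd (upd e 2 (catrev (e v) [::])) v [::]) d [::] by upd_ext.
rewrite H2 ?catrevE ?cats0 ?size_rev // revK; upd_ext.
Qed.

Lemma run_skip v g e : v != g -> e g = [::] -> size (e v) < B ->
  run N (skip_prog v g) e = upd e v (skip (e v)).
Proof.
move=> vg eg hB; rewrite /= run_reps.
set body := Case g _ _ _.
have done_ b e' : e' g = [:: true] -> iter b (run N body) e' = e'.
  move=> E; elim: b => // b IH; rewrite iterS IH /= E.
  by rewrite updE upd_same -E upd_id.
have idle b e' : e' g = [::] -> e' v = [::] -> iter b (run N body) e' = e'.
  by move=> E1 Ev; elim: b => // b IH; rewrite iterS IH /= E1 Ev.
have fin b e' r : e' g = [::] ->
    run N (pop g) (iter b (run N body) (upd (upd e' v r) g [:: true])) = upd e' v r.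
  by move=> E1; rewrite done_ ?updE //= ?upd_same; upd_ext.
have H b s e' : e' g = [::] -> e' v = s -> size s < b ->
    run N (pop g) (iter b (run N body) e') = upd e' v (skip s).
  elim: b s e' => // b IH s e' E1 Ev hb; case: s Ev hb => [|[] s] Ev hb.
  - by rewrite idle //= E1 -Ev upd_id.
  - rewrite iterSr [run _ _ e']/= E1 Ev updE.
    have rd w t : upd (upd e' v w) v t g = [::] by rewrite !updN // eq_sym.
    case: s Ev hb => [|x [|y [|z r]]] Ev hb; rewrite ?updE ?if_same ?upd_same ?updE
      ?if_same ?upd_same ?updE ?if_same ?upd_same ?(updN _ _ (_ : g != v)) ?E1 1?eq_sym //;
      exact: fin.
  - rewrite iterSr [run _ _ e']/= E1 Ev updE.
    have E1' w : upd e' v w g = [::] by rewrite updN // eq_sym.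
    case: s Ev hb => [|x s] Ev hb; first by rewrite idle ?updE //= E1'.
    by rewrite if_same upd_same (IH s) ?updE ?upd_same //; move: hb => /=; lia.
by apply: H.
Qed.

Lemma run_skips m v g e : v != g -> e g = [::] -> size (e v) < B ->
  run N (skips_prog m v g) e = upd e v (iter m skip (e v)).
Proof.
move=> vg; elim: m e => [|m IH] e eg hB; first by rewrite /= upd_id.
rewrite -[LHS]/(run N (skips_prog m v g) (run N (skip_prog v g) e)) run_skip //.
have hsk := size_skip (e v).
rewrite IH; first by rewrite updE upd_same -iterSr.
  by rewrite updN // eq_sym.
by rewrite updE; lia.
Qed.

Lemma size_skips m s : size (iter m skip s) <= size s.
Proof. by elim: m => //= m IH; have := size_skip (iter m skip s); lia. Qed.

Definition set_regs (e : env) (a b c r : seq bool) : env := fun u =>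
  match u with 0 => a | 1 => b | 2 => c | 3 => r | _ => e u end.

Lemma upd_regs0 e a b c r s : upd (set_regs e a b c r) 0 s = set_regs e s b c r.
Proof. by apply: functional_extensionality => -[|[|[|[|u]]]]. Qed.
Lemma upd_regs1 e a b c r s : upd (set_regs e a b c r) 1 s = set_regs e a s c r.
Proof. by apply: functional_extensionality => -[|[|[|[|u]]]]. Qed.
Lemma upd_regs2 e a b c r s : upd (set_regs e a b c r) 2 s = set_regs e a b s r.
Proof. by apply: functional_extensionality => -[|[|[|[|u]]]]. Qed.
Lemma upd_regs3 e a b c r s : upd (set_regs e a b c r) 3 s = set_regs e a b c s.
Proof. by apply: functional_extensionality => -[|[|[|[|u]]]]. Qed.
Definition upd_regs := (upd_regs0, upd_regs1, upd_regs2, upd_regs3).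

Lemma set_regs_id e : e = set_regs e (e 0) (e 1) (e 2) (e 3).
Proof. by apply: functional_extensionality => -[|[|[|[|u]]]]. Qed.

(** The unread rest [s'] depends on where the test stopped; only its length matters, because the
    register is cleared next. [run_lt] and [run_num] follow the same pattern. *)
Lemma run_pre u s e b c r :
  exists s', size s' <= size s /\
    run N (pre_prog u) (set_regs e s b c r) = set_regs e s' b c (prefix u s :: r).
Proof.
elim: u s => [|x u IH] s /=; first by exists s; rewrite upd_regs prefix0s.
case: s => [|y s] /=; first by exists [::]; rewrite upd_regs.
have [s' [hs' E]] := IH s.
case: x; case: y; rewrite !upd_regs ?E.
- by exists s'; split=> //; exact: leqW.
- by exists s; rewrite /= upd_regs; split; [exact: leqnSn | by []].
- by exists s; rewrite /= upd_regs; split; [exact: leqnSn | by []].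
- by exists s'; split=> //; exact: leqW.
Qed.

Lemma run_lt s t e r : size s < B -> size t <= B ->
  exists s' t', [/\ size s' <= B, size t' <= B &
    run N lt_prog (set_regs e s t [::] r) =
      set_regs e s' t' [:: true] (ltd s t :: r)].
Proof.
rewrite run_reps; set body := Case 2 _ _ _.
have done_ b s0 t0 r0 : iter b (run N body) (set_regs e s0 t0 [:: true] r0) =
    set_regs e s0 t0 [:: true] r0.
  by elim: b => // b IH; rewrite iterS IH /= !upd_regs.
suff H b : size s < b -> exists s' t', [/\ size s' <= size s, size t' <= size t &
    iter b (run N body) (set_regs e s t [::] r) =
      set_regs e s' t' [:: true] (ltd s t :: r)].
  move=> hs ht; have [s' [t' [h1 h2 h3]]] := H _ hs; exists s', t'.
  by split=> //; lia.
elim: b s t => // b IH s t hb; rewrite iterSr.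
have fin (s1 t1 s0 t0 : seq bool) x : size s0 <= size s1 -> size t0 <= size t1 ->
    exists s' t', [/\ size s' <= size s1, size t' <= size t1 &
      iter b (run N body) (set_regs e s0 t0 [:: true] (x :: r)) =
      set_regs e s' t' [:: true] (x :: r)].
  by move=> h1 h2; exists s0, t0; rewrite done_.
have end_left (s1 s0 : seq bool) : size s0 <= size s1 ->
    exists s' t', [/\ size s' <= size s1, size t' <= size t &
      iter b (run N body) (run N (Case 1 (answer false)
    (Case 1 (answer false) (answer true) (answer true)) (answer false))
      (set_regs e s0 t [::] r)) =
      set_regs e s' t' [:: true]
       ((if t is [:: false, _ & _] then true else false) :: r)].
  case: t {IH} => [|[] [|[] t]] h; rewrite [run _ _ _]/= !upd_regs; apply: fin => //=; lia.
case: s hb => [|[] s] hb.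
- exact: (end_left [::] [::] (leqnn _)).
- by rewrite [run _ _ _]/= upd_regs; apply: (end_left (true :: s) s (leqnSn _)).
case: s hb => [|x s] hb.
- by rewrite [run _ _ _]/= upd_regs; apply: (end_left [:: false] [::] (leq0n _)).
case: t {end_left} => [|[] t].
- by case: x hb => hb; rewrite [run _ _ _]/= !upd_regs; apply: fin => /=; lia.
- by case: x hb => hb; rewrite [run _ _ _]/= !upd_regs; apply: fin => /=; lia.
case: t => [|y t].
- by case: x hb => hb; rewrite [run _ _ _]/= !upd_regs; apply: fin => /=; lia.
case: x hb => hb; case: y; rewrite [run _ _ _]/= !upd_regs [ltd _ _]/=.
- have [s' [t' [h1 h2 ->]]] := IH s t ltac:(move: hb => /=; lia).
  by exists s', t'; split=> //=; lia.
- by apply: fin => /=; lia.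
- by apply: fin => /=; lia.
- have [s' [t' [h1 h2 ->]]] := IH s t ltac:(move: hb => /=; lia).
  by exists s', t'; split=> //=; lia.
Qed.

Lemma run_num s e r : size s < B ->
  exists s' t', [/\ size s' <= B, size t' <= B &
    run N num_prog (set_regs e s [::] [::] r) =
      set_regs e s' t' [:: true] (numb true s :: r)].
Proof.
rewrite [run _ _ _]/= run_reps upd_regs; set body := Case 2 _ _ _.
have done_ b s0 t0 r0 : iter b (run N body) (set_regs e s0 t0 [:: true] r0) =
    set_regs e s0 t0 [:: true] r0.
  by elim: b => // b IH; rewrite iterS IH /= !upd_regs.
suff H b p : size s < b -> exists s' t', [/\ size s' <= size s, size t' <= 1 &
    iter b (run N body) (set_regs e s [:: p] [::] r) =
      set_regs e s' t' [:: true] (numb p s :: r)].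
  move=> hs; have [s' [t' [h1 h2 h3]]] := H _ true hs; exists s', t'.
  by split=> //; lia.
elim: b s p => // b IH s p hb; rewrite iterSr.
have fin (s1 s0 t0 : seq bool) x : size s0 <= size s1 -> size t0 <= 1 ->
    exists s' t', [/\ size s' <= size s1, size t' <= 1 &
      iter b (run N body) (set_regs e s0 t0 [:: true] (x :: r)) =
      set_regs e s' t' [:: true] (x :: r)].
  by move=> h1 h2; exists s0, t0; rewrite done_.
case: s hb => [|[] s] hb.
- by rewrite [run _ _ _]/= !upd_regs; apply: fin.
- case: s hb => [|[] s] hb; try (rewrite [run _ _ _]/= !upd_regs; apply: fin => /=; lia).
  case: s hb => [|[] s] hb; try (rewrite [run _ _ _]/= !upd_regs; apply: fin => /=; lia).
  case: s hb => [|[] s] hb; try (rewrite [run _ _ _]/= !upd_regs; apply: fin => /=; lia).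
  by case: p; rewrite [run _ _ _]/= !upd_regs; apply: fin => /=; lia.
- case: s hb => [|x s] hb; first by rewrite [run _ _ _]/= !upd_regs; apply: fin.
  have [s' [t' [h1 h2 E]]] := IH s x ltac:(move: hb => /=; lia).
  exists s', t'; split; [by rewrite /=; lia | exact: h2 |].
  rewrite -[numb p _]/(numb x s) -E; case: x {E hb}; case: p;
    by rewrite [run _ _ (set_regs _ _ _ _ _)]/= !upd_regs.
Qed.

Lemma run_and e a b c p q r :
  run N and_prog (set_regs e a b c [:: p, q & r]) =
  set_regs e a b c ((q && p) :: r).
Proof. by case: p; case: q; rewrite /= !upd_regs. Qed.

(* The registers are clean, no variable of level [l] or more is in use, and
   all strings are short enough for the loops. *)
Definition ready (l : nat) (e : env) : Prop :=
  [/\ e 0 = [::], e 1 = [::], e 2 = [::], forall j, l <= j -> e (j + 4) = [::] &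
      forall j, size (e (j + 4)) < B].

Definition vars (e : env) : nat -> seq bool := fun i => e (i + 4).

Lemma var_reg j v : v < 4 -> j + 4 != v. Proof. by lia. Qed.
Lemma reg_var j v : v < 4 -> v != j + 4. Proof. by lia. Qed.

Lemma ready_regs l e x : ready l e -> set_regs e [::] [::] [::] x = upd e 3 x.
Proof.
by case=> e0 e1 e2 _ _; apply: functional_extensionality => -[|[|[|[|u]]]].
Qed.

Lemma ready_push l e x : ready l e -> ready l (upd e 3 x).
Proof.
by case=> e0 e1 e2 el eB; split=> // j *; rewrite updN ?var_reg //; apply: el.
Qed.

Lemma ready_bind l e s : ready l e -> size s < B -> ready l.+1 (upd e (l + 4) s).
Proof.
case=> e0 e1 e2 el eB hs; split; rewrite ?updN ?(var_reg, reg_var) //.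
- by move=> j hj; rewrite updN ?el ?(ltnW hj) //; lia.
- by move=> j; rewrite /upd; case: eqP.
Qed.

Lemma vars_push e x : vars (upd e 3 x) = vars e.
Proof. by apply: functional_extensionality => i; rewrite /vars updN ?(var_reg, reg_var). Qed.

Lemma vars_bind e l s : vars (upd e (l + 4) s) = upd (vars e) l s.
Proof.
by apply: functional_extensionality => i; rewrite /vars /upd eqn_add2r.
Qed.

Lemma copy_ready l e i d : ready l e -> (d = 0 \/ d = l + 4) -> i < l ->
  run N (copy (i + 4) d) e = upd e d (e (i + 4)).
Proof.
case=> e0 e1 e2 el eB hd hi; apply: run_copy => //.
- by rewrite var_reg.
- by case: hd => ->; lia.
- by case: hd => ->; lia.
- by case: hd => -> //; apply: el.
- exact: ltnW.
Qed.

Lemma run_load e l m i d g : ready l e -> (d = 0 \/ d = l + 4) -> i < l -> d != g ->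
  g \in [:: 1; 2] ->
  run N (Seq (copy (i + 4) d) (skips_prog m d g)) e =
  upd e d (iter m skip (e (i + 4))).
Proof.
move=> Hr hd hi dg hg; rewrite -[LHS]/(run N (skips_prog m d g) (run N (copy (i + 4) d) e)).
rewrite (copy_ready Hr) //; have [e0 e1 e2 el eB] := Hr.
rewrite run_skips ?updE ?upd_same // updN 1?eq_sym //.
by move: hg; rewrite !inE => /orP[] /eqP ->.
Qed.

Lemma run_compf l f e : wff l f -> ready l e ->
  run N (compf l f) e = upd e 3 (sat B l (vars e) f :: e 3).
Proof.
elim: f l e => [u m i|m i n j|m i|f IHf g IHg|f IHf|m i f IHf] l e.
- move=> /= hi Hr; have [e0 e1 e2 el eB] := Hr.
  rewrite -[LHS]/(run N (clear 0) (run N (pre_prog u)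
    (run N (Seq (copy (i + 4) 0) (skips_prog m 0 1)) e))).
  rewrite (run_load _ Hr) //; last by left.
  rewrite (_ : upd e 0 _ = set_regs e (iter m skip (e (i + 4))) [::] [::] (e 3)); last first.
    by apply: functional_extensionality => -[|[|[|[|v]]]].
  have [s' [hs' ->]] := run_pre u (iter m skip (e (i + 4))) e [::] [::] (e 3).
  rewrite run_clear; last first.
    apply: leq_trans hs' _; apply: leq_trans (size_skips _ _) _; exact: ltnW (eB i).
  by rewrite upd_regs0 (ready_regs _ Hr).
- move=> /= /andP[hi hj] Hr; have [e0 e1 e2 el eB] := Hr.
  rewrite -[LHS]/(run N (pop 2) (run N (clear 1) (run N (clear 0) (run N lt_prog
    (run N (skips_prog n 1 2) (run N (copy (j + 4) 1)
    (run N (Seq (copy (i + 4) 0) (skips_prog m 0 1)) e))))))).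
  rewrite (run_load _ Hr) //; last by left.
  have le x y : size (iter y skip (e (x + 4))) < B.
    exact: leq_ltn_trans (size_skips _ _) (eB x).
  rewrite run_copy ?updN ?var_reg //; last exact: ltnW.
  rewrite run_skips ?updE ?upd_same //.
  rewrite (_ : upd _ 1 _ = set_regs e (iter m skip (e (i + 4)))
    (iter n skip (e (j + 4))) [::] (e 3)); last first.
    by apply: functional_extensionality => -[|[|[|[|v]]]].
  have [s' [t' [h1 h2 ->]]] := run_lt e (e 3) (le i m) (ltnW (le j n)).
  rewrite (@run_clear 0) // upd_regs0 (@run_clear 1) // upd_regs1 /= upd_regs2.
  by rewrite (ready_regs _ Hr).
- move=> /= hi Hr; have [e0 e1 e2 el eB] := Hr.
  rewrite -[LHS]/(run N (pop 2) (run N (clear 1) (run N (clear 0) (run N num_prog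
    (run N (Seq (copy (i + 4) 0) (skips_prog m 0 1)) e))))).
  rewrite (run_load _ Hr) //; last by left.
  rewrite (_ : upd e 0 _ = set_regs e (iter m skip (e (i + 4))) [::] [::] (e 3)); last first.
    by apply: functional_extensionality => -[|[|[|[|v]]]].
  have le : size (iter m skip (e (i + 4))) < B.
    exact: leq_ltn_trans (size_skips _ _) (eB i).
  have [s' [t' [h1 h2 ->]]] := run_num e (e 3) le.
  rewrite (@run_clear 0) // upd_regs0 (@run_clear 1) // upd_regs1 /= upd_regs2.
  by rewrite (ready_regs _ Hr).
- move=> /= /andP[hf hg] Hr.
  rewrite -[LHS]/(run N and_prog (run N (compf l g) (run N (compf l f) e))).
  rewrite IHf // IHg //; last exact: ready_push.
  rewrite vars_push updE upd_same (set_regs_id (upd _ _ _)) updE run_and.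
  have [e0 e1 e2 _ _] := Hr; rewrite !updN // e0 e1 e2.
  by rewrite (ready_regs _ (ready_push _ Hr)) upd_same.
- move=> /= hf Hr; rewrite IHf // updE upd_same.
  by case: (sat _ _ _ _) => /=; rewrite !updE upd_same.
- move=> /andP[hi hf] Hr; have [e0 e1 e2 el eB] := Hr.
  set body := Seq (compf l.+1 f) (Seq and_prog (skip_prog (l + 4) 1)).
  rewrite -[LHS]/(run N (reps c0 k (Case (l + 4) Skip (Seq (Push (l + 4) false) body)
                                    (Seq (Push (l + 4) true) body)))
    (run N (Push 3 true)
      (run N (Seq (copy (i + 4) (l + 4)) (skips_prog m (l + 4) 1)) e))).
  rewrite (run_load _ Hr) ?var_reg //; last by right.
  rewrite run_reps [run N (Push _ _) _]/= updN ?(var_reg, reg_var) //.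
  set B0 := B in eB *.
  (* Each iteration conjoins the truth value of the body to the accumulator on stack 3 and advances
     by one item. *)
  have H b s acc : size s <= b -> size s < B ->
      iter b (run N (Case (l + 4) Skip (Seq (Push (l + 4) false) body)
                          (Seq (Push (l + 4) true) body)))
        (upd (upd e (l + 4) s) 3 (acc :: e 3)) =
      upd e 3 ((acc && all (fun s => sat B l.+1 (upd (vars e) l s) f) (sufs b s)) :: e 3).
    elim: b s acc => [|b IH] s acc hb hB.
      case: s hb hB => // _ _; rewrite andbT -{1}(el l (leqnn _)) upd_id //.
    rewrite iterSr; case: s hb hB => [|c s] hb hB.
      rewrite [run _ _ _]/= updN ?(var_reg, reg_var) // updE IH //.
      by case: (b).
    rewrite [run _ _ _]/= updN ?(var_reg, reg_var) // updE.
    (* Testing the string for emptiness pops a bit; both branches push it back before the body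
       runs. *)
    set e' := (if c then _ else _) _.
    have {e'}-> : e' = run N body (upd (upd e (l + 4) (c :: s)) 3 (acc :: e 3)).
      rewrite /e'; case: (c); congr (run N body _); rewrite updE upd_same;
        by rewrite updC ?upd_same // reg_var.
    have Hr1 := ready_push (acc :: e 3) (ready_bind Hr hB).
    rewrite -[run N body _]/(run N (skip_prog (l + 4) 1) (run N and_prog
      (run N (compf l.+1 f) _))) IHf //.
    rewrite updE upd_same vars_push vars_bind (set_regs_id (upd _ 3 _)) updE run_and.
    rewrite !updN ?reg_var // e0 e1 e2.
    rewrite (ready_regs _ (ready_push _ (ready_bind Hr hB))) upd_same.
    rewrite run_skip; [|by rewrite var_reg|by rewrite !updN ?(var_reg, reg_var)|]; last first.
      by rewrite updN ?(var_reg, reg_var) // updE.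
    rewrite updN ?(var_reg, reg_var) // updE updC ?upd_same; last by rewrite reg_var.
    have hsk := size_skip (c :: s); rewrite [size (c :: s)]/= in hsk hb hB.
    by rewrite IH ?andbA //; lia.
  have le := leq_ltn_trans (size_skips m (e (i + 4))) (eB i).
  by rewrite H // ltnW.
Qed.

End FormulaProgram.

(** * Guessing strings and checking a formula *)

Lemma In_flatten_mapE (A C : Type) (f : A -> seq C) (s : seq A) y :
  List.In y (flatten (map f s)) <-> exists2 x, List.In x s & List.In y (f x).
Proof.
split; first exact: In_flatten_map.
elim: s => [|x s IH] [x' //= Hx Hy]; apply/List.in_or_app.
case: Hx => [->|Hx]; [by left | right; apply: IH; by exists x'].
Qed.

Lemma mem_map_In (A : Type) (T : eqType) (f : A -> T) (s : seq A) y :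
  y \in map f s <-> exists2 x, List.In x s & y = f x.
Proof.
elim: s => [|x s IH] /=; first by split=> // -[].
rewrite inE; split=> [/orP[/eqP ->|/IH[x' Hx ->]]|[x' Hx Ey]].
- by exists x => //; left.
- by exists x' => //; right.
- case: Hx => [E|Hx]; first by rewrite Ey E eqxx.
  by apply/orP; right; apply/IH; exists x'.
Qed.

(** The third choice of [Guess], pushing nothing, makes the shorter strings reachable although the
    number of iterations is fixed. *)
Lemma exec_guess N k v e e' :
  List.In e' (exec N (loopn k (Guess v)) e) <->
  exists2 s, size s <= N ^ k & e' = upd e v (s ++ e v).
Proof.
elim: k e e' => [|k IH] e e'; rewrite /=.
  split=> [[<-|[<-|[<-|[]]]]|[[|b [|//]] _ ->]].
  - by exists [::] => //=; rewrite upd_id.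
  - by exists [:: false].
  - by exists [:: true].
  - by left; rewrite upd_id.
  - by case: b => /=; tauto.
suff H j e1 : List.In e' (loop (exec N (loopn k (Guess v))) j e1) <->
    exists2 s, size s <= j * N ^ k & e' = upd e1 v (s ++ e1 v).
  by rewrite expnS; exact: H.
elim: j e1 => [|j IHj] e1 /=.
  split=> [[<-|[]]|[[|//] _ ->]]; first by exists [::] => //=; rewrite upd_id.
  by left; rewrite upd_id.
rewrite In_flatten_mapE; split.
  case=> e2 /IH[s hs ->] /IHj[t ht ->]; exists (t ++ s); last first.
    by rewrite updE upd_same catA.
  by rewrite size_cat mulSn; lia.
(* Guessed bits are pushed in front, so the first iteration supplies the last [N ^ k] bits of
   [s]. *)
case=> s hs Ee; set n := size s - N ^ k.
exists (upd e1 v (drop n s ++ e1 v)).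
  by apply/IH; exists (drop n s) => //; rewrite size_drop /n; lia.
apply/IHj; exists (take n s).
  by rewrite size_take_min; move: hs; rewrite mulSn /n; lia.
by rewrite Ee updE upd_same catA cat_take_drop.
Qed.

Lemma run_load_to N x v : size x <= N -> 0 < v ->
  run N (Loop (Case 0 Skip (Push v false) (Push v true))) (env0 x) =
  upd (fun=> [::]) v x.
Proof.
move=> hN v0.
have H s y k : size s <= k ->
    iter k (run N (Case 0 Skip (Push v false) (Push v true)))
      (upd (upd (fun=> [::]) 0 s) v y) = upd (fun=> [::]) v (catrev s y).
  elim: k s y => [|k IH] s y hs.
    by case: s hs => // _; rewrite (upd_id (fun=> [::]) 0).
  rewrite iterSr [run _ _ _]/= updN ?updE; last by rewrite neq_ltn v0.
  case: s hs => [|b s] hs; first exact: (IH [::]).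
  rewrite -[catrev (b :: s) y]/(catrev s (b :: y)) -IH //.
  by congr (iter _ _ _); case: b hs => hs; rewrite /= ?updE; upd_ext.
have -> : env0 x = upd (upd (fun=> [::]) 0 (rev x)) v [::].
  rewrite /env0; upd_ext.
by rewrite [LHS]/= H ?size_rev // catrevE revK cats0.
Qed.

Theorem SpanP_sat f k g : wff 3 f -> 0 < k ->
  (forall x, let N := fuel_of x in exists2 outs : seq (seq bool),
     g x = size (undup outs) &
     forall s, s \in outs <-> exists T Y, [/\ size T <= N ^ k, size Y <= N ^ k,
       sat (2 * N ^ k) 3 (fun i => nth [::] [:: x; T; Y] i) f & s = rev Y]) ->
  SpanP g.
Proof.
move=> Hf k0 Hg.
pose load := Loop (Case 0 Skip (Push 4 false) (Push 4 true)).
(* The factor 2 makes the loop bound [2 * N ^ k] strictly larger than the three strings, as [ready]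
   demands. A false verdict kills the branch. *)
pose verify := Seq (compf 2 k 3 f) (Case 3 Skip Fail Skip).
pose p := Seq load (Seq (loopn k (Guess 5)) (Seq (loopn k (Guess 6)) verify)).
apply: (@SpanP_prog p 6) => x; have [outs -> Houts] := Hg x.
set N := fuel_of x in Houts *.
have N1 : 0 < N by rewrite leq_max.
have xN : size x <= N by rewrite leq_maxr.
have NB : N <= N ^ k by rewrite -{1}(expn1 N) leq_pexp2l.
pose e T Y := upd (upd (upd (fun=> [::]) 4 x) 5 T) 6 Y.
have Hexec e' : List.In e' (exec N p (env0 x)) <-> exists T Y,
    [/\ size T <= N ^ k, size Y <= N ^ k & List.In e' (exec N verify (e T Y))].
  rewrite -[exec N p (env0 x)]/(flatten (map (exec N (Seq (loopn k (Guess 5))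
    (Seq (loopn k (Guess 6)) verify))) (exec N load (env0 x)))).
  rewrite exec_det // run_load_to //= cats0 In_flatten_mapE.
  split=> [[e1 /exec_guess[T hT ->]]|[T [Y [hT hY He']]]].
    rewrite In_flatten_mapE => -[e2 /exec_guess[Y hY ->]].
    by rewrite cats0 !updN // cats0; exists T, Y.
  exists (upd (upd (fun=> [::]) 4 x) 5 T).
    by apply/exec_guess; exists T; rewrite // updN // cats0.
  rewrite In_flatten_mapE; exists (e T Y) => //.
  by apply/exec_guess; exists Y; rewrite // !updN // cats0.
have Hver T Y : size T <= N ^ k -> size Y <= N ^ k ->
    exec N verify (e T Y) =
    if sat (2 * N ^ k) 3 (fun i => nth [::] [:: x; T; Y] i) f then [:: e T Y] else [::].
  move=> hT hY; have Npos : 0 < N ^ k by rewrite expn_gt0 N1.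
  have Hr : ready 2 k N 3 (e T Y).
    split=> // j; last first.
      by rewrite addn4; case: j => [|[|[|j]]]; rewrite /e /upd /=; lia.
    by rewrite addn4; case: j => [|[|[|j]]].
  rewrite [LHS]/= exec_det ?det_compf // run_compf // [flatten _]/= cats0.
  have -> : vars (e T Y) = (fun i => nth [::] [:: x; T; Y] i).
    apply: functional_extensionality => -[|[|[|j]]] //.
    by rewrite /vars /e /upd addn4 /= nth_nil.
  case: ifP => // _; congr [:: _]; rewrite upd_same; exact: (upd_id (e T Y) 3).
apply/perm_size/uniq_perm; rewrite ?undup_uniq // => s; rewrite !mem_undup.
apply/idP/idP => hs.
  have [T [Y [hT hY hsat ->]]] := (Houts s).1 hs.
  apply/mem_map_In; exists (e T Y) => //.
  by apply/Hexec; exists T, Y; rewrite Hver // hsat; split=> //; left.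
have [e' /Hexec[T [Y [hT hY He]]] ->] := (mem_map_In _ _ _).1 hs.
move: He; rewrite Hver //; case: ifP => // hsat [<-|[]] //.
by apply/Houts; exists T, Y.
Qed.

(** * Formulas about encoded databases *)

Fixpoint lexb (s t : seq bool) : bool :=
  match s, t with
  | b :: s', c :: t' => if b == c then lexb s' t' else c
  | [::], _ :: _ => true
  | _, [::] => false
  end.

Lemma lexb_irr s : lexb s s = false.
Proof. by elim: s => //= b s ->; rewrite eqxx. Qed.

Lemma lexb_trans : transitive lexb.
Proof.
elim=> [|b s IH] [|c t] [|d u] //=.
by case: b; case: c; case: d => //=; apply: IH.
Qed.

Lemma lexb_total s t : ~~ lexb s t -> ~~ lexb t s -> s = t.
Proof.
elim: s t => [|b s IH] [|c t] //=.
by case: b; case: c => //= h1 h2; rewrite (IH t).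
Qed.

(** This is not the numerical order: digits are compared from the least significant one. Totality
    and irreflexivity are what equality tests and sorting rely on, besides transitivity. *)
Definition nlt (m n : nat) : bool := lexb (binary m) (binary n).

Lemma nlt_eq m n : ~~ nlt m n && ~~ nlt n m = (m == n).
Proof.
apply/andP/eqP => [[h1 h2]|->]; last by rewrite /nlt lexb_irr.
by rewrite -(bval_binary m) (lexb_total h1 h2) bval_binary.
Qed.

Fixpoint lexs (s t : seq nat) : bool :=
  match s, t with
  | m :: s', n :: t' => nlt m n || (m == n) && lexs s' t'
  | [::], _ :: _ => true
  | _, [::] => false
  end.

Lemma lexs_irr s : lexs s s = false.
Proof. by elim: s => //= m s ->; rewrite andbF orbF /nlt lexb_irr. Qed.

Lemma lexs_trans : transitive lexs.
Proof.
elim=> [|b s IH] [|c t] [|d u] //=.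
case/orP=> [h1|/andP[/eqP -> h1]] /orP[h2|/andP[/eqP <- h2]].
- by rewrite /nlt (lexb_trans h1 h2).
- by rewrite h1.
- by rewrite h2.
- by rewrite eqxx (IH _ _ h1 h2) orbT.
Qed.

Lemma lexs_total s t : ~~ lexs s t -> ~~ lexs t s -> s = t.
Proof.
elim: s t => [|b s IH] [|c t] //=.
rewrite !negb_or => /andP[h1 h3] /andP[h2 h4].
have /eqP E : b == c by rewrite -nlt_eq h1 h2.
by move: h3 h4; rewrite E eqxx /= => /IH h /h ->.
Qed.

Lemma skip_num n s : skip (enc_num n ++ s) = s.
Proof. by rewrite enc_numE; elim: (binary n) => //= b t ->. Qed.

Lemma skip_marker i s : skip (marker i ++ s) = s. Proof. by []. Qed.

Lemma ltd_num m n s t : ltd (enc_num m ++ s) (enc_num n ++ t) = nlt m n.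
Proof.
rewrite /nlt !enc_numE; elim: (binary m) (binary n) => [|b u IH] [|c v] //=.
by case: (b == c) => //; exact: IH.
Qed.

Lemma numb_num n s : numb true (enc_num n ++ s).
Proof.
rewrite enc_numE; move: (binary_last n).
suff H (p : bool) (u : seq bool) : last p u -> numb p ((dbl u ++ marker 0) ++ s) by apply: H.
by elim: u p => //= b u IH p /IH.
Qed.

Lemma numbP s : numb true s -> exists n s', s = enc_num n ++ s'.
Proof.
suff H (p : bool) : numb p s -> exists (ds : seq bool) s', s = dbl ds ++ marker 0 ++ s' /\ last p ds.
  move=> /H[ds [s' [-> hl]]]; exists (bval ds), s'.
  by rewrite enc_numE binaryK // catA.
have [n] := ubnP (size s); elim: n s p => // n IH [|[] [|b s]] p //=.
- by case: b; case: s => [|[] [|[] s]] //= _ hp; exists [::], s.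
- move=> h /IH[]; first lia.
  by move=> ds [s' [-> hl]]; exists (b :: ds), s'.
Qed.

Lemma prefixP_cat (u s : seq bool) : prefix u s -> exists s', s = u ++ s'.
Proof. by move/prefixP. Qed.

Definition ss (s : seq bool) : seq (seq bool) := sufs (size s) s.

Lemma sufs_fuel B s : size s <= B -> sufs B s = ss s.
Proof.
rewrite /ss; have [n] := ubnP (size s); elim: n s B => // n IH [|b s] [|B] //= hn hB.
have h := size_skip (b :: s); rewrite /= in h.
by congr (_ :: _); rewrite IH ?[RHS]IH //; lia.
Qed.

Lemma ss_cons s : s != [::] -> ss s = s :: ss (skip s).
Proof.
case: s => // b s _; rewrite {1}/ss [LHS]/= sufs_fuel //.
by have := size_skip (b :: s).
Qed.

Lemma ss_num n s : ss (enc_num n ++ s) = (enc_num n ++ s) :: ss s.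
Proof. by rewrite ss_cons ?skip_num // enc_numE; case: (dbl _). Qed.

Lemma ss_marker i s : ss (marker i ++ s) = (marker i ++ s) :: ss s.
Proof. by rewrite ss_cons. Qed.

Definition encs (fs : seq ifact) (d : seq nat) : seq bool := enc_uidb (UIDB fs d).

Lemma encs_cons f fs d : encs (f :: fs) d = enc_fact f ++ encs fs d.
Proof. exact: (esym (catA _ _ _)). Qed.

Lemma encs_nil d : encs [::] d = marker 4 ++ flatten (map enc_num d).
Proof. by []. Qed.

Fixpoint tails (T : Type) (s : seq T) : seq (seq T) :=
  if s is _ :: s' then s :: tails s' else [::].

Definition filt (i : nat) (s : seq bool) : seq (seq bool) :=
  [seq x <- ss s | prefix (marker i) x].

Lemma prefix_num i n s : i \in [:: 3; 4] -> prefix (marker i) (enc_num n ++ s) = false.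
Proof.
rewrite enc_numE !inE => /orP[] /eqP ->; case: (binary n) => [|b u] //=.
Qed.

Lemma filt_num i n s : i \in [:: 3; 4] -> filt i (enc_num n ++ s) = filt i s.
Proof. by move=> hi; rewrite /filt ss_num /= prefix_num. Qed.

Lemma filt_term i t s : i \in [:: 3; 4] -> filt i (enc_term t ++ s) = filt i s.
Proof.
move=> hi; have E j n : j \in [:: 1; 2] ->
    filt i ((marker j ++ enc_num n) ++ s) = filt i s.
  move=> hj; rewrite -catA -(filt_num n s hi) {1}/filt ss_marker /=.
  by move: hi hj; rewrite !inE => /orP[] /eqP -> /orP[] /eqP ->.
by case: t => n; apply: E.
Qed.

Lemma filt_skip_fact i f s : i \in [:: 3; 4] ->
  filt i (skip (enc_fact f ++ s)) = filt i s.
Proof.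
move=> hi; rewrite enc_factE skip_marker filt_num //.
by elim: (f.2) => //= t ts IH; rewrite -catA filt_term.
Qed.

Lemma filt_cons i s : s != [::] -> filt i s =
  if prefix (marker i) s then s :: filt i (skip s) else filt i (skip s).
Proof. by move=> hs; rewrite /filt ss_cons. Qed.

(** At an item boundary marker 3 occurs only where a fact begins, so quantification over suffixes
    guarded by it is quantification over facts. *)
Lemma filt3_encs fs d : filt 3 (encs fs d) = map (encs^~ d) (tails fs).
Proof.
elim: fs => [|f fs IH].
  rewrite encs_nil filt_cons // skip_marker [prefix _ _]/=.
  by elim: d => // n d IH; rewrite [flatten _]/= filt_num.
rewrite encs_cons filt_cons; last by [].
rewrite filt_skip_fact // IH ifT ?enc_factE ?prefix_prefix //.
by rewrite -enc_factE -encs_cons.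
Qed.

Lemma filt4_encs fs d : filt 4 (encs fs d) = [:: encs [::] d].
Proof.
elim: fs => [|f fs IH].
  rewrite encs_nil filt_cons // prefix_prefix skip_marker; congr (_ :: _).
  by elim: d => // n d IH; rewrite [flatten _]/= filt_num.
rewrite encs_cons filt_cons; last by [].
by rewrite filt_skip_fact // IH ifF.
Qed.

Lemma ss_nums d : ss (flatten (map enc_num d)) =
  map (fun d' => flatten (map enc_num d')) (tails d).
Proof. by elim: d => // n d IH; rewrite [flatten _]/= ss_num IH. Qed.

Definition okf (f : ifact) : bool := (f.1 == 0) && (size f.2 == 6).
Definition trm (f : ifact) (p : nat) : term := nth (inl 0) f.2 p.
Definition tn (t : term) : nat := match t with inl c => c | inr z => z end.
Definition is_const (t : term) : bool := if t is inl _ then true else false.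

(* Item [koff p] of an encoded fact is the kind of its term number [p]; the
   next item is the number of that term. *)
Definition koff (p : nat) : nat := 2 * p + 2.

Lemma skip_term t s : skip (skip (enc_term t ++ s)) = s.
Proof.
by case: t => n; rewrite -[enc_term _ ++ s]/((_ ++ enc_num n) ++ s) -catA
  skip_marker skip_num.
Qed.

Lemma iter_koff f s p : p <= size f.2 ->
  iter (koff p) skip (enc_fact f ++ s) =
  flatten (map enc_term (drop p f.2)) ++ s.
Proof.
move=> hp; rewrite /koff iterD enc_factE -[iter 2 _ _]/(skip (skip _)).
rewrite skip_marker skip_num.
elim: p (f.2) hp => [|p IH] [|t ts] // hp.
rewrite mulnS addnC iterD -[flatten _]/(enc_term t ++ flatten (map enc_term ts)).
by rewrite -(catA (enc_term t)) -[iter 2 _ _]/(skip (skip _)) skip_term IH.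
Qed.

Lemma iter_koff_term f s p : p < size f.2 ->
  exists s', iter (koff p) skip (enc_fact f ++ s) = enc_term (trm f p) ++ s'.
Proof.
move=> hp; rewrite iter_koff 1?ltnW // (drop_nth (inl 0)) //=.
by eexists; rewrite -catA.
Qed.

Lemma iter_noff f s p : p < size f.2 ->
  exists s', iter (koff p).+1 skip (enc_fact f ++ s) = enc_num (tn (trm f p)) ++ s'.
Proof.
move=> hp; have [s' E] := iter_koff_term s hp; rewrite iterS E; exists s'.
by case: (trm f p) => n; rewrite /enc_term -catA.
Qed.

Lemma enc_term_kind (t : term) s :
  prefix (marker 1) (enc_term t ++ s) = is_const t /\
  prefix (marker 2) (enc_term t ++ s) = ~~ is_const t.
Proof. by case: t => n; split; rewrite /= ?prefix0s. Qed.

Definition FImp f g := FNot (FAnd f (FNot g)).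
Definition FOr f g := FImp (FNot f) g.
Definition FTrue := FPre [::] 0 0.
Definition FAnds (fs : seq fm) : fm := foldr FAnd FTrue fs.
Definition FEx m i f := FNot (FAll m i (FNot f)).
Definition FEqn (p i q j : nat) : fm :=
  FAnd (FNot (FLt p i q j)) (FNot (FLt q j p i)).
Definition noff (p : nat) : nat := (koff p).+1.
(** With [m = 0] all facts of the string are covered; with [m = 1], on a string that begins with a
    fact, the strictly later ones. *)
Definition allF m i l g := FAll m i (FImp (FPre (marker 3) 0 l) g).
Definition exF m i l g := FEx m i (FAnd (FPre (marker 3) 0 l) g).

Section Semantics.

Variable B : nat.
Implicit Types (l : nat) (e : nat -> seq bool).

Lemma sat_imp l e f g : sat B l e (FImp f g) = (sat B l e f ==> sat B l e g).
Proof. by rewrite /= negb_and negbK implybE. Qed.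

Lemma sat_or l e f g : sat B l e (FOr f g) = sat B l e f || sat B l e g.
Proof. by rewrite sat_imp implybE /= negbK. Qed.

Lemma sat_and l e f g : sat B l e (FAnd f g) = sat B l e f && sat B l e g.
Proof. by []. Qed.

Lemma sat_not l e f : sat B l e (FNot f) = ~~ sat B l e f.
Proof. by []. Qed.

Lemma sat_ands l e fs : sat B l e (FAnds fs) = all (sat B l e) fs.
Proof. by elim: fs => [|f fs IH] /=; rewrite ?prefix0s ?IH. Qed.

Lemma sat_ex l e m i f : sat B l e (FEx m i f) =
  has (fun s => sat B l.+1 (upd e l s) f) (sufs B (iter m skip (e i))).
Proof. by rewrite /= -has_predC; apply: eq_has => s /=; rewrite negbK. Qed.

Lemma sat_eqn l e p i q j m n s t :
  iter p skip (e i) = enc_num m ++ s -> iter q skip (e j) = enc_num n ++ t ->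
  sat B l e (FEqn p i q j) = (m == n).
Proof. by move=> Ei Ej; rewrite /= Ei Ej !ltd_num nlt_eq. Qed.

Definition reads e i (f : ifact) : Prop := exists s, e i = enc_fact f ++ s.

Lemma okf_size f p : okf f -> p < 6 -> p < size f.2.
Proof. by case/andP=> _ /eqP ->. Qed.

Lemma sat_eqn_fact l e p i q j f g : okf f -> okf g -> reads e i f -> reads e j g ->
  p < 6 -> q < 6 ->
  sat B l e (FEqn (noff p) i (noff q) j) = (tn (trm f p) == tn (trm g q)).
Proof.
move=> okf_ okg [s Es] [t Et] hp hq.
have [s' Es'] := iter_noff s (okf_size okf_ hp).
have [t' Et'] := iter_noff t (okf_size okg hq).
by apply: sat_eqn; rewrite ?Es ?Et; eauto.
Qed.

Lemma sat_lt_fact l e p i q j f g : okf f -> okf g -> reads e i f -> reads e j g ->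
  p < 6 -> q < 6 ->
  sat B l e (FLt (noff p) i (noff q) j) = nlt (tn (trm f p)) (tn (trm g q)).
Proof.
move=> okf_ okg [s Es] [t Et] hp hq.
have [s' Es'] := iter_noff s (okf_size okf_ hp).
have [t' Et'] := iter_noff t (okf_size okg hq).
by rewrite [LHS]/= Es Et -!iterS Es' Et' ltd_num.
Qed.

Lemma sat_kind l e p i f : okf f -> reads e i f -> p < 6 ->
  sat B l e (FPre (marker 1) (koff p) i) = is_const (trm f p) /\
  sat B l e (FPre (marker 2) (koff p) i) = ~~ is_const (trm f p).
Proof.
move=> okf_ [s Es] hp; have [s' Es'] := iter_koff_term s (okf_size okf_ hp).
have [h1 h2] := enc_term_kind (trm f p) s'.
rewrite -[sat _ _ _ _]/(prefix (marker 1) (iter (koff p) skip (e i))).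
rewrite -[sat _ _ _ (FPre (marker 2) _ _)]/(prefix (marker 2) (iter (koff p) skip (e i))).
by rewrite Es Es'.
Qed.

Lemma all_sufs m i l e g s : size (e i) <= B -> s = iter m skip (e i) ->
  sat B l e (FAll m i g) = all (fun s => sat B l.+1 (upd e l s) g) (ss s).
Proof.
move=> hB ->; rewrite /= sufs_fuel //.
exact: leq_trans (size_skips _ _) hB.
Qed.

Lemma upd_at l e s : upd e l s l = s. Proof. by rewrite /upd eqxx. Qed.

Lemma all_guard m i l e g u (P : seq bool -> bool) :
  size (e i) <= B ->
  (forall s, sat B l.+1 (upd e l s) g = P s) ->
  sat B l e (FAll m i (FImp (FPre u 0 l) g)) =
  all P [seq x <- ss (iter m skip (e i)) | prefix u x].
Proof.
move=> hB HP; rewrite (all_sufs _ _ hB (erefl _)) all_filter.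
by apply: eq_all => s; rewrite sat_imp HP /= upd_at.
Qed.

(** A bound variable holds the whole suffix, so the quantified property may also speak of the later
    facts; sortedness needs this. *)
Fixpoint alltails (R : ifact -> seq ifact -> bool) (fs : seq ifact) : bool :=
  if fs is f :: fs' then R f fs' && alltails R fs' else true.

Lemma alltails_all P fs : alltails (fun f _ => P f) fs = all P fs.
Proof. by elim: fs => //= f fs ->. Qed.

Lemma alltails_pairwise r fs : alltails (fun f => all (r f)) fs = pairwise r fs.
Proof. by elim: fs => //= f fs ->. Qed.

Lemma all_tails (fs : seq ifact) d (Q : seq bool -> bool) R :
  size (encs fs d) <= B ->
  (forall f fs', okf f -> all okf fs' -> size (encs (f :: fs') d) <= B ->
     Q (encs (f :: fs') d) = R f fs') ->
  all okf fs -> all Q (map (encs^~ d) (tails fs)) = alltails R fs.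
Proof.
move=> hB H; elim: fs hB => [|f fs IH] // hB /andP[hf hfs].
rewrite [LHS]/= H // IH //.
by apply: leq_trans hB; rewrite encs_cons size_cat; lia.
Qed.

Lemma sat_allF_tails l e i g fs d R :
  e i = encs fs d -> size (e i) <= B -> all okf fs ->
  (forall f fs', okf f -> all okf fs' -> size (encs (f :: fs') d) <= B ->
     sat B l.+1 (upd e l (encs (f :: fs') d)) g = R f fs') ->
  sat B l e (allF 0 i l g) = alltails R fs.
Proof.
move=> Ei hB ok HR; rewrite (@all_guard _ _ _ _ _ _
  (fun s => sat B l.+1 (upd e l s) g)) // Ei -/(filt 3 _) filt3_encs.
by apply: all_tails; rewrite -?Ei.
Qed.

Lemma sat_allF l e i g fs d P :
  e i = encs fs d -> size (e i) <= B -> all okf fs ->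
  (forall f fs', okf f -> sat B l.+1 (upd e l (encs (f :: fs') d)) g = P f) ->
  sat B l e (allF 0 i l g) = all P fs.
Proof.
move=> Ei hB ok HP; rewrite -alltails_all; apply: sat_allF_tails Ei hB ok _.
by move=> f fs' hf _ _; apply: HP.
Qed.

Lemma sat_allF_rest l e i g f fs d P :
  e i = encs (f :: fs) d -> size (e i) <= B -> all okf fs ->
  (forall f fs', okf f -> sat B l.+1 (upd e l (encs (f :: fs') d)) g = P f) ->
  sat B l e (allF 1 i l g) = all P fs.
Proof.
move=> Ei hB ok HP; rewrite (@all_guard _ _ _ _ _ _
  (fun s => sat B l.+1 (upd e l s) g)) // Ei -/(filt 3 _) encs_cons.
rewrite -[iter 1 _ _]/(skip _) filt_skip_fact // filt3_encs.
rewrite -alltails_all; apply: all_tails => //; last by move=> f' fs' hf _ _; apply: HP.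
by apply: leq_trans hB; rewrite Ei encs_cons size_cat; lia.
Qed.

Lemma sat_exF l e i g fs d (P : ifact -> bool) :
  e i = encs fs d -> size (e i) <= B -> all okf fs ->
  (forall f fs', okf f -> sat B l.+1 (upd e l (encs (f :: fs') d)) g = P f) ->
  sat B l e (exF 0 i l g) = has P fs.
Proof.
move=> Ei hB ok HP.
have -> : sat B l e (exF 0 i l g) = ~~ sat B l e (allF 0 i l (FNot g)).
  rewrite sat_ex /= -has_predC; apply: eq_has => s /=.
  by rewrite negbK negbK.
rewrite (@sat_allF _ _ _ _ fs d (fun f => ~~ P f)) //.
  by rewrite -has_predC; apply: eq_has => f /=; rewrite negbK.
by move=> f fs' hf; rewrite sat_not HP.
Qed.

Lemma reads_upd l e f fs d : reads (upd e l (encs (f :: fs) d)) l f.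
Proof. by exists (encs fs d); rewrite upd_at encs_cons. Qed.

Lemma reads_updN l e s i f : i != l -> reads e i f -> reads (upd e l s) i f.
Proof. by move=> h [t Et]; exists t; rewrite updN. Qed.

(* Well-formedness: the string starts with a fact or with the domain marker,
   and so does the remainder after each fact. *)
Definition wf_fact (i : nat) : seq fm :=
  FPre (marker 0) 1 i :: FOr (FPre (marker 3) (koff 6) i) (FPre (marker 4) (koff 6) i) ::
  [seq FOr (FPre (marker 1) (koff p) i) (FPre (marker 2) (koff p) i) | p <- iota 0 6] ++
  [seq FNum (noff p) i | p <- iota 0 6].

Definition wf_enc (i l : nat) : fm :=
  FAnds [:: FOr (FPre (marker 3) 0 i) (FPre (marker 4) 0 i);
            allF 0 i l (FAnds (wf_fact l));
            FAll 0 i (FImp (FPre (marker 4) 0 l) (FAll 1 l (FNum 0 l.+1)))].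

Lemma all_consE (T : Type) (a : pred T) x s : all a (x :: s) = a x && all a s.
Proof. by []. Qed.

Lemma wf_fact_encs l e i f fs d : okf f -> e i = encs (f :: fs) d ->
  sat B l e (FAnds (wf_fact i)).
Proof.
move=> hf Ei; have okf_ := hf; have hr : reads e i f by exists (encs fs d); rewrite Ei encs_cons.
rewrite sat_ands /wf_fact 2!all_consE; apply/and3P; split.
- rewrite -[sat _ _ _ _]/(prefix (marker 0) (skip (e i))) Ei encs_cons enc_factE skip_marker; case/andP: hf => /eqP -> _.
  exact: (prefix_prefix (marker 0)).
- rewrite sat_or.
  rewrite -![sat _ _ _ _]/(prefix _ (iter (koff 6) skip (e i))) Ei encs_cons.
  rewrite iter_koff; last by case/andP: hf => _ /eqP ->.
  rewrite drop_oversize; last by case/andP: hf => _ /eqP ->.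
  case: fs {Ei hr} => [|g fs]; first by rewrite orbC encs_nil prefix_prefix.
  by rewrite encs_cons enc_factE prefix_prefix.
have am (F : nat -> fm) : (forall p, p < 6 -> sat B l e (F p)) ->
    all (sat B l e) (map F (iota 0 6)).
  move=> HF; rewrite all_map; apply/allP => p; rewrite mem_iota => hp; exact: HF.
rewrite all_cat; apply/andP; split; apply: am => // p hp.
  rewrite sat_or.
  by have [-> ->] := sat_kind l okf_ hr hp; rewrite orbN.
have [s Es] := hr; have [s' Es'] := iter_noff s (okf_size okf_ hp).
by rewrite -[sat _ _ _ _]/(numb true (iter (noff p) skip (e i))) Es Es' numb_num.
Qed.

Lemma sat_wf_encs l e i fs d : i < l -> e i = encs fs d -> size (e i) <= B ->
  all okf fs -> sat B l e (wf_enc i l).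
Proof.
move=> hi Ei hB ok; rewrite sat_ands !all_consE; apply/and4P; split=> //.
- rewrite sat_or -![sat _ _ _ _]/(prefix _ (e i)) Ei.
  case: fs {Ei ok} => [|g fs]; first by rewrite orbC encs_nil prefix_prefix.
  by rewrite encs_cons enc_factE prefix_prefix.
- rewrite (@sat_allF _ _ _ _ fs d predT) ?all_predT //.
  by move=> f fs' hf; rewrite (@wf_fact_encs _ _ _ f fs' d) ?upd_at.
- rewrite (@all_guard _ _ _ _ _ _
    (fun s => sat B l.+1 (upd e l s) (FAll 1 l (FNum 0 l.+1)))) //.
  rewrite Ei -/(filt 4 _) filt4_encs all_consE andbT.
  have hd : size (encs [::] d) <= B.
    apply: leq_trans hB; rewrite Ei; elim: (fs) => // g gs IH.
    by rewrite encs_cons size_cat; lia.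
  rewrite (@all_sufs 1 _ _ _ _ (flatten (map enc_num d))) ?upd_at //.
  rewrite ss_nums; move: (upd e l (encs [::] d)) => e1 {Ei hd}.
  elim: d => // n d IH; rewrite [tails _]/= map_cons all_consE IH andbT.
  by rewrite -[sat _ _ _ _]/(numb true (upd e1 l.+1 _ l.+1)) upd_at numb_num.
Qed.

Definition fact_ok (s : seq bool) : Prop :=
  [/\ prefix (marker 0) (skip s),
      prefix (marker 3) (iter (koff 6) skip s) || prefix (marker 4) (iter (koff 6) skip s),
      forall p, p < 6 -> prefix (marker 1) (iter (koff p) skip s) ||
                         prefix (marker 2) (iter (koff p) skip s) &
      forall p, p < 6 -> numb true (iter (noff p) skip s)].

Lemma sat_fact_ok l e i : sat B l e (FAnds (wf_fact i)) -> fact_ok (e i).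
Proof.
rewrite sat_ands /wf_fact 2!all_consE all_cat => /and3P[h1 h2 /andP[h3 h4]].
have am (F : nat -> fm) : all (sat B l e) (map F (iota 0 6)) ->
    forall p, p < 6 -> sat B l e (F p).
  by rewrite all_map => /allP H p hp; apply: H; rewrite mem_iota.
split=> //; first by move: h2; rewrite sat_or.
  by move=> p hp; have := am _ h3 p hp; rewrite sat_or.
exact: am h4.
Qed.

Lemma parse_terms k s :
  (forall p, p < k -> (prefix (marker 1) (iter (2 * p) skip s) ||
                       prefix (marker 2) (iter (2 * p) skip s)) /\
                      numb true (iter (2 * p).+1 skip s)) ->
  exists ts, size ts = k /\ s = flatten (map enc_term ts) ++ iter (2 * k) skip s.
Proof.
elim: k s => [|k IH] s H; first by exists [::].
have [] := H 0 isT; rewrite muln0 -[iter 0 _ _]/s -[iter 1 _ _]/(skip s) => h1 h2.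
have [t [s2 Es]] : exists t s2, s = enc_term t ++ s2.
  case/orP: h1 h2 => /prefixP_cat[s1 ->]; rewrite skip_marker => /numbP[n [s2 ->]].
    by exists (inl n), s2; rewrite catA.
  by exists (inr n), s2; rewrite catA.
have sk m : iter (m + 2) skip s = iter m skip s2.
  by rewrite iterD Es -[iter 2 _ _]/(skip (skip _)) skip_term.
have [|ts [hts E2]] := IH s2.
  move=> p hp; have [] := H p.+1 hp.
  by rewrite mulnS addnC -!addSn !sk.
exists (t :: ts); split; first by rewrite /= hts.
rewrite -[flatten _]/(enc_term t ++ flatten (map enc_term ts)) mulnS addnC sk.
by rewrite -(catA (enc_term t)) -E2.
Qed.

Lemma filt_skips i m s (P : pred (seq bool)) :
  all P (filt i s) -> all P (filt i (iter m skip s)).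
Proof.
elim: m => // m IH /IH; rewrite iterS; set t := iter m skip s.
case: (eqVneq t [::]) => [->|ht] //; rewrite (filt_cons _ ht).
by case: ifP => //= _ /andP[].
Qed.

Lemma wf_parse s : prefix (marker 3) s || prefix (marker 4) s ->
  (forall u, u \in filt 3 s -> fact_ok u) ->
  all (fun u => all (numb true) (ss (skip u))) (filt 4 s) ->
  exists fs d, all okf fs /\ s = encs fs d.
Proof.
have [n] := ubnP (size s); elim: n s => // n IH s hn.
case/orP=> /prefixP_cat[s' Es] H3 H4.
  have s0 : s != [::] by rewrite Es.
  have [|h1 h2 h3 h4] := H3 s.
    by rewrite filt_cons // Es prefix_prefix inE eqxx.
  (* A fact has 14 items: its marker, the relation symbol, and a kind and a number for each of six
     terms. *)
  have hsz : size (iter (koff 6) skip s) < n.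
    rewrite -[koff 6]/14 (iterSr 13); apply: leq_ltn_trans (size_skips 13 (skip s)) _.
    by have := size_skip s; case: (s) s0 hn => //= b u _; lia.
  have [||fs [d [hok E]]] := IH _ hsz h2.
  - move=> u hu; apply: H3; move: hu; elim: (koff 6) => // m IHm.
    rewrite iterS; set t := iter m skip s in IHm *.
    case: (eqVneq t [::]) => [Et|ht]; first by move: IHm; rewrite Et.
    by move=> hu; apply: IHm; rewrite filt_cons //; case: ifP; rewrite ?inE hu ?orbT.
  - exact: filt_skips.
  have [s2 Es2] := prefixP_cat h1.
  have sk m : iter (m + 2) skip s = iter m skip s2.
    rewrite iterD -[iter 2 _ _]/(skip (skip _)) Es2.
    by rewrite -[_ ++ _]/(enc_num 0 ++ s2) skip_num.
  have [|ts [hts Ets]] := @parse_terms 6 s2.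
    move=> p hp; have := h3 p hp; have := h4 p hp.
    by rewrite /noff /koff -addSn !sk.
  exists ((0, ts) :: fs), d; split; first by rewrite /= hok andbT /okf /= hts.
  rewrite encs_cons -E enc_factE -[(0, ts).1]/0 -[(0, ts).2]/ts {1}Es.
  have Es' : s' = skip s by rewrite Es.
  congr (_ ++ _); rewrite Es' Es2 -[marker 0 ++ s2]/(enc_num 0 ++ s2).
  by congr (_ ++ _); rewrite {1}Ets -[koff 6]/(2 * 6 + 2) sk.
exists [::]; move: H4; rewrite filt_cons ?Es // prefix_prefix skip_marker all_consE skip_marker.
case/andP=> H _.
suff [d ->] : exists d, s' = flatten (map enc_num d) by exists d.
have [m] := ubnP (size s'); elim: m s' H {Es} => // m IHm t H hm.
case: (eqVneq t [::]) => [->|ht]; first by exists [::].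
move: H; rewrite ss_cons // all_consE => /andP[/numbP[k [t' Et]]].
rewrite Et skip_num => H; have [|d Ed] := IHm t' H.
  move: hm; rewrite Et size_cat; have : 0 < size (enc_num k); last by lia.
  by rewrite enc_numE size_cat addnC.
by exists (k :: d); rewrite /= -Ed.
Qed.

Lemma size_sufs k s u : u \in sufs k s -> size u <= size s.
Proof.
elim: k s => [|k IH] [|b s] //=; rewrite inE => /orP[/eqP -> //|/IH h].
by apply: leq_trans h _; have := size_skip (b :: s); rewrite /=; lia.
Qed.

Lemma wf_sound l e i : i < l -> size (e i) <= B -> sat B l e (wf_enc i l) ->
  exists fs d, all okf fs /\ e i = encs fs d.
Proof.
move=> hi hB; rewrite sat_ands !all_consE => /and4P[h1 h2 h3 _].
apply: wf_parse.
- by move: h1; rewrite sat_or.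
- move=> u hu; move: h2; rewrite (@all_guard _ _ _ _ _ _
    (fun s => sat B l.+1 (upd e l s) (FAnds (wf_fact l)))) // => /allP /(_ u hu).
  by move/sat_fact_ok; rewrite upd_at.
move: h3; rewrite (@all_guard _ _ _ _ _ _
  (fun s => sat B l.+1 (upd e l s) (FAll 1 l (FNum 0 l.+1)))) //.
move=> /allP H; apply/allP => u hu; have := H u hu.
have hu' : size u <= B.
  by apply: leq_trans hB; move: hu; rewrite mem_filter => /andP[_ /size_sufs].
rewrite (@all_sufs 1 _ _ _ _ (skip u)) ?upd_at //; apply: sub_all => v.
by rewrite -[sat _ _ _ _]/(numb true (upd _ l.+1 v l.+1)) upd_at.
Qed.

End Semantics.

(** * Membership *)

Definition nums (f : ifact) : seq nat := map tn f.2.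

Lemma numsE f : okf f -> nums f = [seq tn (trm f p) | p <- iota 0 6].
Proof.
case/andP=> _ /eqP hf; apply: (@eq_from_nth _ 0); rewrite /nums !size_map ?size_iota //.
move=> i hi; rewrite (nth_map (inl 0)) // (nth_map 0) ?size_iota -?hf //.
by rewrite nth_iota -?hf.
Qed.

(* Variable 0 is the input, 1 a table of the valuation (a list of facts whose
   first two terms are a null and its value), 2 the sorted completion. *)
Fixpoint lexF (ps : seq nat) (i j : nat) : fm :=
  if ps is p :: ps' then
    FOr (FLt (noff p) i (noff p) j) (FAnd (FEqn (noff p) i (noff p) j) (lexF ps' i j))
  else FNot FTrue.

Definition instF (f y l : nat) : fm :=
  FAnds [seq FOr
    (FAnd (FPre (marker 1) (koff p) f) (FEqn (noff p) f (noff p) y))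
    (FAnd (FPre (marker 2) (koff p) f)
       (exF 0 1 l (FAnd (FEqn (noff 0) l (noff p) f) (FEqn (noff 1) l (noff p) y))))
  | p <- iota 0 6].

(** Any matching table entry is accepted for a null; this becomes evaluation under a valuation once
    the table is functional. *)
Definition inst (ft : seq ifact) (f y : ifact) : bool :=
  all (fun p => match trm f p with
    | inl c => c == tn (trm y p)
    | inr z => has (fun t => (tn (trm t 0) == z) && (tn (trm t 1) == tn (trm y p))) ft
    end) (iota 0 6).

Definition chk_ground := allF 0 2 3
  (FAnd (FAnds [seq FPre (marker 1) (koff p) 3 | p <- iota 0 6])
        (FNot (FAnds [seq FEqn (noff p) 3 (noff (p + 3)) 3 | p <- iota 0 3]))).
(** An empty domain part and, below, strict sorting leave each completion a single admissible output
    string. *)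
Definition chk_nodom := FAll 0 2 (FImp (FPre (marker 4) 0 3) (FAll 1 3 (FNot FTrue))).
Definition chk_sorted := allF 0 2 3 (allF 1 3 4 (lexF (iota 0 6) 3 4)).
Definition chk_fun := allF 0 1 3 (allF 0 1 4
  (FImp (FEqn (noff 0) 3 (noff 0) 4) (FEqn (noff 1) 3 (noff 1) 4))).
Definition chk_dom := allF 0 1 3
  (FEx 0 0 (FAnd (FPre (marker 4) 0 4) (FEx 1 4 (FEqn 0 5 (noff 1) 3)))).
Definition chk_sub := allF 0 0 3 (exF 0 2 4 (instF 3 4 5)).
Definition chk_sup := allF 0 2 3 (exF 0 0 4 (instF 4 3 5)).

Definition check : fm :=
  FAnds [:: wf_enc 0 3; wf_enc 1 3; wf_enc 2 3; chk_ground; chk_nodom; chk_sorted;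
            chk_fun; chk_dom; chk_sub; chk_sup].

Section CheckSemantics.

Variables (B : nat) (e : nat -> seq bool).
Variables (fw ft fy : seq ifact) (dw dt dy : seq nat).
Hypotheses (E0 : e 0 = encs fw dw) (E1 : e 1 = encs ft dt) (E2 : e 2 = encs fy dy).
Hypotheses (okw : all okf fw) (okt : all okf ft) (oky : all okf fy).
Hypotheses (B0 : size (e 0) <= B) (B1 : size (e 1) <= B) (B2 : size (e 2) <= B).

Lemma sat_lexF l e' ps i j f g : okf f -> okf g -> reads e' i f -> reads e' j g ->
  all (ltn^~ 6) ps ->
  sat B l e' (lexF ps i j) = lexs [seq tn (trm f p) | p <- ps] [seq tn (trm g p) | p <- ps].
Proof.
move=> hf hg ri rj; elim: ps => [|p ps IH]; first by rewrite /= prefix0s.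
case/andP=> hp hps; rewrite -[lexF _ _ _]/(FOr _ (FAnd _ (lexF ps i j))) sat_or sat_and.
rewrite (IH hps) (sat_lt_fact _ _ hf hg ri rj) // (sat_eqn_fact _ _ hf hg ri rj) //.
Qed.

Lemma sat_ands_map (T : Type) l e' (F : T -> fm) s :
  sat B l e' (FAnds (map F s)) = all (fun p => sat B l e' (F p)) s.
Proof. by rewrite sat_ands all_map. Qed.

Lemma sat_instF l e' f y i j : okf f -> okf y -> i < l -> j < l -> 1 < l ->
  reads e' i f -> reads e' j y -> e' 1 = e 1 ->
  sat B l e' (instF i j l) = inst ft f y.
Proof.
move=> hf hy hi hj h1 ri rj e1; rewrite sat_ands_map /inst.
apply: eq_in_all => p; rewrite mem_iota => /andP[_ hp].
rewrite sat_or [X in X || _]sat_and [X in _ || X]sat_and.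
have [-> ->] := sat_kind B l hf ri (hp : p < 6).
rewrite (sat_eqn_fact _ _ hf hy ri rj) //.
rewrite (@sat_exF B l e' 1 _ ft dt (fun t =>
  (tn (trm t 0) == tn (trm f p)) && (tn (trm t 1) == tn (trm y p)))) ?e1 //.
  by case: (trm f p) => z /=; rewrite ?andbF ?orbF.
move=> t ft' ht; rewrite sat_and.
have rt := reads_upd l e' t ft' dt.
have {}ri : reads (upd e' l (encs (t :: ft') dt)) i f.
  by apply: reads_updN ri; rewrite neq_ltn hi.
have {}rj : reads (upd e' l (encs (t :: ft') dt)) j y.
  by apply: reads_updN rj; rewrite neq_ltn hj.
by rewrite (sat_eqn_fact _ _ ht hf rt ri) // (sat_eqn_fact _ _ ht hy rt rj).
Qed.

Lemma sat_ground : sat B 3 e chk_ground =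
  all (fun y => all is_const y.2 && ~~ pat (nums y)) fy.
Proof.
apply: sat_allF E2 B2 oky _ => y fs hy.
have ry := reads_upd 3 e y fs dy.
rewrite sat_and sat_not !sat_ands_map numsE //; congr (_ && ~~ _).
  have hs : size y.2 = 6 by case/andP: hy => _ /eqP.
  have E : y.2 = [seq trm y p | p <- iota 0 6].
    apply: (@eq_from_nth _ (inl 0)); rewrite ?size_map ?size_iota // hs => i hi.
    by rewrite (nth_map 0) ?size_iota // nth_iota.
  rewrite [in RHS]E all_map; apply: eq_in_all => p; rewrite mem_iota => /andP[_ hp].
  by have [-> _] := sat_kind B 4 hy ry (hp : p < 6).
rewrite (eq_in_all (a2 := fun p => tn (trm y p) == tn (trm y (p + 3)))).
  by rewrite /= andbT.
move=> p; rewrite mem_iota => /andP[_ hp].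
by rewrite (sat_eqn_fact _ _ hy hy ry ry) //; move: hp; lia.
Qed.

Lemma sat_nodom : sat B 3 e chk_nodom = (dy == [::]).
Proof.
rewrite (@all_guard _ _ _ _ _ _ _ (fun s => sat B 4 (upd e 3 s) (FAll 1 3 (FNot FTrue)))) //.
rewrite E2 -/(filt 4 _) filt4_encs all_consE andbT.
rewrite (@all_sufs _ 1 _ _ _ _ (flatten (map enc_num dy))); first last.
- by rewrite upd_at encs_nil.
- rewrite upd_at; apply: leq_trans B2; rewrite E2; elim: (fy) => // g gs IH.
  by rewrite encs_cons size_cat; lia.
rewrite ss_nums; case: (dy) => // n d.
by rewrite [tails _]/= map_cons all_consE sat_not /= prefix0s.
Qed.

Lemma sat_sorted : sat B 3 e chk_sorted =
  pairwise (fun y y' => lexs (nums y) (nums y')) fy.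
Proof.
rewrite -alltails_pairwise; apply: sat_allF_tails E2 B2 oky _ => y fs hy hfs hB.
apply: (@sat_allF_rest _ _ _ _ _ y fs dy) => //; rewrite ?upd_at //.
move=> y' fs' hy'; rewrite (@sat_lexF _ _ _ _ _ y y') ?numsE //.
  by apply: reads_updN => //; exact: reads_upd.
exact: reads_upd.
Qed.

Lemma sat_fun : sat B 3 e chk_fun = all (fun t => all (fun t' =>
  (tn (trm t 0) == tn (trm t' 0)) ==> (tn (trm t 1) == tn (trm t' 1))) ft) ft.
Proof.
apply: sat_allF E1 B1 okt _ => t fs ht.
apply: (@sat_allF _ _ _ _ _ ft dt) => // t' fs' ht'; rewrite sat_imp.
have rt' := reads_upd 4 (upd e 3 (encs (t :: fs) dt)) t' fs' dt.
have rt : reads (upd (upd e 3 (encs (t :: fs) dt)) 4 (encs (t' :: fs') dt)) 3 t.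
  by apply: reads_updN => //; exact: reads_upd.
by rewrite !(sat_eqn_fact _ _ ht ht' rt rt').
Qed.

Lemma sat_dom : sat B 3 e chk_dom = all (fun t => tn (trm t 1) \in dw) ft.
Proof.
apply: sat_allF E1 B1 okt _ => t fs ht.
have rt := reads_upd 3 e t fs dt.
set e' := upd e 3 _ in rt *.
have -> : sat B 4 e' (FEx 0 0 (FAnd (FPre (marker 4) 0 4) (FEx 1 4 (FEqn 0 5 (noff 1) 3)))) =
    ~~ sat B 4 e' (FAll 0 0 (FImp (FPre (marker 4) 0 4)
                     (FNot (FEx 1 4 (FEqn 0 5 (noff 1) 3))))).
  by rewrite sat_ex /= -has_predC; apply: eq_has => s /=; rewrite !negbK.
rewrite (@all_guard _ _ _ _ _ _ _ (fun s => sat B 5 (upd e' 4 s)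
  (FNot (FEx 1 4 (FEqn 0 5 (noff 1) 3))))) //.
rewrite -[e' 0]/(e 0) E0 -/(filt 4 _) filt4_encs all_consE andbT sat_not negbK sat_ex.
rewrite upd_at encs_nil -[iter 1 _ _]/(skip _) skip_marker.
have hd : size (flatten (map enc_num dw)) <= B.
  apply: leq_trans B0; rewrite E0; elim: (fw) => [|g gs IH].
    by rewrite encs_nil size_cat; lia.
  by rewrite encs_cons size_cat; lia.
rewrite sufs_fuel // ss_nums; set e4 := upd e' 4 _.
elim: (dw) => // n d IH; rewrite [tails _]/= map_cons.
rewrite -[has _ (_ :: _)]/(_ || has _ _) IH inE; congr (_ || _).
have [s Es] : reads (upd e4 5 (flatten (map enc_num (n :: d)))) 3 t.
  by do 2 apply: reads_updN => //.
have [s' Es'] := iter_noff s (okf_size ht (isT : 1 < 6)).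
rewrite (@sat_eqn _ _ _ 0 _ _ _ n (tn (trm t 1)) (flatten (map enc_num d)) s').
- by rewrite eq_sym.
- by rewrite -[iter 0 _ _]/(upd _ _ _ _) upd_at.
- by rewrite Es -Es'.
Qed.

Lemma sat_sub : sat B 3 e chk_sub = all (fun f => has (inst ft f) fy) fw.
Proof.
apply: sat_allF E0 B0 okw _ => f fs hf.
apply: (@sat_exF _ _ _ _ _ fy dy) => // y fs' hy.
apply: (@sat_instF _ _ f y) => //; last exact: reads_upd.
by apply: reads_updN => //; exact: reads_upd.
Qed.

Lemma sat_sup : sat B 3 e chk_sup = all (fun y => has (fun f => inst ft f y) fw) fy.
Proof.
apply: sat_allF E2 B2 oky _ => y fs hy.
apply: (@sat_exF _ _ _ _ _ fw dw) => // f fs' hf.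
apply: (@sat_instF _ _ f y) => //; first exact: reads_upd.
by apply: reads_updN => //; exact: reads_upd.
Qed.

Definition valid : bool :=
  [&& all (fun y => all is_const y.2 && ~~ pat (nums y)) fy, dy == [::],
      pairwise (fun y y' => lexs (nums y) (nums y')) fy,
      all (fun t => all (fun t' =>
        (tn (trm t 0) == tn (trm t' 0)) ==> (tn (trm t 1) == tn (trm t' 1))) ft) ft,
      all (fun t => tn (trm t 1) \in dw) ft,
      all (fun f => has (inst ft f) fy) fw &
      all (fun y => has (fun f => inst ft f y) fw) fy].

Lemma sat_check : sat B 3 e check = valid.
Proof.
rewrite sat_ands 3!all_consE.
rewrite (@sat_wf_encs _ _ _ 0 fw dw) // (@sat_wf_encs _ _ _ 1 ft dt) //.
rewrite (@sat_wf_encs _ _ _ 2 fy dy) // !andTb 7!all_consE /valid.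
by rewrite sat_ground sat_nodom sat_sorted sat_fun sat_dom sat_sub sat_sup andbT.
Qed.

End CheckSemantics.

(** * Completions as sorted lists, and tables as valuations *)

Definition cfact (y : seq nat) : ifact := (0, map inl y).

Lemma nums_cfact y : nums (cfact y) = y.
Proof. by rewrite /nums -map_comp map_id. Qed.

Lemma okf_cfact y : okf (cfact y) = (size y == 6).
Proof. by rewrite /okf eqxx size_map. Qed.

Lemma cfact_nums f : okf f -> all is_const f.2 -> cfact (nums f) = f.
Proof.
case: f => r s /andP[/eqP /= -> _] hs; congr (_, _).
by elim: s hs => //= -[c|z] s IH // /IH ->.
Qed.

Lemma all_const_cfact y : all is_const (cfact y).2.
Proof. by elim: y. Qed.

Section Rows.

Definition lexle (s t : seq nat) : bool := (s == t) || lexs s t.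

Lemma lexle_total : total lexle.
Proof.
move=> s t; rewrite /lexle; case h1: (lexs s t); rewrite ?orbT //.
case h2: (lexs t s); rewrite ?orbT //.
by rewrite (lexs_total (negbT h1) (negbT h2)) eqxx.
Qed.

Lemma lexle_trans : transitive lexle.
Proof.
move=> t s u /orP[/eqP -> //|h1] /orP[/eqP <-|h2].
  by rewrite /lexle h1 orbT.
by rewrite /lexle (lexs_trans h1 h2) orbT.
Qed.

Definition rows (C : {fset gfact}) : seq (seq nat) :=
  sort lexle (undup (map snd (enum_fset C))).

Definition all_zero (C : {fset gfact}) : Prop := forall g, g \in C -> g.1 = 0.

Lemma mem_rows C y : all_zero C -> (y \in rows C) = ((0, y) \in C).
Proof.
move=> HC; rewrite mem_sort mem_undup; apply/mapP/idP => [[[r s] hg ->]|hg].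
  by move: (HC _ hg) => /= <-.
by exists (0, y).
Qed.

Lemma rows_inj C C' : all_zero C -> all_zero C' -> rows C = rows C' -> C = C'.
Proof.
move=> HC HC' E; apply/fsetP => -[r y]; case: (eqVneq r 0) => [->|hr].
  by rewrite -!mem_rows // E.
by apply/idP/idP => [/HC|/HC'] /= h; rewrite h eqxx in hr.
Qed.

Lemma rows_pairwise C : pairwise lexs (rows C).
Proof.
have := sort_uniq lexle (undup (map snd (enum_fset C))); rewrite undup_uniq -/(rows C).
have := sort_sorted lexle_total (undup (map snd (enum_fset C))); rewrite -/(rows C).
rewrite (sorted_pairwise lexle_trans) uniq_pairwise => h1 h2.
have : pairwise [rel s t | lexle s t && (s != t)] (rows C).
  by rewrite pairwise_relI h1 h2.
by apply: sub_pairwise => s t /= /andP[/orP[->|]].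
Qed.

Lemma rows_unique C s : pairwise lexs s -> s =i rows C -> s = rows C.
Proof.
have hp := rows_pairwise C; rewrite -!sorted_pairwise in hp *; try exact: lexs_trans.
by move=> hs; apply: (irr_sorted_eq lexs_trans lexs_irr).
Qed.

Lemma size_rows nu D : size (rows (completion nu D)) <= size (idb_facts D).
Proof.
rewrite size_sort; apply: leq_trans (size_undup _) _.
rewrite size_map -[size _]/(#|` completion nu D|)%fset size_seq_fset.
by apply: leq_trans (size_undup _) _; rewrite size_map.
Qed.

End Rows.

Lemma completion_zero nu D : over_schema q0 D -> all_zero (completion nu D).
Proof.
move=> /over_q0 HD g; rewrite mem_completion => /mapP[f /HD[h _] ->]; exact: h.
Qed.

Definition tval (ft : seq ifact) (z : nat) : nat :=
  tn (trm (nth (0, [::]) ft (find (fun t => tn (trm t 0) == z) ft)) 1).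

Definition functional (ft : seq ifact) : bool := all (fun t => all (fun t' =>
  (tn (trm t 0) == tn (trm t' 0)) ==> (tn (trm t 1) == tn (trm t' 1))) ft) ft.

(** In a functional table the first entry found for a null speaks for all its entries. *)
Lemma has_tval ft z v : functional ft -> has (fun t => tn (trm t 0) == z) ft ->
  has (fun t => (tn (trm t 0) == z) && (tn (trm t 1) == v)) ft = (v == tval ft z).
Proof.
move=> /allP hfun hz; have hn := nth_find (0, [::]) hz; rewrite has_find in hz.
have hm := mem_nth (0, [::]) hz; apply/hasP/eqP => [[t ht /andP[/eqP h0 /eqP <-]]|->].
  have /allP /(_ _ ht) := hfun _ hm.
  by rewrite (eqP hn) h0 eqxx => /eqP <-.
by eexists; first exact: hm; rewrite hn eqxx.
Qed.

(** The hypothesis hides how the table represents [nu]: it holds for the graph of a given valuation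
    and for [tval] of a verified table, so both directions of membership use the lemma. *)
Lemma inst_ground nu ft f y : okf f -> okf y ->
  (forall z v, inr z \in f.2 ->
     has (fun t => (tn (trm t 0) == z) && (tn (trm t 1) == v)) ft = (v == nu z)) ->
  inst ft f y = (nums y == map (val_term nu) f.2).
Proof.
move=> hf hy H; rewrite (numsE hy).
have hs : size f.2 = 6 by case/andP: hf => _ /eqP.
have -> : map (val_term nu) f.2 = [seq val_term nu (trm f p) | p <- iota 0 6].
  apply: (@eq_from_nth _ 0); rewrite ?size_map ?size_iota // hs => i hi.
  by rewrite (nth_map (inl 0)) ?hs // (nth_map 0) ?size_iota // nth_iota.
have -> : inst ft f y = all (fun p => tn (trm y p) == val_term nu (trm f p)) (iota 0 6).
  apply: eq_in_all => p; rewrite mem_iota => /andP[_ hp].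
  have : trm f p \in f.2 by apply: mem_nth; rewrite hs.
  case: (trm f p) => [c _|z /H ->] //=; exact: eq_sym.
elim: (iota 0 6) => //= p s ->; exact: (esym (eqseq_cons _ _ _ _)).
Qed.

(** Zeros pad the rows to arity six, so that the table has the format of an encoded database and
    [wf_enc] applies to it. *)
Definition graph (nu : nat -> nat) (zs : seq nat) : seq (seq nat) :=
  [seq [:: z; nu z; 0; 0; 0; 0] | z <- zs].

Lemma has_graph nu zs z v : z \in zs ->
  has (fun t => (tn (trm t 0) == z) && (tn (trm t 1) == v)) (map cfact (graph nu zs)) =
  (v == nu z).
Proof.
move=> hz; apply/hasP/eqP => [[t /mapP[s /mapP[z' _ ->] ->]]|->] /=.
  by case/andP=> /eqP <- /eqP.
exists (cfact [:: z; nu z; 0; 0; 0; 0]); last by rewrite /= !eqxx.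
by apply/map_f/mapP; exists z.
Qed.

Lemma over_okf D : over_schema q0 D <-> all okf (idb_facts D).
Proof.
rewrite over_q0; split=> [H|/allP H f /H /andP[/eqP -> /eqP ->] //].
by apply/allP => f /H[h1 h2]; rewrite /okf h1 h2.
Qed.

Lemma not_models C : all_zero C -> (forall y, (0, y) \in C -> ~~ pat y) <-> ~ models q0 C.
Proof.
move=> HC; rewrite models_q0; split=> [H [a [b [c /H]]]|H y hy]; first by rewrite /= !eqxx.
apply/negP => hp; apply: H; move: y hy hp.
case=> [|a [|b [|c [|a' [|b' [|c' [|]]]]]]] //= hy.
by case/and3P=> /eqP ea /eqP eb /eqP ec; exists a, b, c; rewrite {2}ea {2}eb {2}ec.
Qed.

Lemma valid_graph nu D : over_schema q0 D ->
  (forall z, z \in nulls D -> nu z \in idb_dom D) -> ~ models q0 (completion nu D) ->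
  valid (idb_facts D) (map cfact (graph nu (nulls D)))
        (map cfact (rows (completion nu D))) (idb_dom D) [::].
Proof.
move=> HD Hnu HM; have HC := completion_zero (nu := nu) HD.
have HE f y : f \in idb_facts D -> okf y ->
    inst (map cfact (graph nu (nulls D))) f y = (nums y == map (val_term nu) f.2).
  move=> hf hy; apply: inst_ground => //.
    by move/over_okf: HD => /allP; apply.
  by move=> z v hz; apply: has_graph; apply/mem_nulls; exists f.
have mem_C y : (y \in rows (completion nu D)) =
    ((0, y) \in [seq (f.1, map (val_term nu) f.2) | f <- idb_facts D]).
  by rewrite mem_rows // mem_completion.
have okC y : y \in rows (completion nu D) -> okf (cfact y).
  rewrite mem_C => /mapP[f hf [_ ->]]; rewrite okf_cfact size_map.
  by move/over_okf: HD => /allP /(_ _ hf) /andP[].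
apply/and5P; split; [| by []| | |apply/and3P; split].
- apply/allP => _ /mapP[y hy ->]; rewrite all_const_cfact nums_cfact.
  by move/not_models: HM; apply=> //; rewrite -mem_rows.
- rewrite pairwise_map; have := rows_pairwise (completion nu D).
  by apply: sub_pairwise => s t; rewrite /relpre /= !nums_cfact.
- apply/allP => _ /mapP[_ /mapP[z _ ->] ->]; apply/allP => _ /mapP[_ /mapP[z' _ ->] ->] /=.
  by apply/implyP => /eqP ->.
- by apply/allP => _ /mapP[_ /mapP[z hz ->] ->] /=; apply: Hnu.
- apply/allP => f hf; apply/hasP; exists (cfact (map (val_term nu) f.2)).
    apply: map_f; rewrite mem_C; apply/mapP; exists f => //.
    by move/over_q0: HD => /(_ _ hf)[->].
  rewrite HE ?nums_cfact // okf_cfact size_map.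
  by move/over_okf: HD => /allP /(_ _ hf) /andP[].
- apply/allP => _ /mapP[y hy ->]; have := hy; rewrite mem_C => /mapP[f hf [_ E]].
  by apply/hasP; exists f => //; rewrite HE ?okC // nums_cfact E.
Qed.

Lemma valid_completion D ft fy dy : over_schema q0 D -> all okf fy ->
  valid (idb_facts D) ft fy (idb_dom D) dy ->
  exists nu, [/\ forall z, z \in nulls D -> nu z \in idb_dom D,
    ~ models q0 (completion nu D), fy = map cfact (rows (completion nu D)) & dy = [::]].
Proof.
move=> HD oky /and5P[/allP hgr /eqP -> hsort hfun /and3P[/allP hdom /allP hsub /allP hsup]].
have okw := over_okf D; have {}okw := (okw.1 HD); have HC nu := completion_zero (nu := nu) HD.
(* A null missing from the table would leave the facts that contain it without an instance, contrary
   to [hsub]. *)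
have hz z : z \in nulls D -> has (fun t => tn (trm t 0) == z) ft.
  case/mem_nulls => f hf hz; have /hasP[y _ /allP hi] := hsub f hf.
  have hs : size f.2 = 6 by move/allP: okw => /(_ _ hf) /andP[_ /eqP].
  have := hi (index (inr z) f.2); rewrite mem_iota -hs index_mem hz => /(_ isT).
  rewrite /trm nth_index // => /hasP[t ht /andP[h _]].
  by apply/hasP; exists t.
exists (tval ft); set C := completion _ _.
have HE f y : f \in idb_facts D -> y \in fy ->
    inst ft f y = (nums y == map (val_term (tval ft)) f.2).
  move=> hf hy; apply: inst_ground; [exact: (allP okw) | exact: (allP oky) |].
  by move=> z v hzf; apply: has_tval => //; apply: hz; apply/mem_nulls; exists f.
have memC y : (y \in map nums fy) = ((0, y) \in C).
  rewrite mem_completion; apply/mapP/mapP => [[y' hy ->]|[f hf [_ ->]]].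
    have /hasP[f hf] := hsup _ hy; rewrite HE // => /eqP ->; exists f => //.
    by move/over_q0: HD => /(_ _ hf)[->].
  by have /hasP[y' hy] := hsub f hf; rewrite HE // => /eqP <-; exists y'.
have E : fy = map cfact (map nums fy).
  rewrite -map_comp -[LHS]map_id; apply/eq_in_map => y hy /=; rewrite cfact_nums //.
    exact: (allP oky).
  by have /andP[] := hgr _ hy.
split=> //.
- move=> z /hz h; apply: hdom; apply: mem_nth; by rewrite -has_find.
- apply/(not_models (HC _)) => y hy; have := memC y; rewrite hy => /mapP[y' {}hy ->].
  by have /andP[] := hgr _ hy.
rewrite {1}E; congr map; apply: rows_unique; first by rewrite pairwise_map.
by move=> y; rewrite memC (mem_rows _ (HC _)).
Qed.

(** * Polynomial size of the guessed strings *)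

Lemma size_encs_cfact ys n : 4 <= n -> size ys <= n ->
  all (fun y => (size y == 6) && all (fun c => size (enc_num c) <= n) y) ys ->
  size (encs (map cfact ys) [::]) <= n ^ 4.
Proof.
move=> hn hys H.
(* Marker and relation symbol take four bits each; each of the six terms takes a marker and at most
   [n] bits. *)
have hf y : (size y == 6) && all (fun c => size (enc_num c) <= n) y ->
    size (enc_fact (cfact y)) <= 32 + 6 * n.
  case/andP=> /eqP hs ha; rewrite -[enc_fact _]cats0 enc_factE !size_cat addn0.
  suff : size (flatten (map enc_term (cfact y).2)) <= size y * (4 + n).
    by rewrite hs; have -> : size (enc_num (cfact y).1) = 4 by []; rewrite /=; lia.
  elim: y ha {hs} => // c y IH /andP[hc /IH h].
  rewrite -[flatten _]/((marker 1 ++ enc_num c) ++ flatten (map enc_term (cfact y).2)).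
  rewrite 2!size_cat -[size (marker 1)]/4 -[size (c :: y)]/(size y).+1 mulSn.
  by apply: leq_add h; rewrite leq_add2l.
have : size (encs (map cfact ys) [::]) <= size ys * (32 + 6 * n) + 4.
  elim: ys H {hys} => // y ys IH /andP[/hf h /IH {}IH].
  rewrite map_cons encs_cons size_cat -[size (y :: ys)]/(size ys).+1 mulSn -addnA.
  exact: leq_add.
(* From [4 <= n]: 32 is at most 8n here, and 16 n^2 is at most n^4 below, which is the origin of the
   exponent 4. *)
have : size ys * (32 + 6 * n) <= n * (14 * n).
  by apply: leq_mul => //; lia.
have : 16 * (n * n) <= (n * n) * (n * n).
  by rewrite leq_mul2r (leq_mul hn hn) orbT.
have : 4 <= n * n by rewrite (leq_mul (_ : 2 <= n) (_ : 2 <= n)) //; lia.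
rewrite !expnS expn0; lia.
Qed.

Lemma size_encs_dom fs d : size (flatten (map enc_num d)) + 4 <= size (encs fs d).
Proof.
elim: fs => [|f fs IH]; first by rewrite encs_nil size_cat addnC.
by rewrite encs_cons size_cat; lia.
Qed.

Lemma size_flatten_mem (T : eqType) (F : T -> seq bool) s x : x \in s ->
  size (F x) <= size (flatten (map F s)).
Proof.
elim: s => // y s IH; rewrite inE /= size_cat => /orP[/eqP <-|/IH]; lia.
Qed.

Lemma size_dom_num D v : v \in idb_dom D -> size (enc_num v) <= size (enc_uidb D).
Proof.
case: D => fs d hv; apply: leq_trans (size_flatten_mem enc_num hv) _.
exact: leq_trans (leq_addr 4 _) (size_encs_dom fs d).
Qed.

Lemma size_fact_num D f t : f \in idb_facts D -> t \in f.2 ->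
  size (enc_num (tn t)) <= size (enc_uidb D).
Proof.
move=> hf ht; apply: (@leq_trans (size (enc_term t))).
  by case: t {ht} => c; rewrite [size (enc_term _)]size_cat leq_addl.
apply: leq_trans (size_flatten_mem enc_term ht) _.
apply: (@leq_trans (size (enc_fact f))); first by rewrite [size (enc_fact f)]size_cat size_cat addnA leq_addl.
by apply: leq_trans (size_flatten_mem enc_fact hf) _; rewrite [size (enc_uidb D)]size_cat leq_addr.
Qed.

Lemma size_facts D : size (idb_facts D) + size (nulls D) <= size (enc_uidb D).
Proof.
case: D => fs d; rewrite /enc_uidb /= size_cat.
have : size (nulls (UIDB fs d)) <= size (flatten (map nulls_of_fact fs)) by exact: size_undup.
suff : size fs + size (flatten (map nulls_of_fact fs)) <=
       size (flatten (map enc_fact fs)) by lia.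
elim: fs => // -[r ts] fs IH; rewrite /= !size_cat /=.
suff : size (nulls_of_fact (r, ts)) <= size (flatten (map enc_term ts)) by lia.
rewrite /nulls_of_fact /=; elim: ts => // t ts IHt; rewrite /= !size_cat.
by case: t => c; rewrite /= ?size_cat /=; lia.
Qed.

Definition row_code (C : {fset gfact}) : seq bool := encs (map cfact (rows C)) [::].

Lemma row_code_inj C C' : all_zero C -> all_zero C' -> row_code C = row_code C' -> C = C'.
Proof.
move=> HC HC' /enc_uidb_inj[E]; apply: rows_inj => //.
by apply: (inj_map _ E); apply: (can_inj nums_cfact).
Qed.

Lemma witness_bounds nu D : over_schema q0 D ->
  (forall z, z \in nulls D -> nu z \in idb_dom D) ->
  size (encs (map cfact (graph nu (nulls D))) [::]) <= size (enc_uidb D) ^ 4 /\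
  size (row_code (completion nu D)) <= size (enc_uidb D) ^ 4.
Proof.
move=> HD Hnu; set n := size (enc_uidb D).
(* Every encoding contains the four bits of the domain marker. *)
have n4 : 4 <= n.
  by rewrite /n; case: (D) => fs d; have := size_encs_dom fs d; rewrite /encs; lia.
have hn := size_facts D.
have hv z : z \in nulls D -> size (enc_num (nu z)) <= n.
  by move/Hnu; apply: size_dom_num.
split; apply: size_encs_cfact => //.
- by rewrite size_map; lia.
- apply/allP => _ /mapP[z hz ->]; rewrite /= hv //=.
  have -> : size (enc_num z) <= n.
    by have /mem_nulls[f hf ht] := hz; apply: (size_fact_num hf ht).
  by rewrite /= n4.
- by apply: leq_trans (size_rows _ _) _; lia.
apply/allP => y; rewrite mem_rows ?mem_completion; last exact: completion_zero.
case/mapP=> f hf [_ ->]; rewrite size_map.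
have [_ ->] := (over_q0 D).1 HD f hf; rewrite eqxx all_map.
apply/allP => -[c|z] ht /=; first exact: (size_fact_num hf ht).
by apply: hv; apply/mem_nulls; exists f.
Qed.

Theorem CompU_neg_SpanP : SpanP (CompU_neg q0).
Proof.
apply: (@SpanP_sat check 4) => // x N.
have xN : size x <= N ^ 4.
  apply: (@leq_trans N); first exact: leq_maxr.
  by rewrite -{1}(expn1 N) leq_pexp2l // leq_maxl.
pose e T Y := fun i => nth [::] [:: x; T; Y] i.
have sound T Y : size T <= N ^ 4 -> size Y <= N ^ 4 -> sat (2 * N ^ 4) 3 (e T Y) check ->
    exists D ft fy dy, [/\ over_schema q0 D, x = enc_uidb D, Y = encs fy dy,
      all okf fy & valid (idb_facts D) ft fy (idb_dom D) dy].
  move=> hT hY hs; have := hs; rewrite sat_ands 3!all_consE => /and4P[h0 h1 h2 _].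
  have [||fw [dw [okw E0]]] := wf_sound _ _ h0 => //; first by rewrite /e /=; lia.
  have [||ft [dt [okt E1]]] := wf_sound _ _ h1 => //; first by rewrite /e /=; lia.
  have [||fy [dy [oky E2]]] := wf_sound _ _ h2 => //; first by rewrite /e /=; lia.
  exists (UIDB fw dw), ft, fy, dy; split=> //; first exact/over_okf.
  rewrite -[valid _ _ _ _ _](@sat_check (2 * N ^ 4) _ _ _ _ _ _ _ E0 E1 E2 okw okt oky) //.
  - by rewrite /e /=; lia.
  - by rewrite /e /=; lia.
  - by rewrite /e /=; lia.
case: (excluded_middle_informative
         (exists D, over_schema q0 D /\ enc_uidb D = x)); last first.
  (* If the input encodes no database over the schema, every guess fails [wf_enc] on it, in
     accordance with the value 0 of [CompU_neg]. *)
  move=> nx; exists [::].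
    by rewrite /CompU_neg; case: excluded_middle_informative.
  move=> s; split=> // -[T [Y [hT hY hs _]]]; case: nx.
  by have [D [? [? [? [HD Ex _ _ _]]]]] := sound T Y hT hY hs; exists D.
case=> D [HD Ex].
pose F := enum_fset [fset C in completions D | classical_bool (~ models q0 C)]%fset.
have memF C : C \in F <-> C \in completions D /\ ~ models q0 C.
  rewrite /F !inE /=; split=> [/andP[h /classical_boolP] //|[-> h]].
  exact/classical_boolP.
have FZ C : C \in F -> all_zero C.
  by case/memF=> /completionsP[nu _ ->] _; exact: completion_zero.
(* [rev] reflects that the output stack is read from its bottom. *)
exists [seq rev (row_code C) | C <- F].
  rewrite -Ex CompU_neg_enc // undup_id ?size_map //.
  rewrite map_inj_in_uniq ?fset_uniq // => C C' hC hC' /(can_inj revK).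
  by apply: row_code_inj; apply: FZ.
move=> s; split.
  case/mapP=> C /memF[/completionsP[nu Hnu ->] HM] ->.
  exists (encs (map cfact (graph nu (nulls D))) [::]), (row_code (completion nu D)).
  have [] := witness_bounds HD Hnu; rewrite Ex => hT hY.
  have xN4 : size x ^ 4 <= N ^ 4 by rewrite leq_exp2r // /N /fuel_of leq_maxr.
  split=> //; try by lia.
  have E0 : e (encs (map cfact (graph nu (nulls D))) [::]) (row_code (completion nu D)) 0 =
    encs (idb_facts D) (idb_dom D) by rewrite /e /= -Ex; case: (D).
  rewrite (sat_check E0 (erefl _) (erefl _)) ?valid_graph //; try by rewrite /e /=; lia.
  - exact/over_okf.
  - by apply/allP => _ /mapP[_ /mapP[z _ ->] ->].
  apply/allP => _ /mapP[y hy ->]; rewrite okf_cfact.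
  move: hy; rewrite mem_rows ?mem_completion; last exact: completion_zero.
  by case/mapP=> f hf [_ ->]; rewrite size_map; have [_ ->] := (over_q0 D).1 HD f hf.
case=> T [Y [hT hY hs ->]].
have [D' [ft [fy [dy [HD' Ex' EY oky hv]]]]] := sound T Y hT hY hs.
move: Ex'; rewrite -Ex => /enc_uidb_inj ED; subst D'.
have [nu [Hnu HM Ey Ed]] := valid_completion HD oky hv.
apply/mapP; exists (completion nu D); last by rewrite EY Ey Ed.
by apply/memF; split=> //; apply/completionsP; exists nu.
Qed.

Theorem theorem6p6 :
  exists q : bcq, cq_wf q /\ self_join_free q /\ SpanP_complete (CompU_neg q).
Proof.
exists q0; split; [by [] | split; [by [] | split]].
  exact: CompU_neg_SpanP.
exact: CompU_neg_hard.
Qed.
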